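(* Let $b\in\mathbb{C}$, $b\neq 0$, and let $\alpha,\bar\alpha,\Delta,\bar\Delta\in\mathbb{C}$ with $\Delta,\bar\Delta\neq0$. Nontrivial extensions of conformal $\mathcal{W}(b)$-modules of the form $$0\longrightarrow M(\bar\alpha,\bar\Delta)\longrightarrow E\longrightarrow M(\alpha,\Delta)\longrightarrow0$$ exist only if $\alpha=\bar\alpha$. For each $\alpha=\bar\alpha\in\mathbb{C}$, these nontrivial extensions are given, up to equivalence, by $E=\mathbb{C}[\partial]v_{\bar\Delta}\oplus\mathbb{C}[\partial]v_\Delta$ with $M(\alpha,\bar\Delta)=\mathbb{C}[\partial]v_{\bar\Delta}$ a submodule and $$L_\lambda v_\Delta=(\partial+\alpha+\Delta\lambda)v_\Delta+f(\partial+\alpha,\lambda)v_{\bar\Delta},\qquad H_\lambda v_\Delta=g(\partial+\alpha,\lambda)v_{\bar\Delta},$$ where either $g=0$ and $f$ is as in list (I), or the values of $\Delta,\bar\Delta$ and the pair $(f,g)$ are, up to a nonzero scalar multiple (of the pair), as in list (II). All $\Delta,\bar\Delta$ in the lists are nonzero. Notation: $p_4(\partial,\lambda)=\lambda^2(4\partial^3+6\partial^2\lambda-\partial\lambda^2+\bar\Delta\lambda^3)$, $p_5(\partial,\lambda)=\partial^4\lambda^2-10\partial^2\lambda^4-17\partial\lambda^5-8\lambda^6$, $p_6(\partial,\lambda)=\partial^4\lambda^3-(2\bar\Delta+3)\partial^3\lambda^4-3\bar\Delta\partial^2\lambda^5-(3\bar\Delta+1)\partial\lambda^6-(\bar\Delta+\tfrac{9}{28})\lambda^7$.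 List (I) ($g=0$; any $b\neq0$; $f$ is a nonzero scalar multiple of the given polynomial): - $\Delta=\bar\Delta$, $f=c_0+c_1\lambda$ with $(c_0,c_1)\neq(0,0)$; - $\Delta-\bar\Delta=2$, $f=\lambda^2(2\partial+\lambda)$; - $\Delta-\bar\Delta=3$, $f=\partial\lambda^2(\partial+\lambda)$; - $\Delta-\bar\Delta=4$, $f=p_4$; - $\Delta=1$, $\bar\Delta=-4$, $f=p_5$; - $\Delta=\frac72\pm\frac{\sqrt{19}}2$, $\Delta-\bar\Delta=6$, $f=p_6$. List (II) (throughout, $c_0,c_1\in\mathbb{C}$ are arbitrary and $a_0\in\mathbb{C}$, $a_0\neq0$): (1) $b=-1$: (i) $\Delta-\bar\Delta=-1$, $f=0$, $g=a_0$; (ii) $\Delta-\bar\Delta=0$, $f=c_0+c_1\lambda$, $g=\partial+\bar\Delta\lambda$. (2) $b=1$: (i) $\Delta-\bar\Delta=1$, $f=0$, $g=a_0$; (ii) $\Delta-\bar\Delta=2$, $f=c_0\lambda^2(2\partial+\lambda)$, $g=\partial-\bar\Delta\lambda$; (iii) $\Delta=1,\bar\Delta=-2$, $f=c_0\partial\lambda^2(\partial+\lambda)$, $g=\partial^2+3\partial\lambda+2\lambda^2$. (3) $b=2$: (i) $\Delta-\bar\Delta=2$, $f=c_0\lambda^2(2\partial+\lambda)$, $g=a_0$; (ii) $\Delta-\bar\Delta=3$, $f=c_0\partial\lambda^2(\partial+\lambda)$, $g=\partial-\frac12\bar\Delta\lambda$; (iii) $\Delta=1,\bar\Delta=-3$,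 $f=c_0\lambda^2(4\partial^3+6\partial^2\lambda-\partial\lambda^2-3\lambda^3)$, $g=\partial^2+\frac52\partial\lambda+\frac32\lambda^2$. (4) $b=3$: (i) $\Delta-\bar\Delta=3$, $f=c_0\partial\lambda^2(\partial+\lambda)$, $g=a_0$; (ii) $\Delta-\bar\Delta=4$, $f=c_0p_4$, $g=\partial-\frac13\bar\Delta\lambda$; (iii) $\Delta=1,\bar\Delta=-4$, $f=c_0p_5$, $g=\partial^2+\frac73\partial\lambda+\frac43\lambda^2$. (5) $b=4$: (i) $\Delta-\bar\Delta=4$, $f=c_0p_4$, $g=a_0$; (ii) $\Delta-\bar\Delta=5$, $f=0$, $g=\partial-\frac14\bar\Delta\lambda$; (ii') $\Delta=1,\bar\Delta=-4$, $f=c_0p_5$, $g=\partial+\lambda$; (iii) $\Delta=1,\bar\Delta=-5$, $f=0$, $g=\partial^2+\frac94\partial\lambda+\frac54\lambda^2$. (6) $b=5$: (i) $\Delta-\bar\Delta=5$, $f=0$, $g=a_0$; (i') $\Delta=1,\bar\Delta=-4$, $f=c_0p_5$, $g=a_0$; (ii) $\Delta-\bar\Delta=6$, $f=0$, $g=\partial-\frac15\bar\Delta\lambda$; (ii') $\Delta=\frac72\pm\frac{\sqrt{19}}2$, $\Delta-\bar\Delta=6$, $f=c_0p_6$, $g=\partial-\frac15\bar\Delta\lambda$; (iii) $\Delta=1,\bar\Delta=-6$, $f=0$, $g=\partial^2+\frac{11}5\partial\lambda+\frac65\lambda^2$. (7) $b=6$: (i) $\Delta-\bar\Delta=6$, $f=0$,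 $g=a_0$; (i') $\Delta=\frac72\pm\frac{\sqrt{19}}2$, $\bar\Delta=-\frac52\pm\frac{\sqrt{19}}2$ (same sign), $f=c_0p_6$, $g=a_0$; (ii) $\Delta-\bar\Delta=7$, $f=0$, $g=\partial-\frac16\bar\Delta\lambda$; (iii) $\Delta=1,\bar\Delta=-7$, $f=0$, $g=\partial^2+\frac{13}6\partial\lambda+\frac76\lambda^2$. (8) $b=-\frac23$: $f=0$ and (i) $\Delta-\bar\Delta=-\frac23$, $g=1$; (ii) $\Delta-\bar\Delta=\frac13$, $g=\partial+\frac32\bar\Delta\lambda$; (iii) $\Delta=1,\bar\Delta=-\frac13$, $g=\partial^2+\frac12\partial\lambda-\frac12\lambda^2$; (iv) $\Delta=\frac53,\bar\Delta=-\frac23$, $g=\partial^3+\frac32\partial^2\lambda-\frac32\partial\lambda^2-\lambda^3$. (9) $b\notin\{-1,1,2,3,4,5,6,-\frac23\}$: $f=0$ and (i) $\Delta-\bar\Delta=b$, $g=1$; (ii) $\Delta-\bar\Delta=1+b$, $g=\partial-\frac1b\bar\Delta\lambda$; (iii) $\Delta=1,\bar\Delta=-1-b$, $g=\partial^2-\left(\frac1b+\frac2b\bar\Delta\right)\partial\lambda-\frac1b\bar\Delta\lambda^2$.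
   Context: For $b\in\mathbb{C}$, $\mathcal{W}(b)=\mathbb{C}[\partial]L\oplus\mathbb{C}[\partial]H$ is the free rank 2 Lie conformal algebra with $\lambda$-brackets $[L_\lambda L]=(\partial+2\lambda)L$, $[L_\lambda H]=(\partial+(1-b)\lambda)H$, $[H_\lambda H]=0$. A conformal module $M$ over a Lie conformal algebra $R$ is a $\mathbb{C}[\partial]$-module with a $\mathbb{C}$-linear map $R\to \mathrm{End}_{\mathbb{C}}(M)\otimes_{\mathbb{C}}\mathbb{C}[\lambda]$, $a\mapsto a_\lambda$, such that $a_\lambda b_\mu-b_\mu a_\lambda=[a_\lambda b]_{\lambda+\mu}$ and $(\partial a)_\lambda=[\partial,a_\lambda]=-\lambda a_\lambda$ for all $a,b\in R$; in particular $a_\lambda(\partial v)=(\partial+\lambda)a_\lambda v$. For $b\ne0$ and $\alpha,\Delta\in\mathbb{C}$ with $\Delta\neq0$, $M(\alpha,\Delta)=\mathbb{C}[\partial]v_\Delta$ is the $\mathcal{W}(b)$-module, free of rank one over $\mathbb{C}[\partial]$, with $L_\lambda v_\Delta=(\partial+\alpha+\Delta\lambda)v_\Delta$, $H_\lambda v_\Delta=0$. When $\Delta=\bar\Delta$, the symbols $v_\Delta$ and $v_{\bar\Delta}$ in $E$ still denote two distinct free generators. An extension of $W$ by $V$ is an exact sequence of $R$-modules $0\to V\to E\to W\to0$. Two extensions $E,E'$ of $W$ by $V$ are equivalent if there is a module homomorphism $\psi:E\to E'$ which together with the identity maps of $V$ and $W$ gives a commutative diagram of exact sequences. An extension is trivial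 if it is equivalent to the direct sum $V\oplus W$, and nontrivial otherwise.
   Formalization: List (II)(9) as printed misses a case: for b=-2, Δ=Δ̄=1, f=c_0+c_1λ with g=∂²+(3/2)∂λ+(1/2)λ² also gives nontrivial extensions (printed: only f=0). The formal list adds exactly this case; all else is as printed. *)

(* Defs.v *)
From HB Require Import structures.
From mathcomp Require Import all_boot all_order all_algebra.
From mathcomp Require Import polyXY complex reals.

Set Implicit Arguments.
Unset Strict Implicit.
Unset Printing Implicit Defensive.

Import Order.TTheory GRing.Theory Num.Theory.
Local Open Scope ring_scope.

Definition complexes (R : realType) : numClosedFieldType := R[i]%C.

(* A C[d]-module is an lmodType over {poly C}, with d acting as 'X *: _ and a *)
(* scalar c acting as c%:P *: _.  An element of M[lambda] is given by the     *)
(* sequence of its coefficients (finitely supported); accordingly a           *)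
(* lambda-bracket or lambda-action is a map  act : A -> nat -> M -> M  with   *)
(*    a_lambda v = \sum_n lambda^n (act a n v).                               *)

Section Conformal.
Variable C : numClosedFieldType.

Definition mul_lambda (M : zmodType) (u : nat -> M) (n : nat) : M :=
  if n is k.+1 then u k else 0.

(* Finiteness of the sum over n is required for each a and v separately: since *)
(* a_lambda (d v) = (d + lambda) a_lambda v, the degree in lambda is never     *)
(* bounded uniformly in v on a nontrivial free module.                         *)
(* cm_commutator is the coefficient of lambda^i mu^j in                        *)
(*    a_lambda b_mu - b_mu a_lambda = [a_lambda b]_(lambda + mu),              *)
(* where (lambda + mu)^(i - k + j) contributes 'C(i - k + j, j).               *)
Record conformal_module (A M : lmodType {poly C})
    (br : A -> nat -> A -> A) (act : A -> nat -> M -> M) : Prop := {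
  cm_finite : forall a v, exists N, forall n, (N <= n)%N -> act a n v = 0;
  cm_linearl : forall (c : C) a a' n v,
    act (c%:P *: a + a') n v = c%:P *: act a n v + act a' n v;
  cm_linearr : forall (c : C) a n v v',
    act a n (c%:P *: v + v') = c%:P *: act a n v + act a n v';
  cm_dl : forall a n v,
    act ('X *: a) n v = - mul_lambda (fun k => act a k v) n;
  cm_dr : forall a n v,
    'X *: act a n v - act a n ('X *: v) = - mul_lambda (fun k => act a k v) n;
  cm_commutator : forall a b i j v,
    act a i (act b j v) - act b j (act a i v) =
    \sum_(k < i.+1) act (br a k b) (i - k + j)%N v *+ 'C(i - k + j, j) }.

Record conformal_hom (A M N : lmodType {poly C}) (actM : A -> nat -> M -> M)
    (actN : A -> nat -> N -> N) (h : M -> N) : Prop := {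
  ch_linear : linear h;
  ch_act : forall a n v, h (actM a n v) = actN a n (h v) }.

Record is_extension (A V W E : lmodType {poly C}) (br : A -> nat -> A -> A)
    (actV : A -> nat -> V -> V) (actW : A -> nat -> W -> W)
    (actE : A -> nat -> E -> E) (i : V -> E) (p : E -> W) : Prop := {
  ext_module : conformal_module br actE;
  ext_hom_inj : conformal_hom actV actE i;
  ext_hom_proj : conformal_hom actE actW p;
  ext_injective : injective i;
  ext_exact : forall x, p x = 0 <-> exists v, x = i v;
  ext_surjective : forall w, exists x, p x = w }.

Definition ext_equiv (A V W E E' : lmodType {poly C})
    (actE : A -> nat -> E -> E) (i : V -> E) (p : E -> W)
    (actE' : A -> nat -> E' -> E') (i' : V -> E') (p' : E' -> W) : Prop :=
  exists psi : E -> E', [/\ conformal_hom actE actE' psi,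
    forall v, psi (i v) = i' v & forall x, p' (psi x) = p x].

Definition dsum_act (A V W : lmodType {poly C}) (actV : A -> nat -> V -> V)
    (actW : A -> nat -> W -> W) (a : A) (n : nat) (x : V * W) : V * W :=
  (actV a n x.1, actW a n x.2).

Definition trivial_extension (A V W E : lmodType {poly C})
    (actV : A -> nat -> V -> V) (actW : A -> nat -> W -> W)
    (actE : A -> nat -> E -> E) (i : V -> E) (p : E -> W) : Prop :=
  ext_equiv actE i p (dsum_act actV actW) (fun v => (v, 0)) snd.

End Conformal.

Section Modules.
Variable C : numClosedFieldType.
Implicit Types (b alpha Delta Deltabar : C) (f g : {poly {poly C}}).

(* C[d][lambda] is {poly {poly C}}: the outer variable is lambda. *)
Local Notation dd := ('X%:P : {poly {poly C}}).
Local Notation ll := ('X : {poly {poly C}}).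
Local Notation cst c := (c%:P%:P : {poly {poly C}}).

(* The sesquilinear extension to free modules of a lambda-operation given on   *)
(* generators by (e_k)_lambda v_i = \sum_j (G k i j)(d, lambda) v_j, so that   *)
(* (P(d) e_k)_lambda (Q(d) v_i) = P(-lambda) Q(d + lambda) (e_k)_lambda v_i.   *)
(* Here poly_XaY Q is Q(d + lambda).                                           *)
Definition sesqui (r m : nat) (G : 'I_r -> 'M[{poly {poly C}}]_m)
    (a : 'rV[{poly C}]_r) (n : nat) (v : 'rV[{poly C}]_m) : 'rV[{poly C}]_m :=
  map_mx (fun q : {poly {poly C}} => q`_n)
    (\sum_k ((a 0 k)^:P \Po (- 'X)) *: (map_mx (@poly_XaY C) v *m G k)).

(* W(b): the generators of index 0 and 1 are L and H.  By skew-symmetry        *)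
(* [H_lambda L] = - [L_(- lambda - d) H] = ((1 - b) lambda - b d) H.           *)
Definition W_gen b (k : 'I_2) : 'M[{poly {poly C}}]_(1 + 1) :=
  if k == 0 then
    block_mx (dd + 2%:R * ll)%:M 0 0 (dd + cst (1 - b) * ll)%:M
  else block_mx 0 (cst (1 - b) * ll - cst b * dd)%:M 0 0.

Definition W_bracket b := sesqui (W_gen b).

Definition LM alpha Delta : {poly {poly C}} := dd + cst alpha + cst Delta * ll.

Definition M_gen alpha Delta (k : 'I_2) : 'M[{poly {poly C}}]_1 :=
  if k == 0 then (LM alpha Delta)%:M else 0.

Definition M_act alpha Delta := sesqui (M_gen alpha Delta).

(* f(d + alpha, lambda) *)
Definition shift_d alpha f : {poly {poly C}} :=
  map_poly (fun q : {poly C} => q \Po ('X + alpha%:P)) f.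

(* The generators of index 0 and 1 are v_Deltabar and v_Delta. *)
Definition E_gen alpha Delta Deltabar f g (k : 'I_2) :
    'M[{poly {poly C}}]_(1 + 1) :=
  if k == 0 then
    block_mx (LM alpha Deltabar)%:M 0
             (shift_d alpha f)%:M (LM alpha Delta)%:M
  else block_mx 0 0 (shift_d alpha g)%:M 0.

Definition E_act alpha Delta Deltabar f g :=
  sesqui (E_gen alpha Delta Deltabar f g).

Definition E_inj (v : 'rV[{poly C}]_1) : 'rV[{poly C}]_(1 + 1) := row_mx v 0.

Definition E_proj (x : 'rV[{poly C}]_(1 + 1)) : 'rV[{poly C}]_1 := rsubmx x.

Definition p2 : {poly {poly C}} := ll ^+ 2 * (2%:R * dd + ll).

Definition p3 : {poly {poly C}} := dd * ll ^+ 2 * (dd + ll).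

Definition p4 Deltabar : {poly {poly C}} :=
  ll ^+ 2 * (4%:R * dd ^+ 3 + 6%:R * dd ^+ 2 * ll - dd * ll ^+ 2
             + cst Deltabar * ll ^+ 3).

Definition p5 : {poly {poly C}} :=
  dd ^+ 4 * ll ^+ 2 - 10%:R * dd ^+ 2 * ll ^+ 4 - 17%:R * dd * ll ^+ 5
  - 8%:R * ll ^+ 6.

Definition p6 Deltabar : {poly {poly C}} :=
  dd ^+ 4 * ll ^+ 3 - cst (2%:R * Deltabar + 3%:R) * dd ^+ 3 * ll ^+ 4
  - cst (3%:R * Deltabar) * dd ^+ 2 * ll ^+ 5
  - cst (3%:R * Deltabar + 1) * dd * ll ^+ 6
  - cst (Deltabar + 9%:R / 28%:R) * ll ^+ 7.

Definition root19 (e : bool) : C := (-1) ^+ e * (sqrtC 19%:R / 2%:R).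

Definition b_special : seq C :=
  [:: -1; 1; 2%:R; 3%:R; 4%:R; 5%:R; 6%:R; - (2%:R / 3%:R)].

Variant list_I Delta Deltabar : {poly {poly C}} -> Prop :=
| I_0 (c0 c1 : C) of Delta = Deltabar & (c0, c1) != (0, 0) :
    list_I Delta Deltabar (cst c0 + cst c1 * ll)
| I_2 of Delta - Deltabar = 2%:R : list_I Delta Deltabar p2
| I_3 of Delta - Deltabar = 3%:R : list_I Delta Deltabar p3
| I_4 of Delta - Deltabar = 4%:R : list_I Delta Deltabar (p4 Deltabar)
| I_5 of Delta = 1 & Deltabar = - 4%:R : list_I Delta Deltabar p5
| I_6 (e : bool) of Delta = 7%:R / 2%:R + root19 e & Delta - Deltabar = 6%:R :
    list_I Delta Deltabar (p6 Deltabar).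

Variant list_II b Delta Deltabar :
    {poly {poly C}} -> {poly {poly C}} -> Prop :=
| II_1i (a0 : C) of b = -1 & Delta - Deltabar = -1 & a0 != 0 :
    list_II b Delta Deltabar 0 (cst a0)
| II_1ii (c0 c1 : C) of b = -1 & Delta - Deltabar = 0 :
    list_II b Delta Deltabar (cst c0 + cst c1 * ll) (dd + cst Deltabar * ll)

| II_2i (a0 : C) of b = 1 & Delta - Deltabar = 1 & a0 != 0 :
    list_II b Delta Deltabar 0 (cst a0)
| II_2ii (c0 : C) of b = 1 & Delta - Deltabar = 2%:R :
    list_II b Delta Deltabar (cst c0 * p2) (dd - cst Deltabar * ll)
| II_2iii (c0 : C) of b = 1 & Delta = 1 & Deltabar = - 2%:R :
    list_II b Delta Deltabar (cst c0 * p3)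
      (dd ^+ 2 + 3%:R * dd * ll + 2%:R * ll ^+ 2)

| II_3i (c0 a0 : C) of b = 2%:R & Delta - Deltabar = 2%:R & a0 != 0 :
    list_II b Delta Deltabar (cst c0 * p2) (cst a0)
| II_3ii (c0 : C) of b = 2%:R & Delta - Deltabar = 3%:R :
    list_II b Delta Deltabar (cst c0 * p3)
      (dd - cst (1 / 2%:R * Deltabar) * ll)
| II_3iii (c0 : C) of b = 2%:R & Delta = 1 & Deltabar = - 3%:R :
    list_II b Delta Deltabar
      (cst c0 * (ll ^+ 2 * (4%:R * dd ^+ 3 + 6%:R * dd ^+ 2 * ll
                            - dd * ll ^+ 2 - 3%:R * ll ^+ 3)))
      (dd ^+ 2 + cst (5%:R / 2%:R) * dd * ll + cst (3%:R / 2%:R) * ll ^+ 2)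

| II_4i (c0 a0 : C) of b = 3%:R & Delta - Deltabar = 3%:R & a0 != 0 :
    list_II b Delta Deltabar (cst c0 * p3) (cst a0)
| II_4ii (c0 : C) of b = 3%:R & Delta - Deltabar = 4%:R :
    list_II b Delta Deltabar (cst c0 * p4 Deltabar)
      (dd - cst (1 / 3%:R * Deltabar) * ll)
| II_4iii (c0 : C) of b = 3%:R & Delta = 1 & Deltabar = - 4%:R :
    list_II b Delta Deltabar (cst c0 * p5)
      (dd ^+ 2 + cst (7%:R / 3%:R) * dd * ll + cst (4%:R / 3%:R) * ll ^+ 2)

| II_5i (c0 a0 : C) of b = 4%:R & Delta - Deltabar = 4%:R & a0 != 0 :
    list_II b Delta Deltabar (cst c0 * p4 Deltabar) (cst a0)
| II_5ii of b = 4%:R & Delta - Deltabar = 5%:R :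
    list_II b Delta Deltabar 0 (dd - cst (1 / 4%:R * Deltabar) * ll)
| II_5ii' (c0 : C) of b = 4%:R & Delta = 1 & Deltabar = - 4%:R :
    list_II b Delta Deltabar (cst c0 * p5) (dd + ll)
| II_5iii of b = 4%:R & Delta = 1 & Deltabar = - 5%:R :
    list_II b Delta Deltabar 0
      (dd ^+ 2 + cst (9%:R / 4%:R) * dd * ll + cst (5%:R / 4%:R) * ll ^+ 2)

| II_6i (a0 : C) of b = 5%:R & Delta - Deltabar = 5%:R & a0 != 0 :
    list_II b Delta Deltabar 0 (cst a0)
| II_6i' (c0 a0 : C) of b = 5%:R & Delta = 1 & Deltabar = - 4%:R & a0 != 0 :
    list_II b Delta Deltabar (cst c0 * p5) (cst a0)
| II_6ii of b = 5%:R & Delta - Deltabar = 6%:R :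
    list_II b Delta Deltabar 0 (dd - cst (1 / 5%:R * Deltabar) * ll)
| II_6ii' (c0 : C) (e : bool) of b = 5%:R
    & Delta = 7%:R / 2%:R + root19 e & Delta - Deltabar = 6%:R :
    list_II b Delta Deltabar (cst c0 * p6 Deltabar)
      (dd - cst (1 / 5%:R * Deltabar) * ll)
| II_6iii of b = 5%:R & Delta = 1 & Deltabar = - 6%:R :
    list_II b Delta Deltabar 0
      (dd ^+ 2 + cst (11%:R / 5%:R) * dd * ll + cst (6%:R / 5%:R) * ll ^+ 2)

| II_7i (a0 : C) of b = 6%:R & Delta - Deltabar = 6%:R & a0 != 0 :
    list_II b Delta Deltabar 0 (cst a0)
| II_7i' (c0 a0 : C) (e : bool) of b = 6%:R
    & Delta = 7%:R / 2%:R + root19 e & Deltabar = - (5%:R / 2%:R) + root19 e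
    & a0 != 0 :
    list_II b Delta Deltabar (cst c0 * p6 Deltabar) (cst a0)
| II_7ii of b = 6%:R & Delta - Deltabar = 7%:R :
    list_II b Delta Deltabar 0 (dd - cst (1 / 6%:R * Deltabar) * ll)
| II_7iii of b = 6%:R & Delta = 1 & Deltabar = - 7%:R :
    list_II b Delta Deltabar 0
      (dd ^+ 2 + cst (13%:R / 6%:R) * dd * ll + cst (7%:R / 6%:R) * ll ^+ 2)

| II_8i of b = - (2%:R / 3%:R) & Delta - Deltabar = - (2%:R / 3%:R) :
    list_II b Delta Deltabar 0 1
| II_8ii of b = - (2%:R / 3%:R) & Delta - Deltabar = 1 / 3%:R :
    list_II b Delta Deltabar 0 (dd + cst (3%:R / 2%:R * Deltabar) * ll)
| II_8iii of b = - (2%:R / 3%:R) & Delta = 1 & Deltabar = - (1 / 3%:R) :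
    list_II b Delta Deltabar 0
      (dd ^+ 2 + cst (1 / 2%:R) * dd * ll - cst (1 / 2%:R) * ll ^+ 2)
| II_8iv of b = - (2%:R / 3%:R) & Delta = 5%:R / 3%:R
    & Deltabar = - (2%:R / 3%:R) :
    list_II b Delta Deltabar 0
      (dd ^+ 3 + cst (3%:R / 2%:R) * dd ^+ 2 * ll
       - cst (3%:R / 2%:R) * dd * ll ^+ 2 - ll ^+ 3)

| II_9i of b \notin b_special & Delta - Deltabar = b :
    list_II b Delta Deltabar 0 1
| II_9ii of b \notin b_special & Delta - Deltabar = 1 + b :
    list_II b Delta Deltabar 0 (dd - cst (b^-1 * Deltabar) * ll)
| II_9iii of b \notin b_special & Delta = 1 & Deltabar = -1 - b :
    list_II b Delta Deltabar 0
      (dd ^+ 2 - cst (b^-1 + 2%:R / b * Deltabar) * dd * ll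
       - cst (b^-1 * Deltabar) * ll ^+ 2).

(* For b = -2 and Delta = Deltabar = 1, the case Delta = 1, Deltabar = - 1 - b *)
(* of list_II meets the case Delta = Deltabar of list_I.  The conditions on f  *)
(* and g are independent of each other, so the extensions with both f and g    *)
(* nonzero occur as well; the case f = 0 is II_9iii.                           *)
Variant list_II_b_minus2 b Delta Deltabar :
    {poly {poly C}} -> {poly {poly C}} -> Prop :=
| II_9iii' (c0 c1 : C) of b = - 2%:R & Delta = 1 & Deltabar = 1 :
    list_II_b_minus2 b Delta Deltabar (cst c0 + cst c1 * ll)
      (dd ^+ 2 + cst (3%:R / 2%:R) * dd * ll + cst (1 / 2%:R) * ll ^+ 2).

Definition listed b Delta Deltabar f g : Prop :=
  (exists c f0, [/\ c != 0, list_I Delta Deltabar f0,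
                    f = cst c * f0 & g = 0])
  \/ (exists c f0 g0, [/\ c != 0,
        list_II b Delta Deltabar f0 g0 \/ list_II_b_minus2 b Delta Deltabar f0 g0,
        f = cst c * f0 & g = cst c * g0]).

End Modules.

(* Main.v *)
Require Import Defs.
From HB Require Import structures.
From mathcomp Require Import all_boot all_order all_algebra.
From mathcomp Require Import polyXY complex reals ring zify.

Set Implicit Arguments.
Unset Strict Implicit.
Unset Printing Implicit Defensive.

Import Order.TTheory GRing.Theory Num.Theory.
Local Open Scope ring_scope.

(* Lifting the generator of the quotient turns an extension into a pair (F, G) *)
(* with L_lambda v = LM v + F vbar and H_lambda v = G vbar, subject to a       *)
(* cocycle equation for F and one for G; another lift changes F by a           *)
(* coboundary.  When alpha <> alphabar the constant term in lambda of the      *)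
(* equations forces F to be a coboundary and G = 0.  Otherwise one may take    *)
(* alpha = 0, and the coefficient of lambda^1 is an Euler identity: G is       *)
(* homogeneous of degree p = Delta - Deltabar - b, and F is, modulo            *)
(* coboundaries, homogeneous of degree m + 1 with m = Delta - Deltabar.        *)
(* Writing F = \sum_k a_k d^(m+1-k) lambda^k with a_0 = a_1 = 0 for m > 0, the *)
(* remaining equations determine all a_k from a_2 and a_3, and one line of     *)
(* solutions consists of coboundaries; so the cohomology has dimension at most *)
(* one, and a 2 x 2 determinant decides when it is nonzero.  The coefficients  *)
(* of G are all determined by the leading one, and two of the equations        *)
(* already exclude p >= 4.                                                     *)

(** The quotient is free over C[d], so an extension is a pair (F, G) ([extension_normal],
    [conformal_E]). Replacing v by v + phi vbar changes F by [dcob] phi and leaves G alone, because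
    H kills vbar ([shear_equiv]); the extension splits exactly when F is a coboundary and G = 0
    ([trivial_dcob], [dcob_trivial]). The equations for F and G are not coupled: each is classified
    by itself, and the lists are the ways to combine the two answers for the same b, Delta,
    Deltabar.

    The equation for F is the one for extensions over the Virasoro conformal algebra. Its constant
    part in lambda acts as a contracting homotopy if alpha <> alphabar ([coc_neq]), its linear part
    if the weight is wrong ([cocL_normal]). For m = Delta - Deltabar > 0 there remains a recursion
    whose solutions are fixed by a_2 and a_3 ([hom_eqs_zero]), one of them being the coboundary of
    d^m. If m = 1 it is the only one; for m = 2, 3, 4 a second solution always exists. From m = 5
    on, equation (3, 4) demands (2 Deltabar + m - 1)^2 = 3m + 1 ([hom_eqs_det34]), and from m = 7 on
    equation (4, 5) excludes that too ([hom_eqs_det45]). What survives is m = 5 with Deltabar = -4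
    and m = 6 with the square roots of 19 ([classL_hom]).

    For G of degree p = m - b the equations (k + 1, 0) express every coefficient through that of
    d^p, where b <> 0 is used; the others restrict p = 2 and p = 3 and exclude larger p
    ([homH_solve]). Since b = m - p, an F with m > 0 and a nonzero G meet for few values of b only;
    [parts_listed] and [listed_parts] compare these cases with the lists. *)

Local Notation sesqui := Defs.sesqui.
Local Notation eL := (delta_mx 0 0 : 'rV[{poly _}]_(1 + 1)).
Local Notation eH := (delta_mx 0 1 : 'rV[{poly _}]_(1 + 1)).

(** * Sesquilinear actions *)

Section Sesquilinear.
Variable C : numClosedFieldType.

Section LinearMaps.
Variables (M N : lmodType {poly C}) (h : M -> N).
Hypothesis hl : linear h.

Let hL : {linear M -> N} :=
  HB.pack_for {linear M -> N} h (GRing.isLinear.Build _ _ _ _ h hl).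

Lemma lin_0 : h 0 = 0. Proof. exact: (linear0 hL). Qed.
Lemma lin_D : {morph h : x y / x + y}. Proof. exact: (linearD hL). Qed.
Lemma lin_B : {morph h : x y / x - y}. Proof. exact: (linearB hL). Qed.
Lemma lin_N : {morph h : x / - x}. Proof. exact: (linearN hL). Qed.
Lemma lin_Z p : {morph h : x / p *: x}. Proof. exact: (linearZZ hL). Qed.
Lemma lin_Mn n : {morph h : x / x *+ n}. Proof. exact: (linearMn hL). Qed.
Lemma lin_sum I r (P : pred I) (F : I -> M) :
  h (\sum_(i <- r | P i) F i) = \sum_(i <- r | P i) h (F i).
Proof. exact: (linear_sum hL). Qed.

End LinearMaps.

Lemma scale_ind (M : lmodType {poly C}) (P : M -> Prop) :
  P 0 -> (forall x y, P x -> P y -> P (x + y)) ->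
  (forall c x, P x -> P (c%:P *: x)) -> (forall x, P x -> P ('X *: x)) ->
  forall p x, P x -> P (p *: x).
Proof.
move=> P0 PD Pc PX p x Px; elim/poly_ind: p => [|p c IHp].
  by rewrite scale0r.
rewrite scalerDl mulrC -scalerA; apply: PD; last exact: Pc.
exact: PX.
Qed.

(** These are the axioms of [conformal_module] that do not mention the bracket, apart from
    finiteness. They hold for actions and for the bracket of W(b) alike, so one theory serves
    both. *)
Record sesquilinear (A M : lmodType {poly C}) (act : A -> nat -> M -> M) :
  Prop := {
  sq_linearl : forall (c : C) a a' n v,
    act (c%:P *: a + a') n v = c%:P *: act a n v + act a' n v;
  sq_linearr : forall (c : C) a n v v',
    act a n (c%:P *: v + v') = c%:P *: act a n v + act a n v';
  sq_dl : forall a n v,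
    act ('X *: a) n v = - mul_lambda (fun k => act a k v) n;
  sq_dr : forall a n v,
    'X *: act a n v - act a n ('X *: v) = - mul_lambda (fun k => act a k v) n }.

Lemma conformal_sesquilinear (A M : lmodType {poly C}) br
    (act : A -> nat -> M -> M) :
  conformal_module br act -> sesquilinear act.
Proof. by case. Qed.

Section Theory.
Variables (A M : lmodType {poly C}) (act : A -> nat -> M -> M).
Hypothesis sq : sesquilinear act.

Lemma sq_Dl a a' n v : act (a + a') n v = act a n v + act a' n v.
Proof. by have := sq_linearl sq 1 a a' n v; rewrite !scale1r. Qed.

Lemma sq_Dr a n v v' : act a n (v + v') = act a n v + act a n v'.
Proof. by have := sq_linearr sq 1 a n v v'; rewrite !scale1r. Qed.

Lemma sq_0l n v : act 0 n v = 0.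
Proof. by apply: (addIr (act 0 n v)); rewrite -sq_Dl !add0r. Qed.

Lemma sq_0r a n : act a n 0 = 0.
Proof. by apply: (addIr (act a n 0)); rewrite -sq_Dr !add0r. Qed.

Lemma sq_Cl c a n v : act (c%:P *: a) n v = c%:P *: act a n v.
Proof. by rewrite -[c%:P *: a]addr0 (sq_linearl sq) sq_0l addr0. Qed.

Lemma sq_Cr c a n v : act a n (c%:P *: v) = c%:P *: act a n v.
Proof. by rewrite -[c%:P *: v]addr0 (sq_linearr sq) sq_0r addr0. Qed.

Lemma sq_Nl a n v : act (- a) n v = - act a n v.
Proof. by apply/eqP; rewrite -addr_eq0 -sq_Dl addNr sq_0l. Qed.

Lemma sq_Nr a n v : act a n (- v) = - act a n v.
Proof. by apply/eqP; rewrite -addr_eq0 -sq_Dr addNr sq_0r. Qed.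

Lemma sq_Mnl a n v m : act (a *+ m) n v = act a n v *+ m.
Proof. by elim: m => [|m IH]; rewrite ?mulr0n ?sq_0l // !mulrS sq_Dl IH. Qed.

Lemma sq_Xr a n v :
  act a n ('X *: v) = 'X *: act a n v + mul_lambda (fun k => act a k v) n.
Proof.
have /eqP := sq_dr sq a n v; rewrite subr_eq => /eqP ->.
by rewrite addrAC addNr add0r.
Qed.

End Theory.

Section HomExtension.
Variables (A M N : lmodType {poly C}).
Variables (actM : A -> nat -> M -> M) (actN : A -> nat -> N -> N).
Hypotheses (sqM : sesquilinear actM) (sqN : sesquilinear actN).
Variable h : M -> N.
Hypothesis hl : linear h.

(** Stated at a single pair so that it can be propagated: by sesquilinearity it is inherited by
    C[d]-combinations in either argument, and homomorphisms need checking on generators only. *)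
Definition compat a x := forall n, h (actM a n x) = actN a n (h x).

Lemma compat_Dl a a' x : compat a x -> compat a' x -> compat (a + a') x.
Proof. by move=> H H' n; rewrite (sq_Dl sqM) (sq_Dl sqN) (lin_D hl) H H'. Qed.

Lemma compat_Dr a x x' : compat a x -> compat a x' -> compat a (x + x').
Proof.
by move=> H H' n; rewrite (sq_Dr sqM) (lin_D hl) H H' (lin_D hl) (sq_Dr sqN).
Qed.

Lemma compat_Zl p a x : compat a x -> compat (p *: a) x.
Proof.
move: p a; apply: scale_ind => [n|a a'|c a H n|a H n].
- by rewrite (sq_0l sqM) (sq_0l sqN) (lin_0 hl).
- exact: compat_Dl.
- by rewrite (sq_Cl sqM) (sq_Cl sqN) (lin_Z hl) H.
- rewrite (sq_dl sqM) (sq_dl sqN) (lin_N hl); congr (- _).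
  by case: n => [|n] /=; rewrite ?H // (lin_0 hl).
Qed.

Lemma compat_Zr p a x : compat a x -> compat a (p *: x).
Proof.
move: p x; apply: scale_ind => [n|x x'|c x H n|x H n].
- by rewrite (sq_0r sqM) (lin_0 hl) (sq_0r sqN).
- exact: compat_Dr.
- by rewrite (sq_Cr sqM) !(lin_Z hl) (sq_Cr sqN) H.
- rewrite (sq_Xr sqM) (lin_D hl) !(lin_Z hl) (sq_Xr sqN) H; congr (_ + _).
  by case: n => [|n] /=; rewrite ?H // (lin_0 hl).
Qed.

End HomExtension.

Section CommutatorExtension.
Variables (A M : lmodType {poly C}).
Variables (br : A -> nat -> A -> A) (act : A -> nat -> M -> M).
Hypotheses (sqA : sesquilinear br) (sq : sesquilinear act).

Definition bracket_act a b v i j :=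
  \sum_(k < i.+1) act (br a k b) (i - k + j)%N v *+ 'C(i - k + j, j).

(** The commutator axiom at one triple. It passes to C[d]-combinations in each of the three
    arguments, which reduces the axiom to generators. *)
Definition comm_at a b v := forall i j,
  act a i (act b j v) - act b j (act a i v) = bracket_act a b v i j.

Lemma comm_at_0l b v : comm_at 0 b v.
Proof.
move=> i j; rewrite !(sq_0l sq) (sq_0r sq) subr0 /bracket_act big1 // => k _.
by rewrite (sq_0l sqA) (sq_0l sq) mul0rn.
Qed.

Lemma comm_at_0m a v : comm_at a 0 v.
Proof.
move=> i j; rewrite !(sq_0l sq) (sq_0r sq) subr0 /bracket_act big1 // => k _.
by rewrite (sq_0r sqA) (sq_0l sq) mul0rn.
Qed.

Lemma comm_at_0r a b : comm_at a b 0.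
Proof.
move=> i j; rewrite !(sq_0r sq) subr0 /bracket_act big1 // => k _.
by rewrite (sq_0r sq) mul0rn.
Qed.

Lemma comm_at_Dl a a' b v : comm_at a b v -> comm_at a' b v ->
  comm_at (a + a') b v.
Proof.
move=> H H' i j; rewrite !(sq_Dl sq) (sq_Dr sq) opprD addrACA H H'.
rewrite /bracket_act -big_split; apply: eq_bigr => k _ /=.
by rewrite (sq_Dl sqA) (sq_Dl sq) mulrnDl.
Qed.

Lemma comm_at_Dm a b b' v : comm_at a b v -> comm_at a b' v ->
  comm_at a (b + b') v.
Proof.
move=> H H' i j; rewrite !(sq_Dl sq) (sq_Dr sq) opprD addrACA H H'.
rewrite /bracket_act -big_split; apply: eq_bigr => k _ /=.
by rewrite (sq_Dr sqA) (sq_Dl sq) mulrnDl.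
Qed.

Lemma comm_at_Dr a b v v' : comm_at a b v -> comm_at a b v' ->
  comm_at a b (v + v').
Proof.
move=> H H' i j; rewrite !(sq_Dr sq) opprD addrACA H H'.
rewrite /bracket_act -big_split; apply: eq_bigr => k _ /=.
by rewrite (sq_Dr sq) mulrnDl.
Qed.

Lemma comm_at_Zl p a b v : comm_at a b v -> comm_at (p *: a) b v.
Proof.
move: p a; apply: scale_ind => [|a a'|c a H i j|a H i j].
- exact: comm_at_0l.
- exact: comm_at_Dl.
- rewrite !(sq_Cl sq) (sq_Cr sq) -scalerBr H /bracket_act scaler_sumr.
  by apply: eq_bigr => k _; rewrite (sq_Cl sqA) (sq_Cl sq) scalerMnr.
- rewrite !(sq_dl sq) (sq_Nr sq) /bracket_act big_ord_recl (sq_dl sqA) /=.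
  rewrite oppr0 (sq_0l sq) mul0rn add0r.
  case: i => [|i] /=; first by rewrite (sq_0r sq) oppr0 subr0 big_ord0.
  rewrite -opprD H /bracket_act -sumrN.
  apply: eq_bigr => k _; rewrite /bump /= add1n subSS (sq_dl sqA) /=.
  by rewrite (sq_Nl sq) mulNrn.
Qed.

(** For d b both sides acquire the factor -mu: on the right d + lambda acts on the bracket, and d
    becomes -(lambda + mu) in the action. On coefficients this is Pascal's rule. *)
Lemma comm_at_Zm p a b v : comm_at a b v -> comm_at a (p *: b) v.
Proof.
move: p b; apply: scale_ind => [|b b'|c b H i j|b H i j].
- exact: comm_at_0m.
- exact: comm_at_Dm.
- rewrite !(sq_Cl sq) (sq_Cr sq) -scalerBr H /bracket_act scaler_sumr.
  by apply: eq_bigr => k _; rewrite (sq_Cr sqA) (sq_Cl sq) scalerMnr.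
- rewrite !(sq_dl sq) (sq_Nr sq) -opprD.
  rewrite /bracket_act.
  under eq_bigr do rewrite (sq_Xr sqA) (sq_Dl sq) (sq_dl sq) mulrnDl mulNrn.
  rewrite big_split /= sumrN [X in _ = _ + X]big_ord_recl /= (sq_0l sq) mul0rn
    add0r.
  under [X in _ = _ + X]eq_bigr do rewrite /bump /= add1n.
  rewrite big_ord_recr /= subnn add0n binn mulr1n.
  case: j => [|j] /=.
    rewrite (sq_0r sq) subr0 oppr0 addr0.
    apply/esym/eqP; rewrite addrC subr_eq0; apply/eqP; apply: eq_bigr => k _.
    rewrite !bin0 !addn0 !mulr1n.
    by have /subnSK <- := ltn_ord k.
  rewrite H /bracket_act big_ord_recr /= subnn add0n binn mulr1n.
  rewrite !opprD addrAC; congr (_ + _); apply/eqP.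
  rewrite -subr_eq0 -!sumrN -big_split -sumrB /= big1 // => k _.
  have /subnSK <- := ltn_ord k; rewrite !addnS !addSn /=.
  by rewrite add0n binS mulrnDr [_ *+ _ + _ *+ _]addrC opprD opprK addrK addNr.
Qed.

(** For d v both sides acquire the factor d + lambda + mu; again Pascal's rule accounts for lambda +
    mu on the right. *)
Lemma comm_at_Zr p a b v : comm_at a b v -> comm_at a b (p *: v).
Proof.
move: p v; apply: scale_ind => [|v v'|c v H i j|v H i j].
- exact: comm_at_0r.
- exact: comm_at_Dr.
- rewrite !(sq_Cr sq) -scalerBr H /bracket_act scaler_sumr.
  by apply: eq_bigr => k _; rewrite (sq_Cr sq) scalerMnr.
- rewrite !(sq_Xr sq) !(sq_Dr sq) !(sq_Xr sq).
  have -> : act a i (mul_lambda (fun k => act b k v) j) =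
      mul_lambda (fun k => act a i (act b k v)) j.
    by case: (j) => //=; rewrite (sq_0r sq).
  have -> : act b j (mul_lambda (fun k => act a k v) i) =
      mul_lambda (fun k => act b j (act a k v)) i.
    by case: (i) => //=; rewrite (sq_0r sq).
  set X1 := 'X *: _; set X2 := 'X *: _.
  (* The three terms are d, mu and lambda times the commutator at v; the cross terms of the two
     products cancel. *)
  transitivity ((X1 - X2)
    + (mul_lambda (fun k => act a i (act b k v) - act b k (act a i v)) j
     + mul_lambda (fun k => act a k (act b j v) - act b j (act a k v)) i)).
    set u := mul_lambda (fun k => act a k (act b j v)) i.
    set w := mul_lambda (fun k => act b k (act a i v)) j.
    have -> : mul_lambda (fun k => act a i (act b k v) - act b k (act a i v)) j
        = mul_lambda (fun k => act a i (act b k v)) j - w.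
      by rewrite /w; case: (j) => //=; rewrite subr0.
    have -> : mul_lambda (fun k => act a k (act b j v) - act b j (act a k v)) i
        = u - mul_lambda (fun k => act b j (act a k v)) i.
      by rewrite /u; case: (i) => //=; rewrite subr0.
    move: (mul_lambda _ j) (mul_lambda _ i) => s t.
    by rewrite !opprD; rewrite [LHS](AC (3*3) (1*4*((3*5)*(2*6)))).
  rewrite -scalerBr H.
  rewrite [in RHS]/bracket_act;
    under [in RHS]eq_bigr do rewrite (sq_Xr sq) mulrnDl scalerMnr.
  rewrite /bracket_act [RHS]big_split /= -scaler_sumr; congr (_ + _).
  rewrite big_ord_recr /= subnn add0n binn mulr1n.
  case: j H X1 X2 => [|j] H X1 X2 /=.
    rewrite add0r addr0; case: i H X1 X2 => [|i] H X1 X2 /=.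
      by rewrite big_ord0.
    rewrite H; apply: eq_bigr => k _; rewrite !bin0 !addn0 !mulr1n.
    by rewrite subSn ?leq_ord.
  rewrite H /bracket_act big_ord_recr /= subnn add0n binn mulr1n.
  rewrite addrAC; congr (_ + _).
  case: i H X1 X2 => [|i] H X1 X2 /=; first by rewrite !big_ord0 addr0.
  rewrite H /bracket_act -big_split; apply: eq_bigr => k _ /=.
  rewrite subSn ?leq_ord //.
  by rewrite !addnS !addSn /= [in RHS]binS mulrnDr addrC.
Qed.

End CommutatorExtension.

End Sesquilinear.

(** * Actions given by matrices on generators *)

Section XaY.
Variable C : numClosedFieldType.

HB.instance Definition _ := GRing.RMorphism.copy (@poly_XaY C)
  (comp_poly ('X + 'X%:P) \o map_poly (@polyC C)).

Lemma XaY_C (c : C) : poly_XaY c%:P = c%:P%:P.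
Proof. by rewrite /poly_XaY map_polyC comp_polyC. Qed.

Lemma XaY_X : poly_XaY 'X = 'X + 'X%:P :> {poly {poly C}}.
Proof. by rewrite /poly_XaY map_polyX comp_polyX. Qed.

Lemma XaY_N (P : {poly C}) : poly_XaY (- P) = - poly_XaY P.
Proof.
by apply/eqP; rewrite -addr_eq0 -(rmorphD (@poly_XaY C)) addNr (rmorph0
  (@poly_XaY C)).
Qed.

(** Taylor expansion of P(d + lambda) in lambda, with divided derivatives. *)
Lemma coef_XaY (P : {poly C}) i : (poly_XaY P)`_i = P^`N(i).
Proof.
elim/poly_ind: P i => [|P c IH] i.
  by rewrite rmorph0 coef0 linear0.
rewrite rmorphD rmorphM /= XaY_X XaY_C coefD mulrDr coefD coefMX coefMC coefC.
case: i => [|i] /=.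
  by rewrite add0r IH !nderivn0.
by rewrite addr0 !IH nderivnMXaddC.
Qed.

End XaY.

Section CoefMx.
Variables (C : numClosedFieldType) (m1 m2 : nat).
Implicit Types X Y : 'M[{poly {poly C}}]_(m1, m2).

Definition coef_mx n X := map_mx (fun q : {poly {poly C}} => q`_n) X.

Lemma coef_mxD n X Y : coef_mx n (X + Y) = coef_mx n X + coef_mx n Y.
Proof. by apply/matrixP => i j; rewrite !mxE coefD. Qed.

Lemma coef_mxN n X : coef_mx n (- X) = - coef_mx n X.
Proof. by apply/matrixP => i j; rewrite !mxE coefN. Qed.

Lemma coef_mxZ n p X : coef_mx n (p%:P *: X) = p *: coef_mx n X.
Proof. by apply/matrixP => i j; rewrite !mxE coefCM. Qed.

Lemma coef_mxX n X : coef_mx n ('X *: X) = mul_lambda (coef_mx^~ X) n.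
Proof. by apply/matrixP => i j; case: n => [|n]; rewrite !mxE coefXM. Qed.

End CoefMx.

Lemma row_ind (R : pzRingType) n (P : 'rV[R]_n -> Prop) :
  P 0 -> (forall x y, P x -> P y -> P (x + y)) ->
  (forall p k, P (p *: delta_mx 0 k)) -> forall x, P x.
Proof.
move=> P0 PD Pd x; rewrite [x]row_sum_delta.
by elim/big_rec: _ => // k y _; apply: PD.
Qed.

Section Sesqui.
Variable C : numClosedFieldType.
Variables (r m : nat) (G : 'I_r -> 'M[{poly {poly C}}]_m).

Definition sesqui_gen (a : 'rV[{poly C}]_r) (v : 'rV[{poly C}]_m) :=
  \sum_k ((a 0 k)^:P \Po (- 'X)) *: (map_mx (@poly_XaY C) v *m G k).

Lemma sesquiE a n v : sesqui G a n v = coef_mx n (sesqui_gen a v).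
Proof. by []. Qed.

Lemma sesqui_sesquilinear : sesquilinear (sesqui G).
Proof.
have DlZ q a v : sesqui_gen (q *: a) v = (q^:P \Po (- 'X)) *: sesqui_gen a v.
  rewrite /sesqui_gen scaler_sumr; apply: eq_bigr => k _.
  by rewrite mxE rmorphM comp_polyM scalerA.
have DlD a a' v : sesqui_gen (a + a') v = sesqui_gen a v + sesqui_gen a' v.
  rewrite /sesqui_gen -big_split; apply: eq_bigr => k _ /=.
  by rewrite mxE rmorphD comp_polyD scalerDl.
have DrZ q a v : sesqui_gen a (q *: v) = poly_XaY q *: sesqui_gen a v.
  rewrite /sesqui_gen scaler_sumr; apply: eq_bigr => k _.
  have -> : map_mx (@poly_XaY C) (q *: v) =
      poly_XaY q *: map_mx (@poly_XaY C) v.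
    by apply/matrixP => i j; rewrite !mxE rmorphM.
  by rewrite -scalemxAl !scalerA mulrC.
have DrD a v v' : sesqui_gen a (v + v') = sesqui_gen a v + sesqui_gen a v'.
  rewrite /sesqui_gen -big_split; apply: eq_bigr => k _ /=.
  by rewrite map_mxD mulmxDl scalerDr.
have CC (c : C) : (c%:P)^:P \Po (- 'X) = c%:P%:P.
  by rewrite map_polyC comp_polyC.
split=> [c a a' n v|c a n v v'|a n v|a n v]; rewrite ?sesquiE.
- by rewrite DlD DlZ CC coef_mxD coef_mxZ.
- by rewrite DrD DrZ XaY_C coef_mxD coef_mxZ.
- by rewrite DlZ map_polyX comp_polyX scaleNr coef_mxN coef_mxX.
- rewrite DrZ XaY_X scalerDl coef_mxD coef_mxX coef_mxZ opprD addrCA subrr.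
  by rewrite addr0.
Qed.

Lemma sesqui_finite a v :
  exists N, forall n, (N <= n)%N -> sesqui G a n v = 0.
Proof.
exists (\max_j size (sesqui_gen a v ord0 j)) => n len.
apply/matrixP => i j; rewrite mxE ord1 mxE nth_default //.
by apply: leq_trans len; rewrite (leq_bigmax j).
Qed.

Lemma sesqui_delta k n v :
  sesqui G (delta_mx 0 k) n v = coef_mx n (map_mx (@poly_XaY C) v *m G k).
Proof.
rewrite sesquiE /sesqui_gen (bigD1 k) //= big1 => [|l /negPf lk].
  by rewrite mxE !eqxx rmorph1 rmorph1 scale1r addr0.
by rewrite mxE lk andbF !rmorph0 scale0r.
Qed.

(** Finiteness and sesquilinearity are built into [sesqui], so only the commutators of generators on
    generators remain. *)
Lemma conformal_sesqui br : sesquilinear br ->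
  (forall k l e, comm_at br (sesqui G) (delta_mx 0 k) (delta_mx 0 l)
                         (delta_mx 0 e)) ->
  conformal_module br (sesqui G).
Proof.
move=> sqA H; have sq := sesqui_sesquilinear.
case: (sq) => ? ? ? ?; split=> //; first exact: sesqui_finite.
suff K a b v : comm_at br (sesqui G) a b v by move=> a b i j v; exact: K.
move: a; apply: row_ind => [|a a'|p k]; first exact: comm_at_0l.
  exact: comm_at_Dl.
apply: comm_at_Zl => //; move: b; apply: row_ind => [|b b'|q l].
- exact: comm_at_0m.
- exact: comm_at_Dm.
apply: comm_at_Zm => //; move: v; apply: row_ind => [|v v'|t e].
- exact: comm_at_0r.
- exact: comm_at_Dr.
by apply: comm_at_Zr.
Qed.

End Sesqui.

(** * Transport of module structures and composition of equivalences *)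

Section Transport.
Variable C : numClosedFieldType.
Variables (A M N : lmodType {poly C}) (br : A -> nat -> A -> A).
Variables (actM : A -> nat -> M -> M) (actN : A -> nat -> N -> N) (h : M -> N).

Lemma conformal_transport :
  conformal_module br actM -> sesquilinear actN ->
  (forall a v, exists K, forall n, (K <= n)%N -> actN a n v = 0) ->
  conformal_hom actM actN h -> (forall y, exists x, h x = y) ->
  conformal_module br actN.
Proof.
move=> cM [? ? ? ?] fN [hl hact] surj; split=> // a b i j v.
have [u <-] := surj v; rewrite -!hact -(lin_B hl) (cm_commutator cM).
by rewrite (lin_sum hl); apply: eq_bigr => k _; rewrite (lin_Mn hl) hact.
Qed.

End Transport.

Section Equivalence.
Variable C : numClosedFieldType.
Variables (A V W : lmodType {poly C}).

Lemma conformal_hom_comp (M N P : lmodType {poly C})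
    (aM : A -> nat -> M -> M) (aN : A -> nat -> N -> N)
    (aP : A -> nat -> P -> P) h k :
  conformal_hom aM aN h -> conformal_hom aN aP k ->
  conformal_hom aM aP (k \o h).
Proof.
move=> [hl ha] [kl ka]; split=> [c x y|a n v] /=.
  by rewrite (lin_D hl) (lin_Z hl) (lin_D kl) (lin_Z kl).
by rewrite ha ka.
Qed.

Lemma ext_equiv_trans (E E' E'' : lmodType {poly C})
    (aE : A -> nat -> E -> E) (aE' : A -> nat -> E' -> E')
    (aE'' : A -> nat -> E'' -> E'')
    (i : V -> E) (p : E -> W) (i' : V -> E') (p' : E' -> W)
    (i'' : V -> E'') (p'' : E'' -> W) :
  ext_equiv aE i p aE' i' p' -> ext_equiv aE' i' p' aE'' i'' p'' ->
  ext_equiv aE i p aE'' i'' p''.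
Proof.
move=> [f [fh fi fp]] [g [gh gi gp]]; exists (g \o f); split=> [|v|x] /=.
- exact: conformal_hom_comp fh gh.
- by rewrite fi gi.
- by rewrite gp fp.
Qed.

End Equivalence.

(** * The brackets of W(b) *)

Lemma ord2_cases (k : 'I_(1 + 1)) : k = 0 \/ k = 1.
Proof. by case: k => [[|[|]]] // ?; [left|right]; apply: val_inj. Qed.

Section RankTwo.
Variable C : numClosedFieldType.
Local Notation dd := ('X%:P : {poly {poly C}}).
Local Notation ll := ('X : {poly {poly C}}).
Local Notation cst c := (c%:P%:P : {poly {poly C}}).

Definition row2 (P Q : {poly C}) : 'rV[{poly C}]_(1 + 1) := row_mx P%:M Q%:M.

Lemma row2_surj (x : 'rV[{poly C}]_(1 + 1)) :
  x = row2 (lsubmx x 0 0) (rsubmx x 0 0).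
Proof.
by rewrite /row2 -!mx11_scalar hsubmxK.
Qed.

Lemma row2_inj P Q P' Q' : row2 P Q = row2 P' Q' -> P = P' /\ Q = Q'.
Proof.
move=> /eq_row_mx [/matrixP/(_ 0 0) + /matrixP/(_ 0 0)].
by rewrite !mxE !eqxx.
Qed.

Lemma row2D P Q P' Q' : row2 P Q + row2 P' Q' = row2 (P + P') (Q + Q').
Proof. by rewrite /row2 add_row_mx !raddfD. Qed.

Lemma row2N P Q : - row2 P Q = row2 (- P) (- Q).
Proof. by rewrite /row2 opp_row_mx !raddfN. Qed.

Lemma row2_0 : row2 0 0 = 0.
Proof. by rewrite /row2 !raddf0 row_mx0. Qed.

Lemma row2Z a P Q : a *: row2 P Q = row2 (a * P) (a * Q).
Proof. by rewrite /row2 scale_row_mx !scale_scalar_mx. Qed.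

Lemma row2Mn P Q n : row2 P Q *+ n = row2 (P *+ n) (Q *+ n).
Proof. by elim: n => [|n IH]; rewrite ?mulr0n ?row2_0 // !mulrS IH row2D. Qed.

Lemma row2_L : row2 1 0 = delta_mx 0 0.
Proof.
apply/matrixP => i j; rewrite ord1 mxE.
case: splitP => k; rewrite ord1 /= => jk; rewrite !mxE.
  by have -> : j = 0 by apply: val_inj.
by have -> : j = 1 by apply: val_inj.
Qed.

Lemma row2_H : row2 0 1 = delta_mx 0 1.
Proof.
apply/matrixP => i j; rewrite ord1 mxE.
case: splitP => k; rewrite ord1 /= => jk; rewrite !mxE.
  by have -> : j = 0 by apply: val_inj.
by have -> : j = 1 by apply: val_inj.
Qed.

Lemma coef_mx_row2 n (u v : {poly {poly C}}) :
  coef_mx n (row_mx u%:M v%:M) = row2 u`_n v`_n.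
Proof.
rewrite /coef_mx map_row_mx; congr row_mx; apply/matrixP => i j;
by rewrite !ord1 !mxE !eqxx.
Qed.

Lemma map_XaY_row2 P Q : map_mx (@poly_XaY C) (row2 P Q) =
  row_mx (poly_XaY P)%:M (poly_XaY Q)%:M.
Proof.
rewrite map_row_mx; congr row_mx; apply/matrixP => i j;
by rewrite !ord1 !mxE !eqxx.
Qed.

(** A version of [E_gen] with independent alpha and alphabar and with unshifted F and G, as needed
    before alpha = alphabar is known. *)
Definition gen_E (al ab D Db : C) (F G : {poly {poly C}}) (k : 'I_2) :
    'M[{poly {poly C}}]_(1 + 1) :=
  if k == 0 then block_mx (LM ab Db)%:M 0 F%:M (LM al D)%:M
  else block_mx 0 0 G%:M 0.

Lemma row2_mul_block n P Q (a b c d : {poly {poly C}}) :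
  coef_mx n (map_mx (@poly_XaY C) (row2 P Q) *m block_mx a%:M b%:M c%:M d%:M) =
  row2 (poly_XaY P * a + poly_XaY Q * c)`_n (poly_XaY P * b + poly_XaY Q *
    d)`_n.
Proof.
have e (x y z t : {poly {poly C}}) :
    x%:M *m y%:M + z%:M *m t%:M = (x * y + z * t)%:M :> 'M_1.
  by apply/matrixP => i j; rewrite !ord1 !mxE !big_ord1 !mxE !eqxx !mulr1n.
by rewrite map_XaY_row2 mul_row_block !e coef_mx_row2.
Qed.

Lemma scalar_mx0 : 0%:M = 0 :> 'M[{poly {poly C}}]_1.
Proof. exact: raddf0. Qed.

Lemma act_L al ab D Db F G n P Q :
  sesqui (gen_E al ab D Db F G) eL n (row2 P Q) =
  row2 (poly_XaY P * LM ab Db + poly_XaY Q * F)`_n (poly_XaY Q * LM al D)`_n.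
Proof.
by rewrite sesqui_delta /gen_E eqxx -scalar_mx0 row2_mul_block mulr0 add0r.
Qed.

Lemma act_H al ab D Db F G n P Q :
  sesqui (gen_E al ab D Db F G) eH n (row2 P Q) = row2 (poly_XaY Q * G)`_n 0.
Proof.
rewrite sesqui_delta /gen_E /= -scalar_mx0 row2_mul_block.
by rewrite !mulr0 add0r addr0 coef0.
Qed.

Lemma W_L (b : C) n P Q : W_bracket b eL n (row2 P Q) =
  row2 (poly_XaY P * (dd + 2%:R * ll))`_n (poly_XaY Q * (dd + cst (1 - b) *
    ll))`_n.
Proof.
rewrite /W_bracket sesqui_delta /W_gen eqxx -scalar_mx0 row2_mul_block.
by rewrite !mulr0 add0r addr0.
Qed.

Lemma W_H (b : C) n P Q : W_bracket b eH n (row2 P Q) =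
  row2 0 (poly_XaY P * (cst (1 - b) * ll - cst b * dd))`_n.
Proof.
rewrite /W_bracket sesqui_delta /W_gen /= -scalar_mx0 row2_mul_block.
by rewrite !mulr0 !addr0 coef0.
Qed.

(* The coefficient of lambda^i mu^j in [a_lambda b]_(lambda + mu) v when the   *)
(* products a_(0) b and a_(1) b act on v by u0 and u1, and the higher products *)
(* vanish.                                                                     *)
Definition bracket_coef (M : zmodType) (u0 u1 : nat -> M) i j : M :=
  u0 (i + j)%N *+ 'C(i + j, j) +
  (if i is i'.+1 then u1 (i' + j)%N *+ 'C(i' + j, j) else 0).

Lemma eq_bracket_coef (M : zmodType) (u0 u1 v0 v1 : nat -> M) i j :
  u0 =1 v0 -> u1 =1 v1 -> bracket_coef u0 u1 i j = bracket_coef v0 v1 i j.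
Proof. by move=> e0 e1; rewrite /bracket_coef e0; case: i => // i;
  rewrite e1. Qed.

Lemma bracket_actE (A M : lmodType {poly C}) br (act : A -> nat -> M -> M)
    a b v i j : sesquilinear act -> (forall k, br a k.+2 b = 0) ->
  bracket_act br act a b v i j =
  bracket_coef (fun n => act (br a 0%N b) n v) (fun n => act (br a 1%N b) n v) i
    j.
Proof.
move=> sq br2; rewrite /bracket_act /bracket_coef big_ord_recl /= subn0;
  congr (_ + _).
case: i => [|i]; first by rewrite big_ord0.
rewrite big_ord_recl /= subSS subn0 big1 ?addr0 // => k _.
by rewrite /bump /= !add1n br2 (sq_0l sq) mul0rn.
Qed.

Lemma coef_dl (a c : C) n :
  (dd + cst a + cst c * ll)`_n =
  (if n is n'.+1 then (if n' is 0%N then c%:P else 0) else 'X + a%:P).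
Proof.
rewrite !coefD coefCM coefX !coefC.
by case: n => [|[|n]] /=; rewrite ?mulr0 ?addr0 ?mulr1 ?add0r.
Qed.

Lemma W_LL (b : C) n : W_bracket b eL n eL =
  (if n is n'.+1 then (if n' is 0%N then eL *+ 2 else 0) else 'X *: eL).
Proof.
rewrite -{2}row2_L W_L rmorph0 rmorph1 mul1r mul0r coef0.
have -> : dd + 2%:R * ll = dd + cst 0 + cst 2%:R * ll.
  by rewrite !rmorph0 addr0 !rmorph_nat.
rewrite coef_dl -row2_L; case: n => [|[|n]]; rewrite ?row2Z ?row2Mn ?row2_0 //.
  by rewrite rmorph0 addr0 mulr1 mulr0.
by rewrite mul0rn rmorph_nat.
Qed.

Lemma W_LH (b : C) n : W_bracket b eL n eH =
  (if n is n'.+1 then (if n' is 0%N then (1 - b)%:P *: eH else 0)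
   else 'X *: eH).
Proof.
rewrite -{1}row2_H W_L rmorph0 rmorph1 mul1r mul0r coef0.
rewrite -[dd]addr0; have -> : dd + 0 = dd + cst 0 by rewrite !rmorph0.
rewrite coef_dl -row2_H; case: n => [|[|n]]; rewrite ?row2Z ?row2Mn ?row2_0 //.
  by rewrite rmorph0 addr0 mulr1 mulr0.
by rewrite mulr0 mulr1.
Qed.

Lemma W_HL (b : C) n : W_bracket b eH n eL =
  (if n is n'.+1 then (if n' is 0%N then (1 - b)%:P *: eH else 0)
   else - (b%:P *: ('X *: eH))).
Proof.
rewrite -{1}row2_L W_H rmorph1 mul1r -row2_H coefB !coefCM coefX coefC.
case: n => [|[|n]] /=; rewrite ?row2Z ?row2N ?row2_0 //=.
- by rewrite mulr0 sub0r mulr1 !mulr0 oppr0.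
- by rewrite mulr0 subr0 mulr0.
- by rewrite !mulr0 subr0 row2_0.
Qed.

Lemma W_HH (b : C) n : W_bracket b eH n eH = 0.
Proof. by rewrite -{2}row2_H W_H rmorph0 mul0r coef0 row2_0. Qed.

(** Coefficients of (lambda - mu) u(lambda + mu), which is -(lambda + mu) + 2 lambda times u(lambda
    + mu). *)
Definition coefLL (M : zmodType) (u : nat -> M) :=
  bracket_coef (fun n => - mul_lambda u n) (fun n => u n *+ 2).

(** Coefficients of -(b lambda + mu) u(lambda + mu). *)
Definition coefLH (M : lmodType {poly C}) (b : C) (u : nat -> M) :=
  bracket_coef (fun n => - mul_lambda u n) (fun n => (1 - b)%:P *: u n).

Section Brackets.
Variables (M : lmodType {poly C}) (b : C).
Variable act : 'rV[{poly C}]_(1 + 1) -> nat -> M -> M.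
Hypothesis sq : sesquilinear act.

Lemma bracket_LL v i j :
  bracket_act (W_bracket b) act eL eL v i j = coefLL (fun n => act eL n v) i j.
Proof.
rewrite bracket_actE // => [|k]; last by rewrite W_LL.
by apply: eq_bracket_coef => n; rewrite W_LL ?(sq_dl sq) ?(sq_Mnl sq).
Qed.

Lemma bracket_LH v i j :
  bracket_act (W_bracket b) act eL eH v i j = coefLH b (fun n => act eH n v) i
    j.
Proof.
rewrite bracket_actE // => [|k]; last by rewrite W_LH.
by apply: eq_bracket_coef => n; rewrite W_LH ?(sq_dl sq) ?(sq_Cl sq).
Qed.

(** Skew-symmetry of the bracket, which makes the relation for (H, L) a consequence of the one for
    (L, H). *)
Lemma bracket_HL v i j : bracket_act (W_bracket b) act eH eL v i j =
  - bracket_act (W_bracket b) act eL eH v j i.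
Proof.
rewrite bracket_LH bracket_actE // => [|k]; last by rewrite W_HL.
rewrite /coefLH (@eq_bracket_coef _ _ _ (fun n => b%:P *: mul_lambda (fun k =>
  act eH k v) n)
  (fun n => (1 - b)%:P *: act eH n v)); first last.
- by move=> n; rewrite W_HL (sq_Cl sq).
- by move=> n; rewrite W_HL (sq_Nl sq) (sq_Cl sq) (sq_dl sq) scalerN opprK.
rewrite /bracket_coef; set u := fun n => act eH n v.
rewrite !rmorphB /= rmorph1.
have e0 n : (b%:P *: u n) = u n - (1 - b%:P) *: u n.
  by rewrite scalerBl scale1r opprB addrCA subrr addr0.
case: i j => [|i] [|j] /=.
- by rewrite scaler0 !mul0rn !addr0 oppr0 mul0rn oppr0.
- rewrite addr0 !add0n addn0 bin0 mulr1n binn mulr1n e0 /= bin0 mulr1n.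
  by rewrite opprD opprK.
- rewrite addr0 !addn0 add0n !bin0 !mulr1n binn mulr1n e0 addrNK.
  by rewrite opprK.
- have -> : (j.+1 + i.+1 = (i + j).+2)%N by rewrite addSn addnS addnC.
  have -> : (i.+1 + j.+1 = (i + j).+2)%N by rewrite addSn addnS.
  have -> : (j + i.+1 = (i + j).+1)%N by rewrite addnS addnC.
  have -> : (i + j.+1 = (i + j).+1)%N by rewrite addnS.
  rewrite e0 /= mulrnBl.
  have -> : 'C((i + j).+1, i.+1) = 'C((i + j).+1, j).
    by rewrite -[RHS]bin_sub ?leqW ?leq_addl // -addSn addnK.
  have -> : 'C((i + j).+2, i.+1) = 'C((i + j).+2, j.+1).
    rewrite -[RHS]bin_sub; last by rewrite -addnS -addSn leq_addl.
    by rewrite -addnS -addSn addnK.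
  rewrite mulNrn [RHS]opprD opprK -[LHS]addrA; congr (_ + _).
  by rewrite binS mulrnDr opprD addrAC addNr add0r.
Qed.

Lemma comm_HL v : comm_at (W_bracket b) act eL eH v ->
  comm_at (W_bracket b) act eH eL v.
Proof. by move=> H i j; rewrite bracket_HL -H opprB. Qed.

Lemma bracket_HH v i j : bracket_act (W_bracket b) act eH eH v i j = 0.
Proof.
rewrite bracket_actE // => [|k]; last by rewrite W_HH.
rewrite /bracket_coef !W_HH !(sq_0l sq) mul0rn add0r.
by case: i => // i; rewrite (sq_0l sq) mul0rn.
Qed.

End Brackets.

End RankTwo.

(** * Cocycle equations *)

Section Cocycles.
Variable C : numClosedFieldType.
Local Notation dd := ('X%:P : {poly {poly C}}).
Local Notation ll := ('X : {poly {poly C}}).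
Local Notation cst c := (c%:P%:P : {poly {poly C}}).
Implicit Types (al ab D Db b a : C) (F G Q : {poly {poly C}}).

Lemma coef_LM a D n : (LM a D)`_n =
  (if n is n'.+1 then (if n' is 0%N then D%:P else 0) else 'X + a%:P).
Proof. exact: coef_dl. Qed.

Lemma coef_XaY_LM a D Q i j : (poly_XaY (LM a D)`_j * Q)`_i =
  match j with
  | 0%N => ('X + a%:P) * Q`_i + mul_lambda (nth 0 Q) i
  | 1%N => D%:P * Q`_i
  | _ => 0
  end.
Proof.
rewrite coef_LM; case: j => [|[|j]].
- rewrite rmorphD /= XaY_X XaY_C -addrA -polyCD mulrDl coefD coefXM coefCM
    addrC.
  by case: i.
- by rewrite XaY_C coefCM.
- by rewrite rmorph0 mul0r coef0.
Qed.

Lemma coef_M_LM a D Q i : (Q * LM a D)`_i =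
  ('X + a%:P) * Q`_i + D%:P * mul_lambda (nth 0 Q) i.
Proof.
rewrite /LM -polyCD mulrDr coefD coefMC mulrC mulrA coefMX coefMC.
by case: i => [|i] //=; rewrite ?mulr0 // [_ * D%:P]mulrC.
Qed.

(** This says that L acts correctly on the rank one module. Both coefficients vanish beyond
    lambda^1, so finitely many pairs (i, j) decide. *)
Lemma LM_coc a D i j :
  (poly_XaY (LM a D)`_j * LM a D)`_i - (poly_XaY (LM a D)`_i * LM a D)`_j =
  coefLL (fun n => (LM a D)`_n) i j.
Proof.
rewrite !coef_XaY_LM /coefLL /bracket_coef.
case: i j => [|[|[|i]]] [|[|[|j]]]; rewrite /mul_lambda ?addnS ?addn0 /=;
  rewrite ?addSn ?add0n !coef_LM ?oppr0 ?mulr0n ?mul0rn ?mulr0 ?addr0 ?subr0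
    ?subrr // ?bin0 ?bin1 ?binn; ring.
Qed.

(* The coefficients of lambda^i mu^j in the vbar-component of                  *)
(* L_lambda L_mu v, L_lambda H_mu v and H_mu L_lambda v.                       *)
Definition actLL al ab D Db F i j :=
  (poly_XaY F`_j * LM ab Db + poly_XaY (LM al D)`_j * F)`_i.

Definition cocL al ab D Db F := forall i j,
  actLL al ab D Db F i j - actLL al ab D Db F j i = coefLL (nth 0 F) i j.

Definition actLH ab Db G i j := (poly_XaY G`_j * LM ab Db)`_i.

Definition actHL al D G i j := (poly_XaY (LM al D)`_i * G)`_j.

Definition cocH b al ab D Db G := forall i j,
  actLH ab Db G i j - actHL al D G i j
  = coefLH b (nth 0 G : nat -> {poly C}^o) i j.

(** L reaches vbar from v either through F after which L acts on vbar, or through [LM] on v followed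
    by F. These are the two terms that occur for G, so computations for H serve L as well. *)
Lemma actLLE al ab D Db F i j :
  actLL al ab D Db F i j = actLH ab Db F i j + actHL al D F j i.
Proof. by rewrite /actLL coefD. Qed.

Lemma actLHE ab Db F i j : actLH ab Db F i j =
  ('X + ab%:P) * (F`_j)^`N(i)
  + Db%:P * (if i is i'.+1 then (F`_j)^`N(i') else 0).
Proof.
by rewrite /actLH coef_M_LM coef_XaY; case: i => //= i; rewrite coef_XaY.
Qed.

Lemma actHLE al D F i j : actHL al D F i j =
  match i with
  | 0%N => ('X + al%:P) * F`_j + mul_lambda (nth 0 F) j
  | 1%N => D%:P * F`_j
  | _ => 0
  end.
Proof. exact: coef_XaY_LM. Qed.

Lemma row2_bracket_coef (p0 p1 q0 q1 : nat -> {poly C}) i j :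
  bracket_coef (fun n => row2 (p0 n) (q0 n)) (fun n => row2 (p1 n) (q1 n)) i j =
  row2 (bracket_coef p0 p1 i j) (bracket_coef q0 q1 i j).
Proof. by rewrite /bracket_coef; case: i => [|i];
  rewrite ?addr0 !row2Mn ?row2D. Qed.

Lemma row2_mul_lambda (p q : nat -> {poly C}) n :
  - mul_lambda (fun n => row2 (p n) (q n)) n =
  row2 (- mul_lambda p n) (- mul_lambda q n).
Proof. by case: n => [|n] /=; rewrite ?row2N // oppr0 -row2_0 oppr0. Qed.

Lemma row2_coefLL (p q : nat -> {poly C}) i j :
  coefLL (fun n => row2 (p n) (q n)) i j = row2 (coefLL p i j) (coefLL q i j).
Proof.
rewrite /coefLL -row2_bracket_coef; apply: eq_bracket_coef => n;
  first exact: row2_mul_lambda.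
by rewrite row2Mn.
Qed.

Lemma row2_coefLH b (p q : nat -> {poly C}^o) i j :
  coefLH b (fun n => row2 (p n) (q n)) i j = row2 (coefLH b p i j) (coefLH b q i
    j).
Proof.
rewrite /coefLH -row2_bracket_coef; apply: eq_bracket_coef => n;
  first exact: row2_mul_lambda.
by rewrite row2Z.
Qed.

Lemma bracket_coef0 (M : zmodType) i j : bracket_coef (fun=> 0 : M) (fun=> 0) i
  j = 0.
Proof. by rewrite /bracket_coef mul0rn add0r; case: i => // i;
  rewrite mul0rn. Qed.

Lemma coefLL0 (M : zmodType) i j : coefLL (fun=> 0 : M) i j = 0.
Proof.
rewrite -[RHS](bracket_coef0 M i j); apply: eq_bracket_coef => n;
  last by rewrite mul0rn.
by case: n => [|n] /=; rewrite oppr0.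
Qed.

Lemma coefLH0 (M : lmodType {poly C}) b i j : coefLH b (fun=> 0 : M) i j = 0.
Proof.
rewrite -[RHS](bracket_coef0 M i j); apply: eq_bracket_coef => n;
  last by rewrite scaler0.
by case: n => [|n] /=; rewrite oppr0.
Qed.

Lemma W_sesquilinear b : sesquilinear (W_bracket b).
Proof. exact: sesqui_sesquilinear. Qed.

Section Module.
Variables (b al ab D Db : C) (F G : {poly {poly C}}).
Let act := sesqui (gen_E al ab D Db F G).
Let sq : sesquilinear act := sesqui_sesquilinear _.

Lemma comm_LL1 : comm_at (W_bracket b) act eL eL (row2 1 0).
Proof.
move=> i j.
have E n P : act eL n (row2 P 0) = row2 (poly_XaY P * LM ab Db)`_n 0.
  by rewrite /act act_L rmorph0 !mul0r addr0 coef0.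
have -> : bracket_act (W_bracket b) act eL eL (row2 1 0) i j =
   row2 (coefLL (nth 0 (LM ab Db)) i j) 0.
  rewrite bracket_LL // -[X in _ = row2 _ X](coefLL0 {poly C} i j) -row2_coefLL.
  apply: eq_bracket_coef => n; last by rewrite E rmorph1 mul1r.
  by case: n => [|n] //=; rewrite E rmorph1 mul1r.
by rewrite -LM_coc !E rmorph1 !mul1r row2N row2D oppr0 addr0.
Qed.

Lemma comm_LL2 : cocL al ab D Db F <->
  comm_at (W_bracket b) act eL eL (row2 0 1).
Proof.
have E i j : act eL i (act eL j (row2 0 1)) - act eL j (act eL i (row2 0 1)) =
    row2 (actLL al ab D Db F i j - actLL al ab D Db F j i) (coefLL (nth 0 (LM al
      D)) i j).
  by rewrite -LM_coc /actLL /act !act_L rmorph0 rmorph1 !mul0r !add0r !mul1r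
    row2N row2D.
have E' i j : bracket_act (W_bracket b) act eL eL (row2 0 1) i j =
   row2 (coefLL (nth 0 F) i j) (coefLL (nth 0 (LM al D)) i j).
  rewrite bracket_LL // -row2_coefLL; apply: eq_bracket_coef => n.
    by case: n => [|n] //=; rewrite /act act_L rmorph0 rmorph1 mul0r add0r
      !mul1r.
  by rewrite /act act_L rmorph0 rmorph1 mul0r add0r !mul1r.
split=> H i j; first by rewrite E E' H.
by have := H i j; rewrite E E' => /row2_inj[].
Qed.

Lemma comm_LH1 : comm_at (W_bracket b) act eL eH (row2 1 0).
Proof.
move=> i j.
have E n P : act eH n (row2 P 0) = 0 by rewrite /act act_H rmorph0 mul0r coef0
  row2_0.
have -> : bracket_act (W_bracket b) act eL eH (row2 1 0) i j = 0.
  rewrite bracket_LH // -[RHS](coefLH0 ('rV[{poly C}]_(1 + 1)) b i j).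
  apply: eq_bracket_coef => n; last by rewrite E.
  by case: n => [|n] //=; rewrite E.
have E' : act eL i (row2 1 0) = row2 (poly_XaY 1 * LM ab Db)`_i 0.
  by rewrite /act act_L rmorph0 !mul0r addr0 coef0.
by rewrite E (sq_0r sq) sub0r E' E oppr0.
Qed.

Lemma comm_LH2 : cocH b al ab D Db G <->
  comm_at (W_bracket b) act eL eH (row2 0 1).
Proof.
have E i j : act eL i (act eH j (row2 0 1)) - act eH j (act eL i (row2 0 1)) =
    row2 (actLH ab Db G i j - actHL al D G i j) 0.
  rewrite /act act_H !act_L act_H rmorph0 rmorph1 !mul1r !mul0r coef0 addr0.
  by rewrite row2N row2D oppr0 addr0.
have E' i j : bracket_act (W_bracket b) act eL eH (row2 0 1) i j =
   row2 (coefLH b (nth 0 G : nat -> {poly C}^o) i j) 0.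
  rewrite bracket_LH // -[X in _ = row2 _ X](coefLH0 {poly C}^o b i j)
    -row2_coefLH.
  apply: eq_bracket_coef => n.
    by case: n => [|n] //=; rewrite /act act_H rmorph1 mul1r.
  by rewrite /act act_H rmorph1 mul1r.
split=> H i j; first by rewrite E E' H.
by have := H i j; rewrite E E' => /row2_inj[].
Qed.

Lemma comm_HH v : comm_at (W_bracket b) act eH eH v.
Proof.
move=> i j; rewrite bracket_HH // [v]row2_surj /act !act_H.
by rewrite !rmorph0 !mul0r !coef0 row2_0 subr0.
Qed.

Lemma conformal_E : conformal_module (W_bracket b) act <->
  cocL al ab D Db F /\ cocH b al ab D Db G.
Proof.
split=> [M|[HL HH]].
  by split; [apply/comm_LL2|apply/comm_LH2] => i j; exact: (cm_commutator M).
apply: conformal_sesqui; first exact: W_sesquilinear.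
have LL e : comm_at (W_bracket b) act eL eL (delta_mx 0 e).
  case: (ord2_cases e) => ->; first by rewrite -[X in comm_at _ _ _ _ X]row2_L;
    exact: comm_LL1.
  by rewrite -[X in comm_at _ _ _ _ X]row2_H; apply/comm_LL2.
have LH e : comm_at (W_bracket b) act eL eH (delta_mx 0 e).
  case: (ord2_cases e) => ->; first by rewrite -[X in comm_at _ _ _ _ X]row2_L;
    exact: comm_LH1.
  by rewrite -[X in comm_at _ _ _ _ X]row2_H; apply/comm_LH2.
move=> k l e; case: (ord2_cases k) (ord2_cases l) => -> [] ->.
- exact: LL.
- exact: LH.
- exact: comm_HL.
- exact: comm_HH.
Qed.

End Module.

End Cocycles.

(** * Extensions and coboundaries *)

Section Extensions.

Variable C : numClosedFieldType.
Local Notation dd := ('X%:P : {poly {poly C}}).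
Local Notation ll := ('X : {poly {poly C}}).
Local Notation cst c := (c%:P%:P : {poly {poly C}}).
Implicit Types (al ab D Db b a : C) (F G Q : {poly {poly C}}) (phi : {poly C}).

Definition E0_act al ab D Db F G := sesqui (gen_E al ab D Db F G).

Lemma E0_sesquilinear al ab D Db F G : sesquilinear (E0_act al ab D Db F G).
Proof. exact: sesqui_sesquilinear. Qed.

Lemma M_sesquilinear a D : sesquilinear (M_act a D).
Proof. exact: sesqui_sesquilinear. Qed.

Lemma M_act_L a D n P :
  M_act a D eL n P%:M = ((poly_XaY P * LM a D)`_n)%:M.
Proof.
rewrite /M_act sesqui_delta /M_gen eqxx.
by apply/matrixP => i j; rewrite !ord1 !mxE !big_ord1 !mxE !eqxx !mulr1n.
Qed.

Lemma M_act_H a D n v : M_act a D eH n v = 0.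
Proof.
rewrite /M_act sesqui_delta /M_gen /= mulmx0.
by apply/matrixP => i j; rewrite !mxE coef0.
Qed.

Lemma compat_all (M N : lmodType {poly C}) actM actN (h : M -> N) x :
  sesquilinear actM -> sesquilinear actN -> linear h ->
  compat actM actN h eL x -> compat actM actN h eH x ->
  forall c, compat actM actN h c x.
Proof.
move=> sqM sqN hl HL HH; apply: row_ind => [n|a a'|p k].
- by rewrite (sq_0l sqM) (sq_0l sqN) (lin_0 hl).
- exact: compat_Dl.
- by apply: compat_Zl => //; case: (ord2_cases k) => ->.
Qed.

Lemma row2_split (P Q : {poly C}) : row2 P Q = P *: row2 1 0 + Q *: row2 0 1.
Proof. by rewrite !row2Z row2D !mulr1 !mulr0 addr0 add0r. Qed.

(** The four families of equations are the actions of L and H on the two generators. *)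
Lemma row2_hom (N : lmodType {poly C}) al ab D Db F G actN (h : 'rV_(1 + 1) ->
  N) :
  sesquilinear actN -> linear h ->
  (forall n, h (row2 (LM ab Db)`_n 0) = actN eL n (h (row2 1 0))) ->
  (forall n, 0 = actN eH n (h (row2 1 0))) ->
  (forall n, h (row2 F`_n (LM al D)`_n) = actN eL n (h (row2 0 1))) ->
  (forall n, h (row2 G`_n 0) = actN eH n (h (row2 0 1))) ->
  conformal_hom (E0_act al ab D Db F G) actN h.
Proof.
move=> sqN hl H1 H2 H3 H4; split=> // a n v.
have sqM := E0_sesquilinear al ab D Db F G.
suff: compat (E0_act al ab D Db F G) actN h a v by [].
rewrite [v]row2_surj row2_split; apply: compat_Dr => //; apply: compat_Zr => //;
  apply: compat_all => // k; rewrite /E0_act ?act_L ?act_H ?rmorph0 ?rmorph1.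
- by rewrite mul0r addr0 mul1r mul0r coef0.
- by rewrite mul0r coef0 row2_0 (lin_0 hl).
- by rewrite mul0r add0r !mul1r.
- by rewrite mul1r.
Qed.

Lemma E_injE (v : 'rV[{poly C}]_1) : E_inj v = row2 (v 0 0) 0.
Proof. by rewrite /E_inj /row2 raddf0 -mx11_scalar. Qed.

Lemma E_projE (P Q : {poly C}) : E_proj (row2 P Q) = Q%:M.
Proof. by rewrite /E_proj /row2 row_mxKr. Qed.

Lemma E_inj_hom al ab D Db F G :
  conformal_hom (M_act ab Db) (E0_act al ab D Db F G) (@E_inj C).
Proof.
have hl : linear (@E_inj C).
  by move=> c u v; rewrite /E_inj scale_row_mx add_row_mx scaler0 addr0.
have sqM := M_sesquilinear ab Db.
have sqN := E0_sesquilinear al ab D Db F G.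
split=> // a n v; suff: compat (M_act ab Db) (E0_act al ab D Db F G)
  (@E_inj C) a v by [].
rewrite [v]mx11_scalar -[_ 0 0]mulr1 -scale_scalar_mx; apply: compat_Zr => //.
apply: compat_all => // k; rewrite !E_injE.
  rewrite M_act_L mxE eqxx mulr1n /E0_act mxE eqxx mulr1n act_L rmorph0 !mul0r.
  by rewrite addr0 coef0.
by rewrite M_act_H !mxE eqxx mulr1n /E0_act act_H rmorph0 mul0r coef0.
Qed.

Lemma E_proj_hom al ab D Db F G :
  conformal_hom (E0_act al ab D Db F G) (M_act al D) (@E_proj C).
Proof.
apply: row2_hom => [||n|n|n|n].
- exact: M_sesquilinear.
- by move=> c u v; rewrite /E_proj linearP.
- by rewrite !E_projE M_act_L poly_XaY0 mul0r coef0.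
- by rewrite M_act_H.
- by rewrite !E_projE M_act_L rmorph1 mul1r.
- by rewrite !E_projE M_act_H raddf0.
Qed.

Lemma E_is_extension b al ab D Db F G :
  cocL al ab D Db F -> cocH b al ab D Db G ->
  is_extension (W_bracket b) (M_act ab Db) (M_act al D)
    (E0_act al ab D Db F G) (@E_inj C) (@E_proj C).
Proof.
move=> HF HG; split.
- exact/conformal_E.
- exact: E_inj_hom.
- exact: E_proj_hom.
- by move=> u v /eq_row_mx[].
- move=> x; split=> [xr|[v ->]]; last by rewrite /E_proj /E_inj row_mxKr.
  by exists (lsubmx x); rewrite /E_inj -xr /E_proj hsubmxK.
- by move=> w; exists (row_mx 0 w); rewrite /E_proj row_mxKr.
Qed.

(* The change of F when v is replaced by v + phi vbar. *)
Definition dcob al ab D Db phi : {poly {poly C}} :=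
  poly_XaY phi * LM ab Db - phi%:P * LM al D.

Lemma dcobN al ab D Db phi : dcob al ab D Db (- phi) = - dcob al ab D Db phi.
Proof.
rewrite /dcob; move: (LM ab Db) (LM al D) => Q Q'.
by rewrite XaY_N polyCN !mulNr opprB opprK addrC.
Qed.

Lemma dcob0 al ab D Db : dcob al ab D Db 0 = 0.
Proof. by rewrite /dcob !rmorph0 !mul0r subr0. Qed.

Definition shear phi (x : 'rV[{poly C}]_(1 + 1)) :=
  row2 (lsubmx x 0 0 + phi * rsubmx x 0 0) (rsubmx x 0 0).

Lemma shear_row2 phi (P Q : {poly C}) : shear phi (row2 P Q) = row2 (P + phi *
  Q) Q.
Proof. by rewrite /shear /row2 row_mxKl row_mxKr !mxE !mulr1n. Qed.

Lemma shear_linear phi : linear (shear phi).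
Proof.
move=> c x y; rewrite [x]row2_surj [y]row2_surj.
move: (lsubmx x 0 0) (rsubmx x 0 0) (lsubmx y 0 0) (rsubmx y 0 0) => P Q P' Q'.
rewrite row2Z row2D !shear_row2 row2Z row2D; congr (row2 _ _).
by rewrite !mulrDr [RHS]addrACA; congr (_ + (_ + _)); rewrite mulrCA.
Qed.

Lemma shear_hom al ab D Db F G phi :
  conformal_hom (E0_act al ab D Db (F + dcob al ab D Db phi) G)
    (E0_act al ab D Db F G) (shear phi).
Proof.
apply: row2_hom => [||n|n|n|n];
  rewrite ?shear_row2 ?mulr0 ?mulr1 ?add0r ?addr0 //.
- exact: E0_sesquilinear.
- exact: shear_linear.
- by rewrite /E0_act act_L rmorph0 rmorph1 !mul0r addr0 coef0 mul1r.
- by rewrite /E0_act act_H rmorph0 mul0r coef0 row2_0.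
- rewrite /E0_act act_L rmorph1 !mul1r; congr (row2 _ _).
  by rewrite (coefD F) coefB coefCM (coefD (_ * LM ab Db)) addrA subrK addrC.
- by rewrite /E0_act act_H rmorph1 mul1r.
Qed.

Lemma shear_equiv al ab D Db F G phi :
  ext_equiv (E0_act al ab D Db (F + dcob al ab D Db phi) G) (@E_inj C) (@E_proj
    C)
    (E0_act al ab D Db F G) (@E_inj C) (@E_proj C).
Proof.
exists (shear phi); split=> [|v|x]; first exact: shear_hom.
  by rewrite E_injE shear_row2 mulr0 addr0.
by rewrite [x]row2_surj shear_row2 !E_projE.
Qed.

Lemma actLH0 ab Db i j : actLH ab Db 0 i j = 0.
Proof. by rewrite /actLH coef0 poly_XaY0 mul0r coef0. Qed.

Lemma actHL0 al D i j : actHL al D 0 i j = 0.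
Proof. by rewrite /actHL mulr0 coef0. Qed.

Lemma cocL0 al ab D Db : cocL al ab D Db 0.
Proof.
move=> i j; rewrite !actLLE !actLH0 !actHL0 subrr.
rewrite -[LHS](coefLL0 {poly C} i j); apply: eq_bracket_coef => n;
  last by rewrite coef0.
by case: n => [|n] //=; rewrite coef0.
Qed.

Lemma cocH0 b al ab D Db : cocH b al ab D Db 0.
Proof.
move=> i j; rewrite actLH0 actHL0 subrr.
rewrite -[LHS](coefLH0 {poly C}^o b i j); apply: eq_bracket_coef => n;
  last by rewrite coef0.
by case: n => [|n] //=; rewrite coef0.
Qed.

Lemma cocL_D_cob al ab D Db F phi :
  cocL al ab D Db (F + dcob al ab D Db phi) -> cocL al ab D Db F.
Proof.
(* With b = 0 and G = 0 the equation for F becomes the existence of a module, which the invertible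
   shear carries over. *)
move=> HF; suff: conformal_module (W_bracket 0) (E0_act al ab D Db F 0).
  by case/conformal_E.
apply: (conformal_transport (actM := E0_act al ab D Db (F + dcob al ab D Db phi)
  0)
  (h := shear phi)).
- by apply/conformal_E; split=> //; exact: cocH0.
- exact: E0_sesquilinear.
- exact: sesqui_finite.
- exact: shear_hom.
- move=> y; exists (shear (- phi) y); rewrite [y]row2_surj !shear_row2.
  by rewrite mulNr subrK.
Qed.

Lemma cocL_dcob al ab D Db phi : cocL al ab D Db (dcob al ab D Db phi).
Proof.
apply: (@cocL_D_cob _ _ _ _ _ (- phi)); rewrite dcobN subrr; exact: cocL0.
Qed.

Lemma split_equiv al ab D Db :
  trivial_extension (M_act ab Db) (M_act al D)
    (E0_act al ab D Db 0 0) (@E_inj C) (@E_proj C).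
Proof.
exists (fun x => (lsubmx x, rsubmx x)); split=> [|v|x] //; last first.
  by rewrite /E_inj row_mxKl row_mxKr.
have h (P Q : {poly C}) : (lsubmx (row2 P Q), rsubmx (row2 P Q)) = (P%:M, Q%:M).
  by rewrite /row2 row_mxKl row_mxKr.
apply: row2_hom => [||n|n|n|n].
- have sM := M_sesquilinear ab Db; have sM' := M_sesquilinear al D.
  split=> [c a a' n v|c a n v v'|a n v|a n v]; congr pair => /=.
  + exact: (sq_linearl sM).
  + exact: (sq_linearl sM').
  + exact: (sq_linearr sM).
  + exact: (sq_linearr sM').
  + by rewrite (sq_dl sM); case: (n).
  + by rewrite (sq_dl sM'); case: (n).
  + by rewrite (sq_dr sM); case: (n).
  + by rewrite (sq_dr sM'); case: (n).
- by move=> c x y; rewrite !linearP.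
- by rewrite !h /dsum_act /= !M_act_L rmorph1 poly_XaY0 mul1r mul0r coef0.
- by rewrite /dsum_act !M_act_H.
- by rewrite !h /dsum_act /= !M_act_L rmorph1 poly_XaY0 mul1r mul0r !coef0.
- by rewrite !h /dsum_act /= !M_act_H !coef0 !raddf0.
Qed.

Lemma dcob_trivial al ab D Db phi :
  trivial_extension (M_act ab Db) (M_act al D)
    (E0_act al ab D Db (dcob al ab D Db phi) 0) (@E_inj C) (@E_proj C).
Proof.
apply: ext_equiv_trans (split_equiv al ab D Db).
by have := shear_equiv al ab D Db 0 0 phi; rewrite add0r.
Qed.

(** A splitting sends v to v + phi vbar; comparing the actions of L and H on v gives F and G. *)
Lemma trivial_dcob al ab D Db F G :
  trivial_extension (M_act ab Db) (M_act al D)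
    (E0_act al ab D Db F G) (@E_inj C) (@E_proj C) ->
  exists phi, F = dcob al ab D Db phi /\ G = 0.
Proof.
case=> psi [[hl ha] hi hp].
have psi2 : (psi (row2 0 1)).2 = 1%:M by rewrite hp E_projE.
set phi := (psi (row2 0 1)).1 0 0; exists phi.
have e2 : psi (row2 0 1) = (phi%:M, 1%:M).
  by rewrite [LHS]surjective_pairing psi2 -mx11_scalar.
have e1 : psi (row2 1 0) = (1%:M, 0).
  by rewrite -hi E_injE mxE.
have e (P Q : {poly C}) : psi (row2 P Q) = ((P + Q * phi)%:M, Q%:M).
  rewrite row2_split (lin_D hl) !(lin_Z hl) e1 e2; congr pair => /=.
    by rewrite !scale_scalar_mx mulr1 raddfD.
  by rewrite scaler0 add0r scale_scalar_mx mulr1.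
split; apply/polyP => n.
  have := ha eL n (row2 0 1);
    rewrite /E0_act act_L rmorph0 rmorph1 !mul1r mul0r.
  rewrite add0r e e2 /dsum_act /= !M_act_L => -[/matrixP/(_ 0 0)+ _].
  rewrite !mxE !eqxx !mulr1n /dcob coefB coefCM => <-.
  by rewrite mulrC addrK.
have := ha eH n (row2 0 1); rewrite /E0_act act_H rmorph1 mul1r e /dsum_act /=.
rewrite !M_act_H => -[/matrixP/(_ 0 0)+ _].
by rewrite !mxE mul0r addr0 mulr1n coef0.
Qed.

Lemma extension_normal b al ab D Db (E : lmodType {poly C})
    (actE : 'rV[{poly C}]_2 -> nat -> E -> E) i p :
  is_extension (W_bracket b) (M_act ab Db) (M_act al D) actE i p ->
  exists F G, [/\ cocL al ab D Db F, cocH b al ab D Db G &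
    ext_equiv actE i p (E0_act al ab D Db F G) (@E_inj C) (@E_proj C)].
Proof.
case=> cm [il ia] [pl pa] iinj ex surj.
have [x0 px0] := surj 1%:M.
(* Exactness provides the component of x in V relative to the lift x0; the boolean equality lets
   [xchoose] pick it, and injectivity of i makes the choice linear. *)
have H x : exists v, i v == x - p x 0 0 *: x0.
  have : p (x - p x 0 0 *: x0) = 0.
    by rewrite (lin_B pl) (lin_Z pl) px0 scale_scalar_mx mulr1 -mx11_scalar
      subrr.
  by move/ex => [v ->]; exists v.
pose q x := xchoose (H x).
have qP x : i (q x) = x - p x 0 0 *: x0 by apply/eqP; exact: xchooseP (H x).
have ql : linear q.
  move=> c x y; apply: iinj; rewrite (lin_D il) (lin_Z il) !qP (lin_D pl) (lin_Z
    pl).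
  rewrite !mxE scalerBr scalerA scalerDl opprD.
  by rewrite addrACA.
have pi v : p (i v) = 0 by apply/ex; exists v.
have qi v : q (i v) = v by apply: iinj; rewrite qP pi mxE scale0r subr0.
have qx0 : q x0 = 0.
  by apply: iinj; rewrite qP px0 mxE eqxx scale1r subrr (lin_0 il).
have sq := conformal_sesquilinear cm.
pose psi x := row2 (q x 0 0) (p x 0 0).
have psil : linear psi.
  by move=> c x y; rewrite /psi row2Z row2D (lin_D ql) (lin_Z ql) (lin_D pl)
    (lin_Z pl) !mxE.
have psii v : psi (i v) = E_inj v by rewrite /psi qi pi E_injE mxE.
have psix0 : psi x0 = row2 0 1 by rewrite /psi qx0 px0 !mxE eqxx.
have [N1 fin1] := cm_finite cm eL x0.
have [N2 fin2] := cm_finite cm eH x0.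
(* F and G are the V-components of L and H on the lift; the finiteness axiom makes them polynomials
   in lambda. *)
pose F := \poly_(n < N1) q (actE eL n x0) 0 0.
pose G := \poly_(n < N2) q (actE eH n x0) 0 0.
have FE n : F`_n = q (actE eL n x0) 0 0.
  by rewrite coef_poly; case: ltnP => // /fin1 ->; rewrite (lin_0 ql) mxE.
have GE n : G`_n = q (actE eH n x0) 0 0.
  by rewrite coef_poly; case: ltnP => // /fin2 ->; rewrite (lin_0 ql) mxE.
exists F, G.
have sq0 := E0_sesquilinear al ab D Db F G.
have hpsi : conformal_hom actE (E0_act al ab D Db F G) psi.
  split=> // a n x; suff: compat actE (E0_act al ab D Db F G) psi a x by [].
  have -> : x = i (q x) + p x 0 0 *: x0 by rewrite qP subrK.
  apply: compat_Dr => //.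
    by move=> k; rewrite -ia !psii (ch_act (E_inj_hom al ab D Db F G)).
  apply: compat_Zr => //; apply: compat_all => // k; rewrite psix0.
    rewrite /E0_act act_L rmorph0 rmorph1 !mul1r mul0r add0r FE /psi pa px0.
    by rewrite M_act_L rmorph1 mul1r [X in row2 _ X]mxE eqxx mulr1n.
  by rewrite /E0_act act_H rmorph1 !mul1r GE /psi pa px0 M_act_H mxE.
have cm0 : conformal_module (W_bracket b) (E0_act al ab D Db F G).
  apply: (conformal_transport cm sq0 _ hpsi); first exact: sesqui_finite.
  move=> y; rewrite [y]row2_surj; set P := lsubmx y 0 0; set Q := rsubmx y 0 0.
  exists (i P%:M + Q *: x0); rewrite (lin_D psil) (lin_Z psil) psii psix0
    E_injE.
  by rewrite mxE eqxx mulr1n row2Z row2D mulr0 mulr1 addr0 add0r.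
case/conformal_E: cm0 => cL cH; split=> //; exists psi; split=> // x.
by rewrite /psi E_projE -mx11_scalar.
Qed.

(** The constant coefficient in lambda of L acts on vbar as d + alphabar and on v as d + alpha
    modulo vbar. Comparing its commutators with the other coefficients gives (alphabar - alpha) F =
    [dcob] of the constant coefficient of F, and (alphabar - alpha) G = 0. *)
Lemma coc_neq b al ab D Db F G : al != ab ->
  cocL al ab D Db F -> cocH b al ab D Db G ->
  exists phi, F = dcob al ab D Db phi /\ G = 0.
Proof.
move=> nab HF HG.
have dne : ab - al != 0 by rewrite subr_eq0 eq_sym.
exists (((ab - al)^-1)%:P * F`_0); split; apply/polyP => j; last first.
  have := HG 0%N j; rewrite actLHE actHLE /coefLH /bracket_coef add0n binn
    coef0.
  rewrite nderivn0 /= mulr0 !addr0 mulr1n.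
  have -> : mul_lambda (nth 0 G : nat -> {poly C}^o) j = mul_lambda (nth 0 G) j.
    by [].
  move/eqP; rewrite opprD addrA -subr_eq0 opprK subrK -mulrBl.
  rewrite opprD addrACA subrr add0r -polyCB mul_polyC scaler_eq0 (negPf dne).
  by move/eqP.
have := HF 0%N j; rewrite !actLLE (actLHE _ _ _ 0) !actHLE nderivn0.
have -> : coefLL (nth 0 F) 0 j = - mul_lambda (nth 0 F) j.
  by rewrite /coefLL /bracket_coef add0n binn addr0 mulr1n.
rewrite /= mulr0 !addr0.
set M := (X in _ + X - _); have -> : M = F`_0 * (LM al D)`_j.
  by rewrite /M coef_LM; case: (j) => [|[|k]]; rewrite ?mulr0 // mulrC.
rewrite /dcob coefB coefCM rmorphM /= XaY_C -mulrA coefCM -/(actLH ab Db F j 0).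
set T := actLH _ _ _ _ _; set N := F`_0 * _ => e.
rewrite -[_ * F`_0 * _]mulrA -/N -mulrBr.
apply: (@mulfI _ (ab - al)%:P); first by rewrite polyC_eq0.
rewrite mulrA -polyCM mulfV // mul1r polyCB; apply/eqP; rewrite -subr_eq0.
move/eqP: e; rewrite -subr_eq0; congr (_ == 0); ring.
Qed.

End Extensions.

(** * Shifting and scalar equations *)

Section Shift.
Variable C : numClosedFieldType.
Local Notation dd := ('X%:P : {poly {poly C}}).
Local Notation ll := ('X : {poly {poly C}}).
Local Notation cst c := (c%:P%:P : {poly {poly C}}).
Variable a : C.

HB.instance Definition _ := GRing.RMorphism.copy (@shift_d C a)
  (map_poly (comp_poly ('X + a%:P))).

Lemma coef_shift_d (F : {poly {poly C}}) n :
  (shift_d a F)`_n = F`_n \Po ('X + a%:P).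
Proof. by rewrite /shift_d coef_map_id0 ?comp_poly0. Qed.

Lemma shift_dB (F G : {poly {poly C}}) :
  shift_d a (F - G) = shift_d a F - shift_d a G.
Proof.
by apply/eqP; rewrite eq_sym subr_eq -(rmorphD (@shift_d C a)) subrK.
Qed.

Lemma shift_d_C (P : {poly C}) : shift_d a P%:P = (P \Po ('X + a%:P))%:P.
Proof.
by apply/polyP => n; rewrite coef_shift_d !coefC; case: n => //=;
  rewrite comp_poly0.
Qed.

Lemma shift_d_X : shift_d a 'X = 'X.
Proof. by rewrite /shift_d (map_polyX (comp_poly ('X + a%:P))). Qed.

Lemma XaY_shift (P : {poly C}) :
  poly_XaY (P \Po ('X + a%:P)) = shift_d a (poly_XaY P).
Proof.
elim/poly_ind: P => [|P c IH]; first by rewrite comp_poly0 poly_XaY0 rmorph0.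
rewrite comp_poly_MXaddC !rmorphD !rmorphM /= IH !rmorphD /= !XaY_X !XaY_C.
by rewrite !rmorphD /= shift_d_X !shift_d_C comp_polyX !comp_polyC polyCD addrA.
Qed.

Lemma LM_shift D : LM a D = shift_d a (LM 0 D).
Proof.
rewrite /LM !rmorphD rmorphM /= shift_d_X !shift_d_C comp_polyX !comp_polyC.
by rewrite polyCD polyC0 addr0.
Qed.

Lemma comp_shift_inj : injective (comp_poly ('X + a%:P)).
Proof. exact: can_inj (fun p => comp_polyXaddC_K p a). Qed.

Lemma shift_dK (F : {poly {poly C}}) : shift_d a (shift_d (- a) F) = F.
Proof.
apply/polyP => n; rewrite !(coef_shift_d, coef_map_id0) ?comp_poly0 //.
have := comp_polyXaddC_K F`_n (- a); rewrite polyCN opprK => {2}<-.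
by [].
Qed.

End Shift.

Section ShiftCocycle.
Variable C : numClosedFieldType.
Variables (al D Db : C).

Lemma coefLL_shift (F : {poly {poly C}}) i j :
  coefLL (nth 0 (shift_d al F)) i j = coefLL (nth 0 F) i j \Po ('X + al%:P).
Proof.
rewrite /coefLL /bracket_coef comp_polyD !(raddfMn (comp_poly ('X + al%:P)))
  (raddfN (comp_poly ('X + al%:P))) /=; congr (- _ *+ _ + _).
  by case: (i + j)%N => [|n] /=; rewrite ?comp_poly0 // coef_shift_d.
by case: i => [|i]; rewrite ?comp_poly0 // !raddfMn /= coef_shift_d.
Qed.

Lemma coefLH_shift b (F : {poly {poly C}}) i j :
  coefLH b (nth 0 (shift_d al F) : nat -> {poly C}^o) i j =
  coefLH b (nth 0 F : nat -> {poly C}^o) i j \Po ('X + al%:P).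
Proof.
rewrite /coefLH /bracket_coef comp_polyD !(raddfMn (comp_poly ('X + al%:P)))
  (raddfN (comp_poly ('X + al%:P))) /=; congr (- _ *+ _ + _).
  by case: (i + j)%N => [|n] /=; rewrite ?comp_poly0 // coef_shift_d.
case: i => [|i]; rewrite ?comp_poly0 // !raddfMn /= coef_shift_d.
by rewrite [in RHS]/GRing.scale /= comp_polyM comp_polyC.
Qed.

Lemma coef_shift_mul (P : {poly C}) Q i :
  (poly_XaY (P \Po ('X + al%:P)) * shift_d al Q)`_i =
  (poly_XaY P * Q)`_i \Po ('X + al%:P).
Proof. by rewrite XaY_shift -(rmorphM (@shift_d C al)) coef_shift_d. Qed.

Lemma actLH_shift F i j :
  actLH al Db (shift_d al F) i j = actLH 0 Db F i j \Po ('X + al%:P).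
Proof. by rewrite /actLH (LM_shift al) coef_shift_d coef_shift_mul. Qed.

Lemma actHL_shift F i j :
  actHL al D (shift_d al F) i j = actHL 0 D F i j \Po ('X + al%:P).
Proof. by rewrite /actHL (LM_shift al) coef_shift_d coef_shift_mul. Qed.

(** All ingredients of the equation are compatible with the substitution d -> d + alpha, which
    reduces it to alpha = 0. *)
Lemma cocL_shift F :
  cocL al al D Db (shift_d al F) <-> cocL 0 0 D Db F.
Proof.
have E i j : actLL al al D Db (shift_d al F) i j
    = actLL 0 0 D Db F i j \Po ('X + al%:P).
  by rewrite !actLLE actLH_shift actHL_shift comp_polyD.
split=> H i j; last by rewrite !E coefLL_shift -H comp_polyB.
by apply: (@comp_shift_inj C al); rewrite comp_polyB -!E H coefLL_shift.
Qed.

Lemma cocH_shift b F :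
  cocH b al al D Db (shift_d al F) <-> cocH b 0 0 D Db F.
Proof.
split=> H i j.
  apply: (@comp_shift_inj C al).
  by rewrite comp_polyB -actLH_shift -actHL_shift H coefLH_shift.
by rewrite actLH_shift actHL_shift coefLH_shift -H comp_polyB.
Qed.

Lemma dcob_shift phi :
  dcob al al D Db (phi \Po ('X + al%:P)) = shift_d al (dcob 0 0 D Db phi).
Proof.
rewrite /dcob !(LM_shift al) XaY_shift -shift_d_C.
move: (LM 0 Db) (LM 0 D) => Q Q'.
by rewrite shift_dB !(rmorphM (@shift_d C al)).
Qed.

End ShiftCocycle.

(** * The cocycle equations coefficient by coefficient *)

Section Scalars.
Variable C : numClosedFieldType.
Variables (D Db : C).
Implicit Types (F G : {poly {poly C}}).

(* The coefficients of lambda^i mu^j d^l in the summands of actLL. *)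
Definition scalS (F : {poly {poly C}}) i j l : C :=
  (if l is l'.+1 then F`_j`_(i + l') *+ 'C(i + l', i) else 0) +
  Db * (if i is i'.+1 then F`_j`_(i' + l) *+ 'C(i' + l, i') else 0).

Definition scalR (F : {poly {poly C}}) i j l : C :=
  match j with
  | 0%N => (if l is l'.+1 then F`_i`_l' else 0) +
           (if i is i'.+1 then F`_i'`_l else 0)
  | 1%N => D * F`_i`_l
  | _ => 0
  end.

Lemma coef_scalS F i j l : (actLH 0 Db F i j)`_l = scalS F i j l.
Proof.
rewrite actLHE polyC0 addr0 coefD coefXM coefCM /scalS; congr (_ + _ * _).
  by case: l => //= l; rewrite coef_nderivn.
by case: i => [|i] /=; rewrite ?coef0 // coef_nderivn.
Qed.

Lemma coef_scalR F i j l : (actHL 0 D F j i)`_l = scalR F i j l.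
Proof.
rewrite actHLE polyC0 addr0 /scalR.
case: j => [|[|j]]; rewrite ?coef0 ?coefCM // coefD coefXM.
by case: l i => [|l] [|i] //=; rewrite coef0.
Qed.

Lemma coef_coefLL F i j l : (coefLL (nth 0 F) i j)`_l = coefLL (fun n =>
  F`_n`_l) i j.
Proof.
rewrite /coefLL /bracket_coef coefD !coefMn coefN; congr (- _ *+ _ + _).
  by case: (i + j)%N => [|n] //=; rewrite coef0.
by case: i => [|i]; rewrite ?coef0 // !coefMn.
Qed.

Lemma cocLP F : cocL 0 0 D Db F <-> forall i j l,
  scalS F i j l + scalR F i j l - (scalS F j i l + scalR F j i l) =
  coefLL (fun n => F`_n`_l) i j.
Proof.
split=> H i j.
  move=> l; rewrite -coef_coefLL -H.
  by rewrite !actLLE coefB 2!coefD !coef_scalS !coef_scalR.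
apply/polyP => l; rewrite coef_coefLL -H.
by rewrite !actLLE coefB 2!coefD !coef_scalS !coef_scalR.
Qed.

Definition coefLHc b (u : nat -> C) :=
  bracket_coef (fun n => - mul_lambda u n) (fun n => (1 - b) * u n).

Lemma coef_coefLH b F i j l :
  (coefLH b (nth 0 F : nat -> {poly C}^o) i j)`_l = coefLHc b (fun n => F`_n`_l)
    i j.
Proof.
rewrite /coefLH /coefLHc /bracket_coef coefD !coefMn coefN;
  congr (- _ *+ _ + _).
  by case: (i + j)%N => [|n] //=; rewrite coef0.
by case: i => [|i]; rewrite ?coef0 // !coefMn coefCM.
Qed.

Lemma cocHP b F : cocH b 0 0 D Db F <-> forall i j l,
  scalS F i j l - scalR F j i l = coefLHc b (fun n => F`_n`_l) i j.
Proof.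
split=> H i j.
  by move=> l; rewrite -coef_coefLH -H coefB coef_scalS coef_scalR.
by apply/polyP => l; rewrite coef_coefLH -H coefB coef_scalS coef_scalR.
Qed.

Lemma coef_dcob phi i l : (dcob 0 0 D Db phi)`_i`_l =
  scalS phi%:P i 0 l - match i with
     | 0%N => if l is l'.+1 then phi`_l' else 0
     | 1%N => D * phi`_l
     | _ => 0
     end.
Proof.
rewrite /dcob coefB coefCM coefB coef_LM polyC0 addr0 -coef_scalS /actLH.
rewrite coefC /=; congr (_ - _); case: i => [|[|i]].
- by rewrite coefMX; case: l.
- by rewrite mulrC coefCM.
- by rewrite mulr0 coef0.
Qed.

End Scalars.

(** * Homogeneous cocycles *)

Section Homogeneous.
Variable C : numClosedFieldType.
Local Notation cst c := (c%:P%:P : {poly {poly C}}).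
Variables (D Db : C).
Implicit Types (F : {poly {poly C}}).

(** The coefficient of lambda^1 of L multiplies d^l vbar by l + Deltabar: it is an Euler operator,
    the source of all gradings below. *)
Lemma scalS1 F j l :
  scalS Db F 1 j l = (l%:R + Db) * F`_j`_l.
Proof.
rewrite /scalS mulrDl; congr (_ + _ * _); last by rewrite bin0.
by case: l => [|l]; rewrite ?mul0r // bin1 add1n mulr_natl.
Qed.

Lemma coefLL_SS (u : nat -> C) i j : coefLL u i.+1 j.+1 =
  u (i + j).+1 * ('C((i + j).+1, j.+1)%:R - 'C((i + j).+1, j)%:R).
Proof.
rewrite /coefLL /bracket_coef addSn addnS /= binS; ring.
Qed.

Lemma coefLL_0j (u : nat -> C) j : coefLL u 0 j = - mul_lambda u j.
Proof. by rewrite /coefLL /bracket_coef add0n binn mulr1n addr0. Qed.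

(** The factor lambda - mu is antisymmetric and u(lambda + mu) symmetric. *)
Lemma coefLL_anti (u : nat -> C) i j : coefLL u i j = - coefLL u j i.
Proof.
case: i j => [|i] [|j].
- by rewrite !coefLL_0j /= !oppr0.
- by rewrite coefLL_0j /coefLL /bracket_coef !addn0 !bin0 /=; ring.
- by rewrite coefLL_0j /coefLL /bracket_coef !addn0 !bin0 /=; ring.
- rewrite !coefLL_SS [(j + i)%N]addnC.
  have -> : 'C((i + j).+1, i.+1) = 'C((i + j).+1, j).
    by rewrite -[RHS]bin_sub ?leqW ?leq_addl // -addSn addnK.
  have -> : 'C((i + j).+1, j.+1) = 'C((i + j).+1, i).
    by rewrite -[RHS]bin_sub ?leqW ?leq_addr // -addnS addKn.
  ring.
Qed.

(* The coefficient of lambda^1 says that L_(1) grades F, up to coboundaries. *)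
Lemma coc_weight F j l : cocL 0 0 D Db F ->
  F`_1`_(j.+1 + l) = 0 -> F`_j.+2`_l * ((j.+1 + l)%:R - (D - Db)) = 0.
Proof.
move=> /cocLP /(_ 1%N j.+2 l) + f1; rewrite scalS1 coefLL_SS.
have -> : scalS Db F j.+2 1 l = 0.
  rewrite /scalS f1 mul0rn mulr0 addr0; case: l f1 => // l.
  by rewrite addnS -addSn => ->; rewrite mul0rn.
rewrite /scalR add0n binn binSn => /eqP; rewrite -subr_eq0 => /eqP e;
  rewrite -[RHS]e; ring.
Qed.

(** Obtained from the coefficient of lambda^0 mu^(l+1) d^0; it leaves only a scalar in the constant
    part of F. *)
Lemma coc_constant F l : cocL 0 0 D Db F ->
  Db * F`_0`_l = if l is 0%N then D * F`_0`_0 else 0.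
Proof.
move=> /cocLP /(_ 0%N l.+1 0%N);
  rewrite coefLL_0j /scalS /scalR /= mulr0 addr0 !add0r.
rewrite !addn0 binn mulr1n opprD => /eqP; rewrite -subr_eq0 opprK addrA subrK.
rewrite subr_eq0 => /eqP <-.
by case: l.
Qed.

(** A coboundary can cancel the lambda^1 coefficient of F at every d^l with l <> Delta - Deltabar;
    then [coc_weight] makes the rest homogeneous, and [coc_constant] handles lambda^0. *)
Lemma cocL_normal F : Db != 0 -> cocL 0 0 D Db F -> exists phi F',
  [/\ F = F' + dcob 0 0 D Db phi, cocL 0 0 D Db F',
    forall j l, F'`_j.+1`_l != 0 -> D - Db = (j + l)%:R &
    forall l, F'`_0`_l != 0 -> l = 0%N /\ D = Db].
Proof.
move=> Db0 HF; pose c l : C := if l%:R + Db - D == 0 then 0 else F`_1`_l / (l%:R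
  + Db - D).
pose phi := \poly_(l < size F`_1) c l.
have phiE l : phi`_l = c l.
  rewrite coef_poly; case: ltnP => // le; rewrite /c.
  by case: ifP => // _; rewrite nth_default ?mul0r.
exists phi, (F - dcob 0 0 D Db phi).
have HF' : cocL 0 0 D Db (F - dcob 0 0 D Db phi).
  by apply: (@cocL_D_cob _ _ _ _ _ _ phi); rewrite subrK.
move: HF'; set F' := F - _ => HF'.
have F'1 l : F'`_1`_l != 0 -> D - Db = l%:R.
  have -> : F'`_1`_l = F`_1`_l - (l%:R + Db - D) * c l.
    rewrite (coefB F) (coefB F`_1) coef_dcob scalS1 coefC /= phiE;
      congr (_ - _); ring.
  rewrite /c; case: (l%:R + Db - D =P 0) => [e _|/eqP ne].
    by move/eqP: e; rewrite -addrA -(opprB D) subr_eq0 => /eqP ->.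
  by rewrite mulrC divfK // subrr eqxx.
split=> // [||l nz].
- by rewrite subrK.
- case=> [l|j l nz]; first by rewrite add0n; exact: F'1.
  (* If this coefficient of lambda^1 is nonzero, it already has the claimed weight; otherwise
     [coc_weight] applies. *)
  have [f1|f1] := eqVneq (F'`_1`_(j.+1 + l)) 0; last exact: F'1.
  have /eqP := coc_weight HF' f1; rewrite mulf_eq0 (negPf nz) subr_eq0.
  by move/eqP.
have := coc_constant l HF'; case: l nz => [|l] nz.
  by split=> //; apply: (mulIf nz).
by move/eqP; rewrite mulf_eq0 (negPf Db0) (negPf nz).
Qed.

(* \sum_k a_k d^(n-k) lambda^k *)
Definition hom n (a : nat -> C) : {poly {poly C}} :=
  \poly_(k < n.+1) (a k *: 'X^(n - k)).

Lemma coef_hom n a k l : (hom n a)`_k`_l = if (k + l == n)%N then a k else 0.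
Proof.
rewrite coef_poly; case: ltnP => [lt|le].
  rewrite coefZ coefXn; have -> : (l == (n - k)%N) = (k + l == n)%N by lia.
  by case: eqP; rewrite ?mulr1 ?mulr0.
by rewrite coef0; have -> : (k + l == n)%N = false by lia.
Qed.

(** The factor by which the lambda^i coefficient of L sends d^(m+1-j) vbar to a multiple of
    d^(m+2-i-j) vbar, from (d + lambda)^(m+1-j) (d + Deltabar lambda). *)
Definition rec_coef m i j : C := 'C(m.+1 - j, i)%:R + Db * 'C(m.+1 - j,
  i.-1)%:R.

(* The equations with i <= 1 follow from homogeneity and a_0 = a_1 = 0. *)
Definition hom_eqs m (a : nat -> C) := forall i j,
  (2 <= i)%N -> (i < j)%N -> (i + j <= m.+2)%N ->
  a j * rec_coef m i j - a i * rec_coef m j i =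
  a (i + j).-1 * ('C((i + j).-1, j)%:R - 'C((i + j).-1, j.-1)%:R).

Lemma scalS_hom m a i j l : (2 <= i)%N -> (i + j + l = m.+2)%N ->
  scalS Db (hom m.+1 a) i j l = a j * rec_coef m i j.
Proof.
case: i => // i _ e; rewrite /scalS /rec_coef coef_hom.
have -> : (j + (i + l) == m.+1)%N by lia.
have -> : (m.+1 - j = i + l)%N by lia.
case: l e => [|l] e.
  by rewrite addn0 (@bin_small i i.+1) //=; ring.
rewrite coef_hom; have -> : (j + (i.+1 + l) == m.+1)%N by lia.
by rewrite addSn addnS /=; ring.
Qed.

Lemma scalS_hom0 m a i j l : (i + j + l != m.+2)%N -> (0 < i + l)%N ->
  scalS Db (hom m.+1 a) i j l = 0.
Proof.
move=> ne pos; rewrite /scalS.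
have -> : (if i is i'.+1 then (hom m.+1 a)`_j`_(i' + l) *+ 'C(i' + l, i') else
  0) = 0.
  case: i ne pos => [|i] // ne _; rewrite coef_hom.
  have -> : (j + (i + l) == m.+1)%N = false by lia.
  by rewrite mul0rn.
rewrite mulr0 addr0; case: l ne pos => [|l] // ne _; rewrite coef_hom.
have -> : (j + (i + l) == m.+1)%N = false by lia.
  by rewrite mul0rn.
Qed.

(** By homogeneity a pair i, j >= 2 gives one equation, at d^(m+2-i-j). The terms for i = 0 cancel,
    those for i = 1 are Euler's identity, and antisymmetry leaves i < j. *)
Lemma cocL_hom m a : (0 < m)%N -> D - Db = m%:R -> a 0%N = 0 -> a 1%N = 0 ->
  cocL 0 0 D Db (hom m.+1 a) <-> hom_eqs m a.
Proof.
move=> m0 mE a0 a1.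
have f0 l : (hom m.+1 a)`_0`_l = 0 by rewrite coef_hom a0; case: ifP.
have f1 l : (hom m.+1 a)`_1`_l = 0 by rewrite coef_hom a1; case: ifP.
have gen i j : (2 <= i)%N -> (2 <= j)%N -> (i + j <= m.+2)%N ->
    a j * rec_coef m i j - a i * rec_coef m j i =
    a (i + j).-1 * ('C((i + j).-1, j)%:R - 'C((i + j).-1, j.-1)%:R) <->
    scalS Db (hom m.+1 a) i j (m.+2 - (i + j))
    + scalR D (hom m.+1 a) i j (m.+2 - (i + j))
    - (scalS Db (hom m.+1 a) j i (m.+2 - (i + j))
       + scalR D (hom m.+1 a) j i (m.+2 - (i + j)))
    = coefLL (fun n => (hom m.+1 a)`_n`_(m.+2 - (i + j))) i j.
  move=> i2 j2 le; rewrite !scalS_hom //; try lia.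
  case: i i2 le => [|[|i]] // _; case: j j2 => [|[|j]] // _ le.
  rewrite /scalR coefLL_SS coef_hom !addr0.
  have -> : ((i.+2 + j.+2).-1 = (i.+1 + j.+1).+1)%N by lia.
  by have -> : ((i.+1 + j.+1).+1 + (m.+2 - (i.+2 + j.+2)) == m.+1)%N by lia.
split=> [/cocLP H i j i2 ij le|H].
  by apply/gen => //; apply: leq_trans ij; apply: ltnW.
apply/cocLP => i j.
wlog ij : i j / (i <= j)%N => [W l|l].
  have [/W //|/ltnW/W e] := leqP i j.
  by rewrite coefLL_anti -e opprB.
case: i ij => [|[|i]] ij.
- rewrite coefLL_0j.
  have -> : scalS Db (hom m.+1 a) j 0 l = 0.
    rewrite /scalS; have -> : (if j is i'.+1 then (hom m.+1 a)`_0`_(i' + l) *+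
      'C(i' + l, i') else 0) = 0 by case: (j) => // k; rewrite f0 mul0rn.
    by case: l => [|l]; rewrite ?f0 ?mul0rn mulr0 addr0.
  rewrite /scalS /scalR mulr0 addr0 add0r opprD.
  case: j ij => [|[|j]] _ /=.
  + by case: l => [|l]; rewrite ?f0 ?mul0rn !addr0 ?oppr0 ?addr0.
  + by rewrite f0; case: l => [|l]; rewrite ?f0 ?bin0 ?add0n; ring.
  + by case: l => [|l]; rewrite ?bin0 ?add0n; ring.
- case: j ij => [|j] // _; rewrite coefLL_SS add0n binn binSn !scalS1.
  have -> : scalS Db (hom m.+1 a) j.+1 1 l = 0.
    rewrite /scalS f1 mul0rn mulr0 addr0; case: l => // l.
    by rewrite f1 mul0rn.
  have -> : scalR D (hom m.+1 a) 1 j.+1 l = 0.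
    by rewrite /scalR; case: (j) => //; rewrite f1 mulr0.
  rewrite /scalR coef_hom; case: eqP => [e|_]; last by ring.
  have -> : D = Db + m%:R by rewrite -mE; ring.
  have -> : m%:R = j%:R + l%:R :> C by rewrite -natrD; congr _%:R; lia.
  ring.
- case: j ij => [|[|j]] // ij.
  have [e|ne] := eqVneq (i.+2 + j.+2 + l)%N m.+2.
    have el : l = (m.+2 - (i.+2 + j.+2))%N by lia.
    rewrite el; apply/gen => //; first by lia.
    (* On the diagonal i = j both sides vanish, the right one by symmetry of the binomial
       coefficients. *)
    move: ij; rewrite leq_eqVlt => /orP[/eqP[<-]|ij]; last by apply: H => //;
      lia.
    have -> : ((i.+2 + i.+2).-1 = i.+1 + i.+2)%N by lia.
    rewrite subrr /=; have -> : 'C(i.+1 + i.+2, i.+2) = 'C(i.+1 + i.+2, i.+1).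
      by rewrite -[RHS]bin_sub ?leq_addr // addKn.
    by rewrite subrr mulr0.
  rewrite !scalS_hom0 //; try lia.
  rewrite /scalR coefLL_SS coef_hom.
  have -> : ((i.+1 + j.+1).+1 + l == m.+1)%N = false by lia.
  by rewrite mul0r !addr0 subrr.
Qed.

End Homogeneous.

(** * The linear recursion for homogeneous cocycles *)

Section Solve.
Variable C : numClosedFieldType.

(** The binomial coefficient as a polynomial in its upper argument: equations in a natural number m
    become identities of rational functions. *)
Fixpoint falling (y : C) i : C :=
  if i is i'.+1 then falling y i' * (y - i'%:R) / i'.+1%:R else 1.

Lemma bin_falling n i : 'C(n, i)%:R = falling n%:R i.
Proof.
elim: i => [|i IH]; first by rewrite bin0.
rewrite /= -IH; apply: (@mulIf _ i.+1%:R); first by rewrite pnatr_eq0.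
rewrite divfK ?pnatr_eq0 // -natrM mulnC mul_bin_left.
have [le|lt] := leqP i n; first by rewrite mulnC natrM natrB.
by rewrite bin_small // muln0 mul0r.
Qed.

Section Elimination.
Variables (a2 a3 a4 a5 a6 a7 a8 : C).
Variables (A23 A32 A24 A42 A25 A52 A26 A62 A27 A72 A34 A43 A45 A54 : C).
Hypothesis e23 : a3 * A23 - a2 * A32 = a4 * (4%:R - 6%:R).
Hypothesis e24 : a4 * A24 - a2 * A42 = a5 * (5%:R - 10%:R).
Hypothesis e25 : a5 * A25 - a2 * A52 = a6 * (6%:R - 15%:R).

Let b4 := (a3 * A23 - a2 * A32) / - 2%:R.
Let b5 := (b4 * A24 - a2 * A42) / - 5%:R.
Let b6 := (b5 * A25 - a2 * A52) / - 9%:R.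
Let b7 := (b6 * A26 - a2 * A62) / - 14%:R.
Let b8 := (b7 * A27 - a2 * A72) / - 20%:R.

Let a4E : a4 = b4. Proof. by rewrite /b4 e23; field. Qed.
Let a5E : a5 = b5. Proof. by rewrite /b5 -a4E e24; field. Qed.
Let a6E : a6 = b6. Proof. by rewrite /b6 -a5E e25; field. Qed.

(** The equations (2, j) are solved successively for a_4, a_5, a_6, the numerical factors being
    differences of binomial coefficients. Keeping the [rec_coef] values abstract separates the
    elimination from their evaluation. *)
Lemma elim34 : a4 * A34 - a3 * A43 = a6 * (15%:R - 20%:R) ->
  b4 * A34 - a3 * A43 + 5%:R * b6 = 0.
Proof. by rewrite -a4E -a6E => ->; ring. Qed.

Lemma elim45 : a6 * A26 - a2 * A62 = a7 * (7%:R - 21%:R) ->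
  a7 * A27 - a2 * A72 = a8 * (8%:R - 28%:R) ->
  a5 * A45 - a4 * A54 = a8 * (56%:R - 70%:R) ->
  b5 * A45 - b4 * A54 + 14%:R * b8 = 0.
Proof.
move=> e26 e27; have a7E : a7 = b7 by rewrite /b7 -a6E e26; field.
have a8E : a8 = b8 by rewrite /b8 -a7E e27; field.
by rewrite -a4E -a5E -a8E => ->; ring.
Qed.

End Elimination.

Section Fixed.
Variables (Db : C) (m : nat).

Lemma rec_coefE i j : (j <= m.+1)%N -> rec_coef Db m i j =
  falling (m%:R + 1 - j%:R) i + Db * falling (m%:R + 1 - j%:R) i.-1.
Proof. by move=> le; rewrite /rec_coef !bin_falling natrB // -natr1. Qed.

(* The coefficients of the coboundary of d^m. *)
Definition cob_coef k : C :=
  if k is k'.+2 then 'C(m, k)%:R + Db * 'C(m, k.-1)%:R else 0.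

(** The determinant of the initial values (a_2, a_3) against those of the coboundary of d^m; it
    detects whether a is a multiple of that coboundary. *)
Definition delta (a : nat -> C) := a 2 * cob_coef 3 - a 3 * cob_coef 2.

Lemma natrB_neq0 k : (k < m)%N -> m%:R - k%:R != 0 :> C.
Proof. by move=> lt; rewrite -natrB ?pnatr_eq0; lia. Qed.

(* The equation (3, 4), after eliminating a_4, a_5 and a_6 by means of (2, j), *)
(* is delta a = 0 up to this factor and (m - 2)(m - 3)(m - 4).                 *)
Lemma hom_eqs_det34 a : (5 <= m)%N -> hom_eqs Db m a ->
  ((2%:R * Db + m%:R - 1) ^+ 2 - (3%:R * m%:R + 1)) * delta a = 0.
Proof.
move=> m5 H.
have e := elim34 (H 2 3 isT isT (ltac:(lia))) (H 2 4 isT isT (ltac:(lia)))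
  (H 2 5 isT isT (ltac:(lia))) (H 3 4 isT isT (ltac:(lia))).
have n2 : m%:R - 2%:R != 0 :> C by apply: natrB_neq0; lia.
have n3 : m%:R - 3%:R != 0 :> C by apply: natrB_neq0; lia.
have n4 : m%:R - 4%:R != 0 :> C by apply: natrB_neq0; lia.
apply: (mulfI (mulf_neq0 n2 (mulf_neq0 n3 n4))); rewrite mulr0.
(* The factor 72 m turns the eliminated equation into (m - 2)(m - 3)(m - 4) times the claim. *)
rewrite -[RHS](mulr0 (72%:R * m%:R)) -e /delta /cob_coef.
by rewrite !rec_coefE ?(leqW (leq_trans _ m5)) // !bin_falling /falling /=;
  field.
Qed.

(* Where the factor of the previous lemma vanishes, the equation (4, 5)        *)
(* becomes m (m - 1) ... (m - 6) delta a = 0 up to a nonzero constant.         *)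
Lemma hom_eqs_det45 a : (7 <= m)%N -> hom_eqs Db m a ->
  (2%:R * Db + m%:R - 1) ^+ 2 = 3%:R * m%:R + 1 -> delta a = 0.
Proof.
move=> m7 H q.
have e := elim45 (H 2 3 isT isT (ltac:(lia))) (H 2 4 isT isT (ltac:(lia)))
  (H 2 5 isT isT (ltac:(lia))) (H 2 6 isT isT (ltac:(lia)))
  (H 2 7 isT isT (ltac:(lia))) (H 4 5 isT isT (ltac:(lia))).
have n0 : m%:R != 0 :> C by rewrite pnatr_eq0; lia.
have n1 : m%:R - 1 != 0 :> C by apply: (@natrB_neq0 1); lia.
have n2 : m%:R - 2%:R != 0 :> C by apply: natrB_neq0; lia.
have n3 : m%:R - 3%:R != 0 :> C by apply: natrB_neq0; lia.
have n4 : m%:R - 4%:R != 0 :> C by apply: natrB_neq0; lia.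
have n5 : m%:R - 5%:R != 0 :> C by apply: natrB_neq0; lia.
have n6 : m%:R - 6%:R != 0 :> C by apply: natrB_neq0; lia.
have n := mulf_neq0 n0 (mulf_neq0 n1 (mulf_neq0 n2 (mulf_neq0 n3 (mulf_neq0 n4
  (mulf_neq0 n5 n6))))).
apply: (mulfI n); rewrite mulr0 -[RHS](mulr0 (3200%:R * m%:R)) -e /delta
  /cob_coef.
rewrite !rec_coefE ?(leqW (leq_trans _ m7)) // !bin_falling /falling /=.
(* The curve is parametrized by y = 2 Deltabar + m - 1, with m = (y^2 - 1)/3, so that an identity
   with the single parameter y remains. *)
have -> : Db = (2%:R * Db + m%:R - 1 - m%:R + 1) / 2%:R by field.
have mE : m%:R = ((2%:R * Db + m%:R - 1) ^+ 2 - 1) / 3%:R by rewrite q; field.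
by move: (2%:R * Db + m%:R - 1) mE => y ->; field.
Qed.


Lemma hom_eqs_comb a a' s : hom_eqs Db m a -> hom_eqs Db m a' ->
  hom_eqs Db m (fun k => a k - s * a' k).
Proof.
move=> H H' i j i2 ij le.
have := congr2 (fun x y => x - s * y) (H i j i2 ij le) (H' i j i2 ij le).
by rewrite [RHS]/= => e; transitivity (a (i + j).-1 *
  ('C((i + j).-1, j)%:R - 'C((i + j).-1, j.-1)%:R) -
  s * (a' (i + j).-1 * ('C((i + j).-1, j)%:R - 'C((i + j).-1, j.-1)%:R)));
  [rewrite -e; ring|ring].
Qed.

(** For k >= 3 equation (2, k) determines a_(k+1) from a_2 and a_k, because 'C(k+1, k) and 'C(k+1,
    k-1) differ. *)
Lemma hom_eqs_zero a : hom_eqs Db m a -> a 2 = 0 -> a 3 = 0 ->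
  forall k, (2 <= k)%N -> (k <= m.+1)%N -> a k = 0.
Proof.
move=> H a2 a3 k; elim: k => // k IH k2 km.
have [k3|k3] := leqP k 2; first by case: k k2 k3 {IH km} => [|[|[|]]].
have ak : a k = 0 by apply: IH; lia.
have := H 2 k isT k3 km; rewrite a2 ak !mul0r subrr add2n /=.
move/esym/eqP; rewrite mulf_eq0 => /orP[/eqP//|].
rewrite subr_eq0 eqr_nat; case: k k3 {IH k2 km ak} => [|[|[|k]]] // _.
rewrite /= binSn -bin_sub; last by lia.
have -> : (k.+4 - k.+2 = 2)%N by lia.
by rewrite bin2 /= => /eqP; lia.
Qed.

Lemma hom_cob_coef D : D - Db = m%:R -> hom m.+1 cob_coef = dcob 0 0 D Db 'X^m.
Proof.
move=> mE; have {mE} -> : D = Db + m%:R by rewrite -mE; ring.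
apply/polyP => i; apply/polyP => l; rewrite coef_hom coef_dcob.
case: i => [|[|i]] /=.
- rewrite if_same /scalS mulr0 addr0; case: l => [|l]; first by rewrite subr0.
  by rewrite coefC /= coefXn add0n bin0 mulr1n subrr.
- rewrite if_same scalS1 coefC /= coefXn; case: eqP => [->|_] /=; ring.
- rewrite subr0 /scalS coefC /= coefXn (addSn i.+1) eqSS.
  case: eqP => [<-|ne].
    case: l => [|l]; first by rewrite addn0 (@bin_small i.+1 i.+2) //=; ring.
    have -> : (i.+1 + l.+1 = i.+2 + l)%N by lia.
    by rewrite coefXn eqxx /=; ring.
  rewrite mul0rn mulr0 addr0; case: l ne => [|l] ne //.
  rewrite coefXn; have -> : ((i.+2 + l)%N == m) = false by apply/eqP; lia.
  by rewrite mul0rn.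
Qed.

Lemma hom_eqs_cob (m0 : (0 < m)%N) : hom_eqs Db m cob_coef.
Proof.
have e : Db + m%:R - Db = m%:R by ring.
apply: (proj1 (cocL_hom m0 e _ _)) => //.
by rewrite (hom_cob_coef e); exact: cocL_dcob.
Qed.

Lemma cob_coef_top : (0 < m)%N -> cob_coef m.+1 = Db.
Proof.
move=> m0; have e : m.+1 = m.-1.+2 by lia.
by rewrite e /cob_coef -e bin_small // -pred_Sn binn add0r mulr1.
Qed.

(** A vanishing determinant makes the initial values proportional to those of the coboundary,
    provided the latter are not both zero. *)
Lemma hom_eqs_span1 a : Db != 0 -> (2 <= m)%N -> hom_eqs Db m a -> delta a = 0
  ->
  exists s, forall k, (2 <= k)%N -> (k <= m.+1)%N -> a k = s * cob_coef k.
Proof.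
move=> Db0 m2 H d0; have m0 : (0 < m)%N by lia.
suff [s [e2 e3]] : exists s, a 2 = s * cob_coef 2 /\ a 3 = s * cob_coef 3.
  exists s => k k2 km; apply/eqP; rewrite -subr_eq0; apply/eqP.
  have /hom_eqs_zero := hom_eqs_comb s H (hom_eqs_cob m0); apply=> //.
    by rewrite e2 subrr.
  by rewrite e3 subrr.
have /eqP := d0; rewrite /delta subr_eq0 => /eqP e.
have [B2|B2] := eqVneq (cob_coef 2) 0; last first.
  by exists (a 2 / cob_coef 2); rewrite divfK // mulrAC e mulfK.
have [B3|B3] := eqVneq (cob_coef 3) 0; last first.
  exists (a 3 / cob_coef 3); rewrite divfK // mulrAC -e mulfK //.
(* If both initial values of the coboundary vanished, so would its top coefficient, which is
   Deltabar. *)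
by have := cob_coef_top m0;
  rewrite (hom_eqs_zero (hom_eqs_cob m0)) // => /esym/eqP;
  rewrite (negPf Db0).
Qed.

Lemma hom_eqs_span2 a p : Db != 0 -> (2 <= m)%N -> hom_eqs Db m a -> hom_eqs Db
  m p ->
  delta p != 0 ->
  exists s t, forall k, (2 <= k)%N -> (k <= m.+1)%N -> a k = s * cob_coef k + t
    * p k.
Proof.
move=> Db0 m2 H Hp dp; pose t := delta a / delta p.
have [||s e] := @hom_eqs_span1 (fun k => a k - t * p k) Db0 m2;
  first exact: hom_eqs_comb.
  transitivity (delta a - t * delta p); first by rewrite /delta; ring.
  by rewrite /t divfK // subrr.
by exists s, t => k k2 km; rewrite -e // subrK.
Qed.

End Fixed.
End Solve.

(** * Classification of the action of L *)

Section ClassifyL.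
Variable C : numClosedFieldType.
Local Notation dd := ('X%:P : {poly {poly C}}).
Local Notation ll := ('X : {poly {poly C}}).
Local Notation cst c := (c%:P%:P : {poly {poly C}}).
Implicit Types (F : {poly {poly C}}) (D Db : C).

Definition pweight m Db : {poly {poly C}} :=
  match m with
  | 2 => p2 C | 3 => p3 C | 4 => p4 Db | 5 => p5 C | 6 => p6 Db | _ => 0
  end.

Definition pcoef m Db : nat -> C := nth 0
  match m with
  | 2 => [:: 0; 0; 2%:R; 1]
  | 3 => [:: 0; 0; 1; 1; 0]
  | 4 => [:: 0; 0; 4%:R; 6%:R; -1; Db]
  | 5 => [:: 0; 0; 1; 0; - 10%:R; - 17%:R; - 8%:R]
  | 6 => [:: 0; 0; 0; 1; - (2%:R * Db + 3%:R); - (3%:R * Db);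
             - (3%:R * Db + 1); - (Db + 9%:R / 28%:R)]
  | _ => [::]
  end.

Definition L_weight m D Db := D - Db = m%:R /\
  match m with
  | 2 | 3 | 4 => True
  | 5 => D = 1
  | 6 => (D - 7%:R / 2%:R) ^+ 2 = 19%:R / 4%:R
  | _ => False
  end.

Lemma pweight_hom m Db : pweight m Db = hom m.+1 (pcoef m Db).
Proof.
case: m => [|[|[|[|[|[|[|m]]]]]]]; rewrite /hom poly_def -?mul_polyC.
- by rewrite !big_ord_recr big_ord0 /= !scale0r !addr0.
- by rewrite !big_ord_recr big_ord0 /= !scale0r !addr0.
- by rewrite !big_ord_recr big_ord0 /= /p2 -!mul_polyC !(subSS, subn0) /pcoef
    /=; ring.
- by rewrite !big_ord_recr big_ord0 /= /p3 -!mul_polyC !(subSS, subn0) /pcoef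
    /=; ring.
- by rewrite !big_ord_recr big_ord0 /= /p4 -!mul_polyC !(subSS, subn0) /pcoef
    /=; ring.
- by rewrite !big_ord_recr big_ord0 /= /p5 -!mul_polyC !(subSS, subn0) /pcoef
    /=; ring.
- by rewrite !big_ord_recr big_ord0 /= /p6 -!mul_polyC !(subSS, subn0) /pcoef
    /=; ring.
- by rewrite big1 // => i _; rewrite /pcoef nth_nil !scale0r.
Qed.

Lemma L_weight6 Db : L_weight 6 (Db + 6%:R) Db -> (2%:R * Db + 5%:R) ^+ 2 =
  19%:R.
Proof.
case=> _ e; transitivity (4%:R * (Db + 6%:R - 7%:R / 2%:R) ^+ 2);
  first by field.
by rewrite e; field.
Qed.

Lemma L_weight5 Db : L_weight 5 (Db + 5%:R) Db -> Db = - 4%:R.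
Proof.
case=> _ e; have <- : (Db + 5%:R) - 5%:R = Db by ring.
by rewrite e; ring.
Qed.

Lemma L_weight_eqs m D Db : L_weight m D Db -> hom_eqs Db m (pcoef m Db).
Proof.
move=> g; have DE : D = Db + m%:R by rewrite -g.1; ring.
rewrite {}DE in g; have q6 := @L_weight6 Db; have q5 := @L_weight5 Db.
move: g q6 q5; case: m => [|[|[|[|[|[|[|m]]]]]]] g;
  try by [case: g]; move=> q6 q5.
- by move=> i j i2 ij le; lia.
- move=> i j i2 ij le; have [-> ->] : i = 2%N /\ j = 3%N by lia.
  by rewrite /rec_coef /pcoef !(subSS, subn0, addSn, add0n) !bin_falling
    /falling /=; field.
- move=> i j i2 ij le; have [-> []] : i = 2%N /\ (j = 3%N \/ j = 4%N) by lia.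
    by move=> ->; rewrite /rec_coef /pcoef !(subSS, subn0, addSn, add0n)
      !bin_falling /falling /=; field.
  by move=> ->; rewrite /rec_coef /pcoef !(subSS, subn0, addSn, add0n)
    !bin_falling /falling /=; field.
- rewrite {}q5 // => i j i2 ij le.
  have [[-> []]|[-> ->]] : (i = 2%N /\ (j = 3%N \/ (j = 4%N \/ j = 5%N))) \/ (i
    = 3%N /\ j = 4%N) by lia.
  + by move=> ->; rewrite /rec_coef /pcoef !(subSS, subn0, addSn, add0n)
      !bin_falling /falling /=; field.
  + by case=> ->; rewrite /rec_coef /pcoef !(subSS, subn0, addSn, add0n)
      !bin_falling /falling /=; field.
  + by rewrite /rec_coef /pcoef !(subSS, subn0, addSn, add0n) !bin_falling
      /falling /=; field.
(* With y = 2 Deltabar + 5 all equations are checked modulo y^2 = 19. *)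
- have DbE : Db = (2%:R * Db + 5%:R - 5%:R) / 2%:R by field.
  move: DbE (q6 g); move: (2%:R * Db + 5%:R) => y -> q i j i2 ij le.
  have [[-> []]|[-> []]] : (i = 2%N /\ (j = 3%N \/ (j = 4%N \/ (j = 5%N \/ j =
    6%N)))) \/
    (i = 3%N /\ (j = 4%N \/ j = 5%N)) by lia.
  + by move=> ->; rewrite /rec_coef /pcoef !(subSS, subn0, addSn, add0n)
      !bin_falling /falling /=; field: q.
  + by case=> [->|[]->]; rewrite /rec_coef /pcoef !(subSS, subn0, addSn, add0n)
      !bin_falling /falling /=; field: q.
  + by move=> ->; rewrite /rec_coef /pcoef !(subSS, subn0, addSn, add0n)
      !bin_falling /falling /=; field: q.
  + by move=> ->; rewrite /rec_coef /pcoef !(subSS, subn0, addSn, add0n)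
      !bin_falling /falling /=; field: q.
Qed.

Lemma L_weight_delta m D Db : L_weight m D Db -> delta Db m (pcoef m Db) != 0.
Proof.
move=> g; have DE : D = Db + m%:R by rewrite -g.1; ring.
rewrite {}DE in g; have q6 := @L_weight6 Db; have q5 := @L_weight5 Db.
move: g q6 q5; case: m => [|[|[|[|[|[|[|m]]]]]]] g;
  try by [case: g]; move=> q6 q5;
    rewrite /delta /cob_coef !bin_falling /falling /pcoef /=.
- rewrite (_ : _ - _ = -1); last by field.
  by rewrite oppr_eq0 oner_eq0.
- rewrite (_ : _ - _ = - 2%:R); last by field.
  by rewrite oppr_eq0 pnatr_eq0.
- rewrite (_ : _ - _ = - 20%:R); last by field.
  by rewrite oppr_eq0 pnatr_eq0.
- rewrite q5 // (_ : _ - _ = - 30%:R); last by field.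
  by rewrite oppr_eq0 pnatr_eq0.
- rewrite (_ : _ - _ = - (3%:R * (2%:R * Db + 5%:R))); last by field.
  rewrite oppr_eq0 mulf_eq0 pnatr_eq0 -[_ + _ == 0](@expf_eq0 _ _ 2) q6 //.
  by rewrite pnatr_eq0.
Qed.

Definition L_class D Db F :=
  [\/ F = 0,
      D = Db /\ exists c0 c1, F = cst c0 + cst c1 * ll |
      exists m c, L_weight m D Db /\ F = cst c * pweight m Db].

Lemma hom_scale n a c : cst c * hom n a = hom n (fun k => c * a k).
Proof.
apply/polyP => k; apply/polyP => l; rewrite !coefCM !coef_hom.
by case: ifP; rewrite ?mulr0.
Qed.

Lemma L_weight_gt1 m D Db : L_weight m D Db -> (2 <= m)%N.
Proof. by case: m => [|[|m]] // []. Qed.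

Lemma pcoef01 m Db : pcoef m Db 0 = 0 /\ pcoef m Db 1 = 0.
Proof. by case: m => [|[|[|[|[|[|[|m]]]]]]]; rewrite /pcoef. Qed.

Lemma hom_eqs_scale Db m a c : hom_eqs Db m a ->
  hom_eqs Db m (fun k => c * a k).
Proof. by move=> H i j i2 ij le; rewrite -!mulrA -mulrBr H. Qed.

Lemma cocL_linear D Db c0 c1 : D = Db ->
  cocL 0 0 D Db (cst c0 + cst c1 * ll).
Proof.
move=> -> i j; rewrite !actLLE !actLHE !actHLE /coefLL /bracket_coef.
have E n : (cst c0 + cst c1 * ll)`_n =
    (match n with 0%N => c0 | 1%N => c1 | _ => 0 end)%:P.
  rewrite coefD coefCM coefX coefC.
  by case: n => [|[|n]] /=; rewrite ?mulr0 ?addr0 ?mulr1 ?add0r.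
have N c n : (c%:P : {poly C})^`N(n.+1) = 0 by rewrite nderivnC.
rewrite /mul_lambda.
case: i j => [|[|[|i]]] [|[|[|j]]]; rewrite ?addnS ?addn0 ?addSn ?add0n /=
  ?E ?nderivn0 ?N ?polyC0 ?bin0 ?bin1 ?binn; ring.
Qed.

Lemma L_class_cocL D Db F : L_class D Db F -> cocL 0 0 D Db F.
Proof.
case=> [->|[e [c0 [c1 ->]]]|[m [c [g ->]]]].
- exact: cocL0.
- exact: cocL_linear.
have m2 := L_weight_gt1 g; have [pc0 pc1] := pcoef01 m Db.
rewrite pweight_hom hom_scale; apply: (proj2 (cocL_hom _ g.1 _ _)).
- by lia.
- by rewrite pc0 mulr0.
- by rewrite pc1 mulr0.
- by apply: hom_eqs_scale; exact: L_weight_eqs g.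
Qed.

Lemma dcobD D Db phi psi : dcob 0 0 D Db (phi + psi) =
  dcob 0 0 D Db phi + dcob 0 0 D Db psi :> {poly {poly C}}.
Proof.
rewrite /dcob; move: (LM 0 Db) (LM 0 D) => Q Q'.
by rewrite (rmorphD (@poly_XaY C)) polyCD !mulrDl opprD addrACA.
Qed.

Lemma dcobZ D Db c phi : dcob 0 0 D Db (c%:P * phi) = cst c * dcob 0 0 D Db phi.
Proof.
rewrite /dcob; move: (LM 0 Db) (LM 0 D) => Q Q'.
by rewrite (rmorphM (@poly_XaY C)) /= XaY_C polyCM -!mulrA -mulrBr.
Qed.

Lemma coef_dcob_hom D Db m phi k : (2 <= k)%N -> (k <= m.+1)%N ->
  (dcob 0 0 D Db phi)`_k`_(m.+1 - k) = phi`_m * cob_coef Db m k.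
Proof.
case: k => [|[|k]] // _ km; rewrite coef_dcob subr0 /scalS coefC /=.
have -> : (k.+1 + (m.+1 - k.+2) = m)%N by lia.
have [l e] : exists l, (l + k.+1 = m)%N by exists (m - k.+1)%N; lia.
have -> : (m.+1 - k.+2 = l)%N by lia.
case: l e => [|l] e.
  by rewrite (@bin_small m k.+2) //=; [ring | lia].
have -> : (k.+2 + l = m)%N by lia.
by rewrite /=; ring.
Qed.

(** For Delta = Deltabar a coboundary has no constant term and no term in lambda alone. Otherwise
    only the d^m part of phi contributes in the relevant degree, and its determinant is zero while
    that of [pcoef] is not. *)
Lemma L_class_dcob D Db F phi : Db != 0 -> L_class D Db F ->
  F = dcob 0 0 D Db phi -> F = 0.
Proof.
move=> Db0 [//|[<- [c0 [c1 ->]]] e|[m [c [g ->]]] e].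
  have E n : (cst c0 + cst c1 * ll)`_n =
      (match n with 0%N => c0 | 1%N => c1 | _ => 0 end)%:P.
    rewrite coefD coefCM coefX coefC.
    by case: n => [|[|n]] /=; rewrite ?mulr0 ?addr0 ?mulr1 ?add0r.
  have := coef_dcob D D phi 0 0; rewrite -e E coefC /scalS /= mulr0 addr0 subr0.
  move=> ->; have := coef_dcob D D phi 1 0.
  rewrite -e E coefC scalS1 coefC /= add0r subrr => ->.
  by rewrite !polyC0 mul0r addr0.
have m2 := L_weight_gt1 g; suff -> : c = 0 by rewrite !polyC0 mul0r.
have E k : (2 <= k)%N -> (k <= m.+1)%N -> c * pcoef m Db k = phi`_m * cob_coef
  Db m k.
  move=> k2 km; rewrite -(coef_dcob_hom D Db phi k2 km) -e pweight_hom
    hom_scale.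
  by rewrite coef_hom subnKC // eqxx.
apply: (mulIf (L_weight_delta g));
  rewrite mul0r /delta mulrBr !mulrA !E ?(leqW m2) //.
by ring.
Qed.

Lemma eq_hom n (a a' : nat -> C) : (forall k, (k <= n)%N -> a k = a' k) ->
  hom n a = hom n a'.
Proof.
move=> e; apply/polyP => k; apply/polyP => l; rewrite !coef_hom.
by case: eqP => // kl; apply: e; lia.
Qed.

Lemma homD n (a a' : nat -> C) : hom n a + hom n a' = hom n (fun k => a k + a'
  k).
Proof.
apply/polyP => k; apply/polyP => l; rewrite !coefD !coef_hom.
by case: ifP; rewrite ?addr0.
Qed.

Lemma classL_hom D Db m a : Db != 0 -> (0 < m)%N -> D - Db = m%:R ->
  a 0%N = 0 -> a 1%N = 0 -> hom_eqs Db m a ->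
  exists phi F', hom m.+1 a = F' + dcob 0 0 D Db phi /\ L_class D Db F'.
Proof.
move=> Db0 m0 mE a0 a1 H; have hB := hom_cob_coef mE.
have Z s p : p 0%N = 0 -> p 1%N = 0 ->
    (forall k, (2 <= k)%N -> (k <= m.+1)%N -> a k = s * cob_coef Db m k + p k)
      ->
    hom m.+1 a = hom m.+1 p + dcob 0 0 D Db (s%:P * 'X^m).
  move=> p0 p1 e; rewrite dcobZ -hB hom_scale homD; apply: eq_hom => k km.
  case: k km => [|[|k]] km; rewrite ?a0 ?p0 ?a1 ?p1 /= ?mulr0 ?addr0 //.
  by rewrite e // addrC.
have triv : delta Db m a = 0 -> (2 <= m)%N -> exists phi F',
    hom m.+1 a = F' + dcob 0 0 D Db phi /\ L_class D Db F'.
  move=> d0 m2; have [s e] := hom_eqs_span1 Db0 m2 H d0.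
  exists (s%:P * 'X^m), 0; split; last by constructor 1.
  rewrite (@Z s (fun=> 0)) // => [|k k2 km]; last by rewrite addr0 e.
  congr (_ + _); apply/polyP => k; apply/polyP => l.
  by rewrite coef_hom !coef0; case: ifP.
have nontriv : L_weight m D Db -> exists phi F',
    hom m.+1 a = F' + dcob 0 0 D Db phi /\ L_class D Db F'.
  move=> g; have m2 := L_weight_gt1 g; have [pc0 pc1] := pcoef01 m Db.
  have [s [t e]] := hom_eqs_span2 Db0 m2 H (L_weight_eqs g) (L_weight_delta g).
  exists (s%:P * 'X^m), (cst t * pweight m Db); split; last by constructor 3;
    exists m, t.
  by rewrite pweight_hom hom_scale; apply: Z; rewrite ?pc0 ?pc1 ?mulr0.
have [m1|m2] := leqP m 1.
  have {}m1 : m = 1%N by lia.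
  (* For m = 1 the only coefficient is a_2, and the coboundary of d has coefficient Deltabar
     there. *)
  exists ((a 2 / Db)%:P * 'X^m), 0; split; last by constructor 1.
  rewrite (@Z (a 2 / Db) (fun=> 0)) // => [|k k2 km].
    congr (_ + _); apply/polyP => k; apply/polyP => l.
    by rewrite coef_hom !coef0; case: ifP.
  have -> : k = m.+1 by lia.
  by rewrite cob_coef_top // divfK // m1 addr0.
have [m5|m5] := ltnP m 5.
  apply: nontriv; split=> //; move: m2 m5; clear.
  by case: m => [|[|[|[|[|m]]]]].
have := hom_eqs_det34 m5 H => /eqP; rewrite mulf_eq0 => /orP[|/eqP d0];
  last exact: triv.
rewrite subr_eq0 => /eqP q.
have [m7|m7] := leqP 7 m; first by apply: triv => //; exact: hom_eqs_det45 q.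
have [m5E|m6E] : m = 5%N \/ m = 6%N by lia.
  rewrite m5E in q mE *; rewrite -m5E; apply: nontriv; rewrite m5E; split=> //.
  (* For m = 5 the equation is (2 Deltabar + 4)^2 = 16. *)
  have : Db * (Db + 4%:R) = 0.
    apply: (@mulfI _ 4%:R); first by rewrite pnatr_eq0.
    rewrite mulr0 -[RHS](subrr (3%:R * 5%:R + 1 : C)) -{1}q; ring.
  move/eqP; rewrite mulf_eq0 (negPf Db0) /= addr_eq0 => /eqP DbE.
  by apply/eqP; rewrite -(inj_eq (addIr (- Db))) mE DbE; apply/eqP; ring.
apply: nontriv; rewrite m6E in q mE *; split=> //.
have -> : D = Db + 6%:R by rewrite -mE; ring.
apply: (@mulfI _ 4%:R); first by rewrite pnatr_eq0.
transitivity ((2%:R * Db + 6%:R - 1) ^+ 2); first by field.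
by rewrite q; field.
Qed.

Lemma cocL_classification D Db F : Db != 0 -> cocL 0 0 D Db F ->
  exists phi F', F = F' + dcob 0 0 D Db phi /\ L_class D Db F'.
Proof.
move=> Db0 /(cocL_normal Db0) [phi [F' [-> HF' P1 P0]]].
suff [psi [F'' [-> HF'']]] : exists psi F'',
    F' = F'' + dcob 0 0 D Db psi /\ L_class D Db F''.
  by exists (psi + phi), F''; split=> //; rewrite dcobD -addrA.
have [->|nz] := eqVneq F' 0.
  by exists 0, 0; rewrite dcob0 addr0; split=> //; constructor 1.
(* Any nonzero coefficient exhibits the degree; the leading one of the leading one is taken. *)
have [m mE] : exists m, D - Db = m%:R.
  have := lead_coef_eq0 F'; rewrite (negPf nz) lead_coefE => /negbT.
  set j := (size F').-1 => nzj.
  have := lead_coef_eq0 F'`_j; rewrite (negPf nzj) lead_coefE => /negbT.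
  case: (j) => [|k] /=; first by move/P0 => [_ ->]; exists 0%N; rewrite subrr.
  by move/P1 ->; eexists.
have natE k n : k%:R = n%:R :> C -> k = n by move/eqP; rewrite eqr_nat => /eqP.
case: m mE => [|m] mE.
  exists 0, F'; rewrite dcob0 addr0; split=> //; constructor 2; split.
    by apply/eqP; rewrite -subr_eq0 mE.
  exists F'`_0`_0, F'`_1`_0; apply/polyP => k; apply/polyP => l.
  rewrite coefD coefCM coefX coefC.
  case: k => [|k].
    rewrite /= mulr0 addr0 coefC; case: l => //= l.
    by have [//|/P0 []] := eqVneq F'`_0`_l.+1 0.
  rewrite add0r eqSS; have [z|/P1] := eqVneq F'`_k.+1`_l 0.
    rewrite z; case: k z => [|k] z; last by rewrite mulr0 coef0.
    by rewrite mulr1 coefC; case: l z => //= z; rewrite -z.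
  rewrite mE => /natE e; have [-> ->] : k = 0%N /\ l = 0%N by lia.
  by rewrite mulr1 coefC.
have DneDb : D != Db by rewrite -subr_eq0 mE pnatr_eq0.
pose a k := F'`_k`_(m.+2 - k).
have FE : F' = hom m.+2 a.
  apply/polyP => k; apply/polyP => l; rewrite coef_hom /a.
  case: eqP => [kl|ne]; first by congr _`_ _; lia.
  have [//|] := eqVneq F'`_k`_l 0; case: k ne => [|k] ne.
    by move/P0 => [_ e]; rewrite e eqxx in DneDb.
  by move/P1; rewrite mE => /natE e; lia.
have a0 : a 0%N = 0.
  rewrite /a; have [//|/P0 [_ e]] := eqVneq F'`_0`_(m.+2 - 0) 0.
  by rewrite e eqxx in DneDb.
have a1 : a 1%N = 0.
  (* The lambda^1 coefficient of the critical weight cannot be removed by a coboundary; here the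
     coefficient of lambda mu^(m+2) reduces to Deltabar a_1 = 0, the degree being m + 1. *)
  have /cocLP /(_ 1%N m.+2 0%N) := HF'.
  rewrite scalS1 coefLL_SS add0n binn binSn /scalS /= addn0 binn mulr1n.
  rewrite /a; have -> : (m.+2 - 1 = m.+1)%N by lia.
  rewrite !addr0 => e; apply: (mulfI Db0); rewrite mulr0.
  have DE : D = Db + m.+1%:R by rewrite -mE; ring.
  move/eqP: e; rewrite -subr_eq0 => /eqP e.
  by apply: oppr_inj; rewrite oppr0 -[RHS]e DE; ring.
rewrite FE; apply: classL_hom => //.
by apply: (proj1 (cocL_hom _ mE a0 a1)) => //; rewrite -FE.
Qed.

End ClassifyL.

(** * Classification of the action of H *)

Section ClassifyH.
Variable C : numClosedFieldType.
Local Notation dd := ('X%:P : {poly {poly C}}).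
Local Notation ll := ('X : {poly {poly C}}).
Local Notation cst c := (c%:P%:P : {poly {poly C}}).
Implicit Types (G : {poly {poly C}}) (b D Db : C).

Definition homH_eqs p b Db (g : nat -> C) := forall i j, (2 <= i)%N ->
  (i + j <= p.+1)%N ->
  g j * ('C(p - j, i)%:R + Db * 'C(p - j, i.-1)%:R) =
  - g (i + j).-1 *
    ((if j is j'.+1 then 'C((i + j).-1, j')%:R else 0) + b * 'C((i + j).-1,
      j)%:R).

Lemma coefLHc0 b (u : nat -> C) j : coefLHc b u 0 j = - mul_lambda u j.
Proof. by rewrite /coefLHc /bracket_coef add0n binn mulr1n addr0. Qed.

Lemma coefLHcS b (u : nat -> C) i j : coefLHc b u i.+1 j =
  - u (i + j)%N * ((if j is j'.+1 then 'C(i + j, j')%:R else 0) + b * 'C(i + j,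
      j)%:R).
Proof.
rewrite /coefLHc /bracket_coef addSn /=; case: j => [|j];
  first by rewrite !bin0; ring.
by rewrite binS; ring.
Qed.

(** Euler's identity from lambda^1. No coboundary acts on G, so G itself is homogeneous. *)
Lemma cocH_weight b D Db G j l : cocH b 0 0 D Db G ->
  G`_j`_l * ((j + l)%:R - (D - Db - b)) = 0.
Proof.
move=> /cocHP /(_ 1%N j l); rewrite scalS1 coefLHcS add0n binn /scalR.
move/eqP; rewrite -subr_eq0 => /eqP e; rewrite -[RHS]e.
by case: j {e} => [|j]; rewrite ?binSn; ring.
Qed.

Lemma scalS_homp p g Db i j l : (2 <= i)%N -> (i + j + l = p.+1)%N ->
  scalS Db (hom p g) i j l = g j * ('C(p - j, i)%:R + Db * 'C(p - j, i.-1)%:R).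
Proof.
case: i => // i _ e; rewrite /scalS !coef_hom.
have -> : (j + (i + l) == p)%N by lia.
have -> : (p - j = i + l)%N by lia.
case: l e => [|l] e.
  by rewrite addn0 (@bin_small i i.+1) //=; ring.
rewrite coef_hom; have -> : (j + (i.+1 + l) == p)%N by lia.
by rewrite addSn addnS /=; ring.
Qed.

Lemma scalS_homp0 p g Db i j l : (2 <= i)%N -> (i + j + l != p.+1)%N ->
  scalS Db (hom p g) i j l = 0.
Proof.
case: i => // i _ e; rewrite /scalS !coef_hom.
have -> : (j + (i + l) == p)%N = false by lia.
rewrite mul0rn mulr0 addr0; case: l e => [|l] e //; rewrite coef_hom.
have -> : (j + (i.+1 + l) == p)%N = false by lia.
by rewrite mul0rn.
Qed.

Lemma cocH_hom p b D Db g : D - Db - b = p%:R ->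
  cocH b 0 0 D Db (hom p g) <-> homH_eqs p b Db g.
Proof.
move=> pE; split=> [/cocHP H i j i2 le|H].
  have := H i j (p.+1 - (i + j))%N; rewrite scalS_homp //; last by lia.
  case: i i2 le => [|[|i]] // _ le; rewrite /scalR subr0 coefLHcS coef_hom.
  by have -> : (i.+1 + j + (p.+1 - (i.+2 + j)) == p)%N by lia.
apply/cocHP => i j l; case: i => [|[|i]].
- rewrite coefLHc0 /scalS /scalR mulr0 addr0 opprD.
  by case: l j => [|l] [|j] /=; rewrite ?bin0 ?add0n; ring.
- rewrite coefLHcS scalS1 add0n binn /scalR coef_hom.
  case: eqP => [e|_]; last by ring.
  have -> : D = Db + b + p%:R by rewrite -pE; ring.
  by rewrite -e natrD; case: j {e} => [|j]; rewrite ?binSn; ring.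
- rewrite /scalR subr0 coefLHcS coef_hom.
  case: eqP => [e|ne]; last by rewrite oppr0 mul0r scalS_homp0 //; lia.
  by rewrite scalS_homp //; [apply: H => //; lia | lia].
Qed.

(** The solution of the equations (k + 1, 0) normalized to coefficient 1 at d^p. *)
Definition H_coef p b Db k : C :=
  if k is 0%N then 1 else - b^-1 * ('C(p, k.+1)%:R + Db * 'C(p, k)%:R).

Definition H_weight p b D Db := D - Db - b = p%:R /\
  match p with
  | 0 | 1 => True
  | 2 => D = 1
  | 3 => b = - (2%:R / 3%:R) /\ Db = - (2%:R / 3%:R)
  | _ => False
  end.

Definition H_class b D Db G :=
  G = 0 \/ exists p g0, [/\ g0 != 0, H_weight p b D Db & G = cst g0 * hom p
    (H_coef p b Db)].

Lemma homH_scale p b Db g c : homH_eqs p b Db g ->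
  homH_eqs p b Db (fun k => c * g k).
Proof. by move=> H i j i2 le; rewrite -mulrA H // -mulrN !mulrA. Qed.

Lemma H_weight_eqs p b D Db : b != 0 -> H_weight p b D Db -> homH_eqs p b Db
  (H_coef p b Db).
Proof.
move=> b0 [pE g] i j i2 le.
case: j le => [|j] le.
  rewrite subn0 addn0 bin0 mul1r add0r mulr1; case: i i2 le => [|[|i]] // _ le.
  by rewrite /H_coef /=; field.
move: g pE le; case: p => [|[|[|[|p]]]] //; try by lia.
  move=> D1 e le; have [-> ->] : i = 2%N /\ j = 0%N by lia.
  have -> : Db = - 1 - b.
    by apply: oppr_inj; apply: (@addrI _ (D - b)); rewrite addrAC e D1; ring.
  by rewrite /H_coef /= !(subSS, subn0, addSn, add0n) !bin_falling /falling /=;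
    field.
move=> [-> ->] e le.
have [[-> ->]|[[-> ->]|[-> ->]]] : (i = 2%N /\ j = 0%N) \/
   ((i = 3%N /\ j = 0%N) \/ (i = 2%N /\ j = 1%N)) by lia.
all: rewrite /H_coef /= !(subSS, subn0, addSn, add0n) !bin_falling /falling /=;
  field.
all: by rewrite ?pnatr_eq0.
Qed.

Lemma H_class_cocH b D Db G : b != 0 -> H_class b D Db G -> cocH b 0 0 D Db G.
Proof.
move=> b0 [->|[p [g0 [_ g ->]]]]; first exact: cocH0.
rewrite hom_scale; apply/(cocH_hom _ g.1); apply: homH_scale;
  exact: H_weight_eqs g.
Qed.

(* The equations (p, 1) and (p - 1, 2) both express b + Deltabar in terms of   *)
(* p; comparing them leaves only p = 3, where (2, 1) then fixes Deltabar.      *)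
Lemma homH_solve p b D Db g : b != 0 -> Db != 0 -> D - Db - b = p%:R ->
  homH_eqs p b Db g -> g 0 != 0 -> H_weight p b D Db.
Proof.
move=> b0 Db0 pE H g0; split=> //.
have gE k : (0 < k)%N -> (k <= p)%N -> g k = g 0 * H_coef p b Db k.
  case: k => // k _ kp; have := H k.+2 0%N isT;
    rewrite addn0 subn0 bin0 mulr1 /=.
  by move=> /(_ kp) e; rewrite /H_coef mulrCA e; field.
case: p pE H gE => [|[|p]] // pE H gE.
have e1 : 'C(p.+2, 2)%:R + Db * p.+2%:R = - (1 + b * p.+2%:R).
  have := H p.+2 1%N isT; rewrite addn1 leqnn => /(_ isT).
  rewrite -pred_Sn (gE 1%N) // (gE p.+2) // /H_coef subn1 -!pred_Sn (@bin_small
    p.+1 p.+2) // binn bin0 bin1.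
  rewrite (@bin_small p.+2 p.+3) // binn => e.
  apply: (@mulfI _ (g 0 * Db * b^-1)); first by rewrite !mulf_neq0 ?invr_eq0.
  apply: oppr_inj; transitivity (g 0 * (- b^-1 * ('C(p.+2, 2)%:R + Db *
    p.+2%:R))
    * (0 + Db * 1)); first by ring.
  by rewrite e; field.
case: p pE H gE e1 => [|p] pE H gE e1.
  have e : 1 + Db * 2%:R + (1 + b * 2%:R) = 0.
    by move/eqP: e1; rewrite binn -addr_eq0 => /eqP.
  have -> : D = Db + b + 2%:R by rewrite -pE; ring.
  apply: (@mulfI _ 2%:R); first by rewrite pnatr_eq0.
  by apply/eqP; rewrite -subr_eq0 -e; apply/eqP; ring.
have e2 : 'C(p.+3, 3)%:R + Db * 'C(p.+3, 2)%:R
    = - (p.+3%:R + b * 'C(p.+3, 2)%:R).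
  have := H p.+2 2%N isT; rewrite addn2 leqnn => /(_ isT).
  rewrite -pred_Sn (gE 2%N) // (gE p.+3) // /H_coef subn2 -!pred_Sn (@bin_small
    p.+1 p.+2) // binn bin1.
  rewrite (@bin_small p.+3 p.+4) // binn => e.
  apply: (@mulfI _ (g 0 * Db * b^-1)); first by rewrite !mulf_neq0 ?invr_eq0.
  apply: oppr_inj; transitivity (g 0 * (- b^-1 * ('C(p.+3, 3)%:R +
    Db * 'C(p.+3, 2)%:R)) * (0 + Db * 1)); first by ring.
  by rewrite e; field.
have x3 : (p.+3%:R : C) = p%:R + 3%:R by rewrite -natrD addn3.
(* Here the degree is n = p + 3. Eliminating b + Deltabar gives (n - 3)(n + 1)(n + 2) = 0. *)
have p0 : p = 0%N.
  apply/eqP; rewrite -(pnatr_eq0 C); move: e1 e2;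
    rewrite !bin_falling /falling /= x3.
  have n1 : p%:R + 5%:R != 0 :> C by rewrite -natrD pnatr_eq0; lia.
  have n2 : p%:R + 3%:R != 0 :> C by rewrite -natrD pnatr_eq0; lia.
  have n3 : p%:R + 4%:R != 0 :> C by rewrite -natrD pnatr_eq0; lia.
  move: (p%:R) n1 n2 n3 => x n1 n2 n3 /eqP; rewrite -subr_eq0 => /eqP e1.
  move/eqP; rewrite -subr_eq0 => /eqP e2.
  suff /eqP : x * ((x + 5%:R) * (x + 4%:R)) = 0.
    by rewrite !mulf_eq0 (negPf n1) (negPf n3) !orbF.
  rewrite -[RHS](mulr0 (- 12%:R)) -{1}e2 -[RHS]subr0 -[X in _ - X](mulr0 (- 6%:R
    * (x + 2%:R))).
  by rewrite -{1}e1; field.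
move: pE H gE e1 {e2 x3}; rewrite {}p0 => pE H gE e1.
have := H 2%N 1%N isT isT; rewrite /= (gE 1%N) // (gE 2%N) // => e3.
have bE : b = - (4%:R / 3%:R) - Db.
  apply: (@mulfI _ 3%:R); first by rewrite pnatr_eq0.
  apply/eqP; rewrite -subr_eq0; apply/eqP.
  move/eqP: e1; rewrite -addr_eq0 bin_falling /falling /= => /eqP e1.
  by rewrite -[RHS]e1; field.
have e4 : (3%:R + 3%:R * Db) * (1 + 2%:R * Db) +
    (1 + 3%:R * Db) * (1 + 2%:R * b) = 0.
  apply: (@mulfI _ (g 0 * b^-1)); first by rewrite mulf_neq0 ?invr_eq0.
  move/eqP: e3; rewrite -subr_eq0 /H_coef !(subSS, subn0, addSn, add0n)
    !bin_falling.
  rewrite /falling /= => /eqP e3; apply: oppr_inj; rewrite mulr0 oppr0 -[RHS]e3.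
  by field.
(* Once b is eliminated the quadratic terms in Deltabar cancel, leaving a linear equation. *)
have DbE : Db = - (2%:R / 3%:R).
  apply: (@mulfI _ 2%:R); first by rewrite pnatr_eq0.
  apply/eqP; rewrite -subr_eq0; apply/eqP.
  by rewrite -[RHS]e4 bE; field.
by split=> //; rewrite bE DbE; field.
Qed.

Lemma cocH_classification b D Db G : b != 0 -> Db != 0 ->
  cocH b 0 0 D Db G -> H_class b D Db G.
Proof.
move=> b0 Db0 H; have [->|nz] := eqVneq G 0; [by left|right].
have W j l : G`_j`_l != 0 -> D - Db - b = (j + l)%:R.
  move=> z; have /eqP := cocH_weight j l H.
  by rewrite mulf_eq0 (negPf z) subr_eq0 => /eqP.
have [p pE] : exists p, D - Db - b = p%:R.
  have := lead_coef_eq0 G; rewrite (negPf nz) lead_coefE => /negbT nzj.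
  have := lead_coef_eq0 G`_(size G).-1;
    rewrite (negPf nzj) lead_coefE => /negbT.
  by move/W ->; eexists.
have natE k n : k%:R = n%:R :> C -> k = n by move/eqP; rewrite eqr_nat => /eqP.
pose g k := G`_k`_(p - k).
have GE : G = hom p g.
  apply/polyP => k; apply/polyP => l; rewrite coef_hom /g.
  case: eqP => [kl|ne]; first by congr _`_ _; lia.
  have [//|/W] := eqVneq G`_k`_l 0; rewrite pE => /natE e; lia.
have Hg : homH_eqs p b Db g by apply/(cocH_hom g pE); rewrite -GE.
have gE k : (k <= p)%N -> g k = g 0%N * H_coef p b Db k.
  case: k => [|k] kp; first by rewrite mulr1.
  have := Hg k.+2 0%N isT; rewrite addn0 subn0 bin0 mulr1 /=.
  by move=> /(_ kp) e; rewrite /H_coef mulrCA e; field.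
(* All coefficients are multiples of the one at d^p. *)
have g0 : g 0%N != 0.
  apply: contraNneq nz => z; apply/eqP; rewrite GE; apply/polyP => k.
  apply/polyP => l; rewrite coef_hom !coef0; case: eqP => // kl.
  by rewrite gE ?z ?mul0r //; lia.
exists p, (g 0%N); split=> //; first exact: homH_solve Hg g0.
by rewrite hom_scale {1}GE; apply: eq_hom.
Qed.

Lemma H_poly0 b Db : hom 0 (H_coef 0 b Db) = 1.
Proof.
rewrite /hom poly_def !big_ord_recr big_ord0 /= -!mul_polyC !(subSS, subn0)
  /H_coef.
by ring.
Qed.

Lemma H_poly1 b Db : hom 1 (H_coef 1 b Db) = dd - cst (b^-1 * Db) * ll.
Proof.
rewrite /hom poly_def !big_ord_recr big_ord0 /= -!mul_polyC !(subSS, subn0)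
  /H_coef.
by rewrite !bin_falling /falling /= !invr1 !(subrr, mulr0, mul0r, add0r, mulr1,
  subr0); ring.
Qed.

Lemma H_poly2 b Db : hom 2 (H_coef 2 b Db) =
  dd ^+ 2 - cst (b^-1 * (1 + 2%:R * Db)) * dd * ll - cst (b^-1 * Db) * ll ^+ 2.
Proof.
rewrite /hom poly_def !big_ord_recr big_ord0 /= -!mul_polyC !(subSS, subn0).
have e1 : 'C(2, 1) = 2%N by [].
have e2 : 'C(2, 2) = 1%N by [].
have e3 : 'C(2, 3) = 0%N by [].
rewrite e1 e2 e3.
by ring.
Qed.

Lemma H_poly3 b Db : hom 3 (H_coef 3 b Db) =
  dd ^+ 3 - cst (b^-1 * (3%:R + 3%:R * Db)) * dd ^+ 2 * ll
  - cst (b^-1 * (1 + 3%:R * Db)) * dd * ll ^+ 2 - cst (b^-1 * Db) * ll ^+ 3.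
Proof.
rewrite /hom poly_def !big_ord_recr big_ord0 /= -!mul_polyC !(subSS, subn0).
have e1 : 'C(3, 1) = 3%N by [].
have e2 : 'C(3, 2) = 3%N by [].
have e3 : 'C(3, 3) = 1%N by [].
have e4 : 'C(3, 4) = 0%N by [].
rewrite e1 e2 e3 e4; by ring.
Qed.

End ClassifyH.

(** * Comparison with the lists *)

Section Lists.
Variable C : numClosedFieldType.
Local Notation dd := ('X%:P : {poly {poly C}}).
Local Notation ll := ('X : {poly {poly C}}).
Local Notation cst c := (c%:P%:P : {poly {poly C}}).
Implicit Types (f g : {poly {poly C}}) (b D Db : C).

Lemma root19P (x : C) : x ^+ 2 = 19%:R / 4%:R <-> exists e, x = root19 C e.
Proof.
have sE : (sqrtC 19%:R / 2%:R : C) ^+ 2 = 19%:R / 4%:R.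
  by rewrite expr_div_n sqrtCK -natrX.
split=> [|[e ->]]; last by rewrite /root19 exprMn sqrr_sign mul1r.
rewrite -sE => /eqP; rewrite eqf_sqr => /orP[]/eqP->.
  by exists false; rewrite /root19 expr0 mul1r.
by exists true; rewrite /root19 expr1 mulN1r.
Qed.

Lemma pweight_neq0 m D Db : L_weight m D Db -> pweight m Db != 0.
Proof.
move=> g; apply: contraNneq (L_weight_delta g) => z.
have E k : (k <= m.+1)%N -> pcoef m Db k = 0.
  move=> km; have := coef_hom m.+1 (pcoef m Db) k (m.+1 - k).
  by rewrite -pweight_hom z !coef0 subnKC // eqxx.
have m2 := L_weight_gt1 g.
by rewrite /delta !E ?(leqW m2) // !mul0r subrr.
Qed.

Lemma H_coef_neq0 p b Db : hom p (H_coef p b Db) != 0.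
Proof.
apply/eqP => /(congr1 (fun q : {poly {poly C}} => q`_0`_p)) /eqP.
by rewrite coef_hom !coef0 add0n eqxx oner_eq0.
Qed.

Lemma cst_eq0 c : (cst c == 0) = (c == 0).
Proof. by rewrite !polyC_eq0. Qed.

Lemma L_class_scale D Db c f : L_class D Db f -> L_class D Db (cst c * f).
Proof.
case=> [->|[e [c0 [c1 ->]]]|[m [c0 [g ->]]]].
- by constructor 1; rewrite mulr0.
- constructor 2; split=> //; exists (c * c0), (c * c1).
  by rewrite !polyCM mulrDr mulrA.
- by constructor 3; exists m, (c * c0); rewrite !polyCM mulrA.
Qed.

Lemma H_class_scale b D Db c g : c != 0 -> H_class b D Db g -> H_class b D Db
  (cst c * g).
Proof.
move=> c0 [->|[p [g0 [g0n gp ->]]]]; first by left; rewrite mulr0.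
right; exists p, (c * g0); split=> //; first by rewrite mulf_neq0.
by rewrite !polyCM mulrA.
Qed.

Lemma list_I_L_class D Db f : list_I D Db f -> L_class D Db f /\ f != 0.
Proof.
have pm1 m : L_weight m D Db -> L_class D Db (pweight m Db) /\ pweight m Db !=
  0.
  move=> g; split; last exact: pweight_neq0 g.
  by constructor 3; exists m, 1; rewrite mul1r.
case=> [c0 c1 e n|e|e|e|e1 e2|e e1 e2].
- split; first by constructor 2; split=> //; exists c0, c1.
  apply: contraNneq n => /polyP z.
  have := z 0%N; rewrite coefD coefCM coefX coefC /= mulr0 addr0 coef0 => /eqP.
  rewrite polyC_eq0 => /eqP ->.
  have := z 1%N; rewrite coefD coefCM coefX coefC /= mulr1 add0r coef0 => /eqP.
  by rewrite polyC_eq0 => /eqP ->.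
- exact: (pm1 2).
- exact: (pm1 3).
- exact: (pm1 4).
- by apply: (pm1 5); split=> //; rewrite e1 e2; ring.
- apply: (pm1 6); split=> //; apply/root19P; exists e.
  by rewrite e1 addrC addKr.
Qed.

Definition H_class_nz b D Db g := exists p (g0 : C),
  [/\ g0 != 0, H_weight p b D Db & g = cst g0 * hom p (H_coef p b Db)].

Lemma H_class_nz_neq0 b D Db g : H_class_nz b D Db g -> g != 0.
Proof. by case=> p [g0 [n _ ->]]; rewrite mulf_neq0 ?cst_eq0 ?H_coef_neq0. Qed.

Lemma H_class_nz0 b D Db a0 : a0 != 0 -> D - Db = b -> H_class_nz b D Db (cst
  a0).
Proof.
move=> a0n e; exists 0%N, a0; split=> //; last by rewrite H_poly0 mulr1.
by split=> //; rewrite e subrr.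
Qed.

Lemma H_class_nz1 b D Db u : D - Db = b + 1 -> u = b^-1 * Db ->
  H_class_nz b D Db (dd - cst u * ll).
Proof.
move=> e ->; exists 1%N, 1; split; first exact: oner_neq0.
  by split=> //; rewrite e addrC addKr.
by rewrite H_poly1 mul1r.
Qed.

Lemma H_class_nz2 b D Db u v : D = 1 -> D - Db = b + 2%:R -> u = - (b^-1 * (1 +
  2%:R * Db)) ->
  v = - (b^-1 * Db) -> H_class_nz b D Db (dd ^+ 2 + cst u * dd * ll + cst v * ll
    ^+ 2).
Proof.
move=> D1 e -> ->; exists 2, 1; split; first exact: oner_neq0.
  by split=> //; rewrite e addrC addKr.
by rewrite H_poly2 mul1r !polyCN !mulNr.
Qed.

Lemma L_class0 D Db : L_class D Db 0. Proof. by constructor 1. Qed.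

Lemma L_class_weight m D Db c : L_weight m D Db -> L_class D Db (cst c * pweight
  m Db).
Proof. by move=> g; constructor 3; exists m, c. Qed.

Lemma list_II_parts b D Db f g :
  list_II b D Db f g \/ list_II_b_minus2 b D Db f g ->
  L_class D Db f /\ H_class_nz b D Db g.
Proof.
have nat0 n : (n.+1%:R : C) != 0 by rewrite pnatr_eq0.
case=> [[]|[]].
- by move=> a0 -> e a0n; split; [exact: L_class0|exact: H_class_nz0].
- move=> c0 c1 -> e; split.
    by constructor 2; split; [apply/eqP; rewrite -subr_eq0 e|exists c0, c1].
  rewrite (_ : _ + _ = dd - cst (- Db) * ll); last by ring.
  by apply: H_class_nz1; [rewrite e; ring | rewrite invrN1 mulN1r].
- by move=> a0 -> e a0n; split; [exact: L_class0|exact: H_class_nz0].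
- move=> c0 -> e; split; first exact: (L_class_weight (m := 2)).
  by apply: H_class_nz1; [rewrite e; ring | rewrite invr1 mul1r].
- move=> c0 -> e1 e2; split.
    by apply: (L_class_weight (m := 3)); split=> //; rewrite e1 e2; ring.
  rewrite (_ : _ + _ = dd ^+ 2 + cst 3%:R * dd * ll + cst 2%:R * ll ^+ 2);
    last by ring.
  by apply: H_class_nz2; rewrite ?e1 ?e2 //; field.
- move=> c0 a0 -> e a0n; split; first exact: (L_class_weight (m := 2)).
  exact: H_class_nz0.
- move=> c0 -> e; split; first exact: (L_class_weight (m := 3)).
  by apply: H_class_nz1; [rewrite e; ring | field].
- move=> c0 -> e1 e2; split.
    rewrite (_ : cst c0 * _ = cst c0 * pweight 4 Db); last by rewrite /= /p4 e2;
      ring.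
    by apply: (L_class_weight (m := 4)); split=> //; rewrite e1 e2; ring.
  by apply: H_class_nz2; rewrite ?e1 ?e2 //; field.
- move=> c0 a0 -> e a0n; split; first exact: (L_class_weight (m := 3)).
  exact: H_class_nz0.
- move=> c0 -> e; split; first exact: (L_class_weight (m := 4)).
  by apply: H_class_nz1; [rewrite e; ring | field].
- move=> c0 -> e1 e2; split.
    by apply: (L_class_weight (m := 5)); split=> //; rewrite e1 e2; ring.
  by apply: H_class_nz2; rewrite ?e1 ?e2 //; field.
- move=> c0 a0 -> e a0n; split; first exact: (L_class_weight (m := 4)).
  exact: H_class_nz0.
- move=> -> e; split; first exact: L_class0.
  by apply: H_class_nz1; [rewrite e; ring | field].
- move=> c0 -> e1 e2; split.
    by apply: (L_class_weight (m := 5)); split=> //; rewrite e1 e2; ring.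
  rewrite (_ : _ + _ = dd - cst (- 1) * ll); last by ring.
  by apply: H_class_nz1; rewrite ?e1 ?e2; field.
- move=> -> e1 e2; split; first exact: L_class0.
  by apply: H_class_nz2; rewrite ?e1 ?e2 //; field.
- by move=> a0 -> e a0n; split; [exact: L_class0|exact: H_class_nz0].
- move=> c0 a0 -> e1 e2 a0n; split.
    by apply: (L_class_weight (m := 5)); split=> //; rewrite e1 e2; ring.
  by apply: H_class_nz0 => //; rewrite e1 e2; ring.
- move=> -> e; split; first exact: L_class0.
  by apply: H_class_nz1; [rewrite e; ring | field].
- move=> c0 e -> e1 e2; split.
    apply: (L_class_weight (m := 6)); split=> //; apply/root19P; exists e.
    by rewrite e1 addrC addKr.
  by apply: H_class_nz1; [rewrite e2; ring | field].
- move=> -> e1 e2; split; first exact: L_class0.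
  by apply: H_class_nz2; rewrite ?e1 ?e2 //; field.
- by move=> a0 -> e a0n; split; [exact: L_class0|exact: H_class_nz0].
- move=> c0 a0 e -> e1 e2 a0n; have e3 : D - Db = 6%:R by rewrite e1 e2; field.
  split; last exact: H_class_nz0.
  apply: (L_class_weight (m := 6)); split=> //; apply/root19P; exists e.
  by rewrite e1 addrC addKr.
- move=> -> e; split; first exact: L_class0.
  by apply: H_class_nz1; [rewrite e; ring | field].
- move=> -> e1 e2; split; first exact: L_class0.
  by apply: H_class_nz2; rewrite ?e1 ?e2 //; field.
- move=> -> e; split; first exact: L_class0.
  by rewrite (_ : 1 = cst 1); [apply: H_class_nz0 => //;
    exact: oner_neq0 | rewrite !polyC1].
- move=> -> e; split; first exact: L_class0.
  rewrite (_ : _ + _ = dd - cst (- (3%:R / 2%:R * Db)) * ll); last by ring.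
  by apply: H_class_nz1; [rewrite e; field | field].
- move=> -> e1 e2; split; first exact: L_class0.
  rewrite (_ : _ - _ = dd ^+ 2 + cst (1 / 2%:R) * dd * ll + cst (- (1 / 2%:R)) *
    ll ^+ 2); last by ring.
  by apply: H_class_nz2; rewrite ?e1 ?e2 //; field.
- move=> -> e1 e2; split; first exact: L_class0.
  exists 3, 1; split; first exact: oner_neq0.
    by split; [rewrite e1 e2; field | rewrite e2].
  rewrite H_poly3 mul1r e2.
  have h1 : (- (2%:R / 3%:R))^-1 * (3%:R + 3%:R * - (2%:R / 3%:R)) = - (3%:R /
    2%:R) :> C by field.
  have h2 : (- (2%:R / 3%:R))^-1 * (1 + 3%:R * - (2%:R / 3%:R)) = 3%:R / 2%:R :>
    C by field.
  have h3 : (- (2%:R / 3%:R))^-1 * - (2%:R / 3%:R) = 1 :> C by field.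
  by rewrite h1 h2 h3; ring.
- move=> _ e; split; first exact: L_class0.
  by rewrite (_ : 1 = cst 1); [apply: H_class_nz0 => //;
    exact: oner_neq0 | rewrite !polyC1].
- move=> _ e; split; first exact: L_class0.
  by apply: H_class_nz1 => //; rewrite e addrC.
- move=> _ e1 e2; split; first exact: L_class0.
  rewrite (_ : _ - _ = dd ^+ 2 + cst (- (b^-1 + 2%:R / b * Db)) * dd * ll
    + cst (- (b^-1 * Db)) * ll ^+ 2); last by ring.
  by apply: H_class_nz2 => //; rewrite ?e1 ?e2; ring.
- move=> c0 c1 -> e1 e2; split.
    by constructor 2; split; [rewrite e1 e2|exists c0, c1].
  by apply: H_class_nz2; rewrite ?e1 ?e2 //; field.
Qed.

Lemma listed_parts b D Db f g : listed b D Db f g ->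
  [/\ L_class D Db f, H_class b D Db g & g = 0 -> f != 0].
Proof.
case=> [[c [f0 [cn I -> ->]]]|[c [f0 [g0 [cn II -> ->]]]]].
  have [F1 F2] := list_I_L_class I; split; first exact: L_class_scale.
    by left.
  by move=> _; rewrite mulf_neq0 ?cst_eq0.
have [F1 F2] := list_II_parts II; split; first exact: L_class_scale.
  by apply: H_class_scale => //; right.
by move/eqP; rewrite mulf_eq0 cst_eq0 (negPf cn) /= (negPf (H_class_nz_neq0
  F2)).
Qed.

Lemma list_II_eq b D Db f g f' g' : list_II b D Db f g -> f = f' -> g = g' ->
  list_II b D Db f' g'.
Proof. by move=> H <- <-. Qed.

Lemma natC_eq (m n : nat) : m%:R = n%:R :> C -> m = n.
Proof. by move/eqP; rewrite eqr_nat => /eqP. Qed.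

Lemma list_II_of_zero b D Db p : b != 0 -> Db != 0 -> H_weight p b D Db ->
  list_II b D Db 0 (hom p (H_coef p b Db)).
Proof.
move=> b0 Db0 [pE g]; have DE : D - Db = b + p%:R by rewrite -pE; ring.
have [|bs] := boolP (b \in b_special C); last first.
  case: p pE g DE => [|[|[|[|p]]]] // _ g DE.
  - by rewrite H_poly0; apply: II_9i => //; rewrite DE addr0.
  - by rewrite H_poly1; apply: II_9ii => //; rewrite DE addrC.
  - have DbE : Db = -1 - b by rewrite -[Db](subKr D) DE g; ring.
    by apply: (list_II_eq (II_9iii _ _ _)) => //; rewrite H_poly2 [in RHS]DbE
      [in LHS]DbE; ring.
  - by case: g bs => -> _; rewrite !inE eqxx !orbT.
rewrite !inE; case: p pE g DE => [|[|[|[|p]]]] // pE g; rewrite ?addr0 => DE.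
- rewrite H_poly0 (_ : 1 = cst 1 :> {poly {poly C}}); last by rewrite !polyC1.
  have n1 : 1 != 0 :> C by exact: oner_neq0.
  do 7?[case/orP]; move/eqP => e; rewrite e in DE *.
  + exact: II_1i.
  + exact: II_2i.
  + by apply: (list_II_eq (II_3i 0 _ _ _ (a0 := 1))) => //;
      rewrite !polyC0 mul0r.
  + by apply: (list_II_eq (II_4i 0 _ _ _ (a0 := 1))) => //;
      rewrite !polyC0 mul0r.
  + by apply: (list_II_eq (II_5i 0 _ _ _ (a0 := 1))) => //;
      rewrite !polyC0 mul0r.
  + exact: II_6i.
  + exact: II_7i.
  + by rewrite !polyC1; exact: II_8i.
- rewrite H_poly1.
  do 7?[case/orP]; move/eqP => e; rewrite e in DE *.
  + apply: (list_II_eq (II_1ii 0 0 _ _)) => //.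
    * by rewrite DE addNr.
    * by rewrite !polyC0 mul0r addr0.
    * by rewrite invrN1 mulN1r; ring.
  + apply: (list_II_eq (II_2ii 0 _ _)) => [//|//||].
    * by rewrite !polyC0 mul0r.
    * by rewrite invr1 mul1r.
  + apply: (list_II_eq (II_3ii 0 _ _)) => //.
    * by rewrite DE; ring.
    * by rewrite !polyC0 mul0r.
    * by rewrite div1r.
  + apply: (list_II_eq (II_4ii 0 _ _)) => //.
    * by rewrite DE; ring.
    * by rewrite !polyC0 mul0r.
    * by rewrite div1r.
  + apply: (list_II_eq (II_5ii _ _)) => //; last by rewrite div1r.
    by rewrite DE; ring.
  + apply: (list_II_eq (II_6ii _ _)) => //; last by rewrite div1r.
    by rewrite DE; ring.
  + apply: (list_II_eq (II_7ii _ _)) => //; last by rewrite div1r.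
    by rewrite DE; ring.
  + apply: (list_II_eq (II_8ii _ _)) => //; first by rewrite DE; field.
    rewrite (_ : (- (2%:R / 3%:R))^-1 * Db = - (3%:R / 2%:R * Db));
      last by field.
    by ring.
- have DbE : Db = -1 - b.
    have -> : Db = D - (D - Db) by ring.
    by rewrite DE g; ring.
  rewrite H_poly2 DbE.
  do 7?[case/orP]; move/eqP => e; rewrite e in DE DbE *.
  (* For b = -1 and p = 2 one would get Deltabar = 0. *)
  + by move: Db0; rewrite DbE opprK addNr eqxx.
  + apply: (list_II_eq (II_2iii 0 _ _ _)) => //.
    * by ring.
    * by rewrite !polyC0 mul0r.
    * by rewrite invr1; ring.
  + apply: (list_II_eq (II_3iii 0 _ _ _)) => //.
    * by ring.
    * by rewrite !polyC0 mul0r.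
    * by ring.
  + apply: (list_II_eq (II_4iii 0 _ _ _)) => //.
    * by ring.
    * by rewrite !polyC0 mul0r.
    * by ring.
  + apply: (list_II_eq (II_5iii _ _ _)) => //; by ring.
  + apply: (list_II_eq (II_6iii _ _ _)) => //; by ring.
  + apply: (list_II_eq (II_7iii _ _ _)) => //; by ring.
  + apply: (list_II_eq (II_8iii _ _ _)) => //; first by field.
    have -> : (- (2%:R / 3%:R))^-1 * (1 + 2%:R * (-1 - - (2%:R / 3%:R)))
      = - (1 / 2%:R) :> C by field.
    have -> : (- (2%:R / 3%:R))^-1 * (-1 - - (2%:R / 3%:R)) = 1 / 2%:R :> C by
      field.
    by ring.
- case: g => bE DbE _; apply: (list_II_eq (II_8iv _ _ _)) => //.
    have -> : D = (D - Db) + Db by ring.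
    by rewrite DE bE DbE; field.
  rewrite H_poly3 bE DbE.
  have h1 : (- (2%:R / 3%:R))^-1 * (3%:R + 3%:R * - (2%:R / 3%:R)) = - (3%:R /
    2%:R) :> C by field.
  have h2 : (- (2%:R / 3%:R))^-1 * (1 + 3%:R * - (2%:R / 3%:R)) = 3%:R / 2%:R :>
    C by field.
  have h3 : (- (2%:R / 3%:R))^-1 * - (2%:R / 3%:R) = 1 :> C by field.
  by rewrite h1 h2 h3; ring.
Qed.

End Lists.

Section Lists2.
Variable C : numClosedFieldType.
Local Notation dd := ('X%:P : {poly {poly C}}).
Local Notation ll := ('X : {poly {poly C}}).
Local Notation cst c := (c%:P%:P : {poly {poly C}}).
Implicit Types (f g : {poly {poly C}}) (b D Db : C).

(** Since m = Delta - Deltabar and p = m - b, the value of b is m - p, and finitely many pairs (m,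
    p) remain. *)
Lemma list_II_of_pweight m p b D Db c : b != 0 -> L_weight m D Db -> H_weight p
  b D Db ->
  list_II b D Db (cst c * pweight m Db) (hom p (H_coef p b Db)).
Proof.
move=> b0 gm [pE gp]; have [mE _] := gm.
have bE : b = m%:R - p%:R by rewrite -mE -pE; ring.
have cst1 : 1 = cst 1 :> {poly {poly C}} by rewrite !polyC1.
have n1 : 1 != 0 :> C by exact: oner_neq0.
have g5 : m = 5 -> D = 1 /\ Db = - 4%:R.
  move=> m5; rewrite m5 in gm mE; have [_ D1] := gm; split=> //.
  have -> : Db = D - (D - Db) by ring.
  by rewrite mE D1; ring.
have g6 : m = 6 -> exists e, D = 7%:R / 2%:R + root19 C e.
  move=> m6; rewrite m6 in gm; have [_ /root19P [e De]] := gm; exists e.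
  by rewrite -De; ring.
move: gm; case: p pE gp bE => [|[|[|[|p]]]] // pE gp bE gm.
- rewrite H_poly0 cst1; case: m mE bE g5 g6 gm => [|[|[|[|[|[|[|m]]]]]]] mE bE
    g5 g6 [_ //] gm;
    rewrite subr0 in bE; rewrite bE in pE *.
  + exact: II_3i.
  + exact: II_4i.
  + exact: II_5i.
  + by have [//|D1 Db4] := g5; exact: II_6i'.
  + have [//|e De] := g6; apply: (II_7i' _ _ De) => //.
    have -> : Db = D - (D - Db) by ring.
    by rewrite mE De; field.
- rewrite H_poly1; case: m mE bE g5 g6 gm => [|[|[|[|[|[|[|m]]]]]]] mE bE g5 g6
    [_ //] gm.
  + have {}bE : b = 1 by rewrite bE; ring.
    rewrite bE in pE *; apply: (list_II_eq (II_2ii c _ _)) => [//|//|//|].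
    by rewrite invr1 mul1r.
  + have {}bE : b = 2%:R by rewrite bE; ring.
    by rewrite bE in pE *; apply: (list_II_eq (II_3ii c _ _)) => //;
      rewrite div1r.
  + have {}bE : b = 3%:R by rewrite bE; ring.
    by rewrite bE in pE *; apply: (list_II_eq (II_4ii c _ _)) => //;
      rewrite div1r.
  + have {}bE : b = 4%:R by rewrite bE; ring.
    have [//|D1 Db4] := g5.
    rewrite bE in pE *; apply: (list_II_eq (II_5ii' c _ _ _)) => //.
    have -> : 4%:R^-1 * Db = -1 by rewrite Db4; field.
    by ring.
  + have {}bE : b = 5%:R by rewrite bE; ring.
    have [//|e De] := g6.
    by rewrite bE in pE *; apply: (list_II_eq (II_6ii' c _ De _)) => //;
      rewrite div1r.
- have DbE : Db = -1 - b.
    have -> : Db = D - (D - Db - b) - b by ring.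
    by rewrite pE gp; ring.
  rewrite H_poly2; case: m mE bE g5 g6 gm => [|[|[|[|[|[|[|m]]]]]]] mE bE g5 g6
    [_ //] gm.
  + by move: b0; rewrite bE subrr eqxx.
  + have {}bE : b = 1 by rewrite bE; ring.
    rewrite bE in pE DbE *; apply: (list_II_eq (II_2iii c _ _ _)) => //.
      by rewrite DbE; ring.
    by rewrite DbE invr1; ring.
  + have {}bE : b = 2%:R by rewrite bE; ring.
    have Db3 : Db = - 3%:R by rewrite DbE bE; ring.
    rewrite bE in pE *; apply: (list_II_eq (II_3iii c _ _ _)) => //.
      by rewrite /= /p4 Db3; ring.
    by rewrite Db3; ring.
  + have {}bE : b = 3%:R by rewrite bE; ring.
    have [//|D1 Db4] := g5.
    by rewrite bE in pE *; apply: (list_II_eq (II_4iii c _ _ _)) => //;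
      rewrite Db4; ring.
  (* For m = 6 and p = 2 the two conditions on Delta clash: (1 - 7/2)^2 is 25/4 and not 19/4. *)
  + move: gm; rewrite gp => /(congr1 (fun x : C => x * 4%:R - 19%:R)).
    have -> : (1 - 7%:R / 2%:R) ^+ 2 * 4%:R - 19%:R = 6%:R :> C by field.
    have -> : 19%:R / 4%:R * 4%:R - 19%:R = 0 :> C by field.
    by move/eqP; rewrite pnatr_eq0.
(* For p = 3 the value b = -2/3 would give 3m = 7. *)
- case: gp => b23 _; have /(congr1 (fun x : C => x * 3%:R)) : m%:R = b + 3%:R.
    by rewrite bE; ring.
  rewrite b23; have -> : (- (2%:R / 3%:R) + 3%:R) * 3%:R = 7%:R :> C by field.
  by rewrite -natrM => /natC_eq; lia.
Qed.

(** With Delta = Deltabar the degree is p = -b: p = 1 gives b = -1, p = 2 gives b = -2 with Delta =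
    1, and p = 3 contradicts b = -2/3. *)
Lemma list_II_of_linear p b D c0 c1 : b != 0 -> H_weight p b D D ->
  list_II b D D (cst c0 + cst c1 * ll) (hom p (H_coef p b D)) \/
  list_II_b_minus2 b D D (cst c0 + cst c1 * ll) (hom p (H_coef p b D)).
Proof.
move=> b0 [pE gp]; have bE : b = - p%:R by rewrite -pE; ring.
case: p pE gp bE => [|[|[|[|p]]]] // pE gp bE.
- by move: b0; rewrite bE oppr0 eqxx.
- left; rewrite H_poly1 bE; apply: (list_II_eq (II_1ii c0 c1 _ _)) => //.
    by rewrite subrr.
  by rewrite invrN1 mulN1r; ring.
- right; rewrite H_poly2 bE gp.
  have -> : (- 2%:R)^-1 * (1 + 2%:R * 1) = - (3%:R / 2%:R) :> C by field.
  have -> : (- 2%:R)^-1 * 1 = - (1 / 2%:R) :> C by field.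
  rewrite (_ : _ - _ = dd ^+ 2 + cst (3%:R / 2%:R) * dd * ll
    + cst (1 / 2%:R) * ll ^+ 2); last by ring.
  exact: II_9iii'.
- case: gp => b23; move: bE; rewrite b23 => /(congr1 (fun x : C => - x * 3%:R)).
  have -> : - - (2%:R / 3%:R) * 3%:R = 2%:R :> C by field.
  by rewrite opprK -natrM => /natC_eq.
Qed.

Lemma list_I_of_L_class D Db f : L_class D Db f -> f != 0 ->
  exists c f0, [/\ c != 0, list_I D Db f0 & f = cst c * f0].
Proof.
case=> [->|[e [c0 [c1 ->]]]|[m [c [g ->]]]]; first by rewrite eqxx.
  move=> nz; exists 1, (cst c0 + cst c1 * ll); split; first exact: oner_neq0.
    apply: I_0 => //; apply: contraNneq nz => -[-> ->].
    by rewrite !polyC0 mul0r addr0.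
  by rewrite !polyC1 mul1r.
rewrite mulf_eq0 negb_or cst_eq0 => /andP[c0 _].
exists c, (pweight m Db); split=> //.
move: g; case: m => [|[|[|[|[|[|[|m]]]]]]] [mE gm] //.
- exact: I_2.
- exact: I_3.
- exact: I_4.
- apply: I_5 => //; have -> : Db = D - (D - Db) by ring.
  by rewrite mE gm; ring.
- have /root19P [e De] := gm; apply: (@I_6 _ _ _ e) => //.
  by rewrite -De; ring.
Qed.

Lemma parts_listed b D Db f g : b != 0 -> Db != 0 -> L_class D Db f ->
  H_class b D Db g -> (g = 0 -> f != 0) -> listed b D Db f g.
Proof.
move=> b0 Db0 Ff [->|[p [g0 [g0n gp ->]]]] nz.
  have [//|c [f0 [cn I ->]]] := list_I_of_L_class Ff; first exact: nz.
  by left; exists c, f0.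
(* The common scalar normalizes the coefficient of d^p in g to 1; f is divided by it and stays in
   its class. *)
right; exists g0, (cst g0^-1 * f), (hom p (H_coef p b Db)); split=> //;
  last first.
  by rewrite mulrA -!polyCM mulfV // !polyC1 mul1r.
have := L_class_scale g0^-1 Ff; move: (cst g0^-1 * f) => {nz Ff} f1.
case=> [->|[e [c0 [c1 ->]]]|[m [c [gm ->]]]].
- by left; exact: list_II_of_zero.
- by rewrite -e in gp *; exact: list_II_of_linear.
- by left; exact: list_II_of_pweight.
Qed.

End Lists2.

(** * Assembly of the classification for arbitrary alpha *)

Section Main.
Variable C : numClosedFieldType.
Implicit Types (f g : {poly {poly C}}) (b al ab D Db : C).

Lemma E_actE al D Db f g :
  E_act al D Db f g = E0_act al al D Db (shift_d al f) (shift_d al g).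
Proof. by []. Qed.

Lemma dcob_unshift al D Db f phi : shift_d al f = dcob al al D Db phi ->
  exists psi, f = dcob 0 0 D Db psi.
Proof.
move=> e; exists (phi \Po ('X - al%:P)).
have phiE : phi = (phi \Po ('X - al%:P)) \Po ('X + al%:P).
  by have := comp_polyXaddC_K phi (- al); rewrite polyCN opprK.
move: e; rewrite {1}phiE dcob_shift => e.
by apply/polyP => n; apply: (@comp_shift_inj C al); rewrite -!coef_shift_d e.
Qed.

Lemma listed_extension b al D Db f g : b != 0 -> Db != 0 -> listed b D Db f g ->
  is_extension (W_bracket b) (M_act al Db) (M_act al D)
    (E_act al D Db f g) (@E_inj C) (@E_proj C) /\
  ~ trivial_extension (M_act al Db) (M_act al D)
    (E_act al D Db f g) (@E_inj C) (@E_proj C).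
Proof.
move=> b0 Db0 /listed_parts [Ff Gg nz]; rewrite E_actE; split.
  apply: E_is_extension; first by apply/cocL_shift; exact: L_class_cocL.
  by apply/cocH_shift; exact: H_class_cocH.
move=> /trivial_dcob [phi [/dcob_unshift [psi fE] gE]].
have g0 : g = 0.
  by apply/polyP => n; apply: (@comp_shift_inj C al);
     rewrite -coef_shift_d gE !coef0 comp_poly0.
by have := nz g0; rewrite (L_class_dcob Db0 Ff fE) eqxx.
Qed.

(** Unshifting by alpha brings the cocycles to alpha = 0, where F is normalized by a coboundary; the
    case f = g = 0 is excluded because it splits. *)
Lemma extension_listed b al D Db (E : lmodType {poly C})
    (actE : 'rV[{poly C}]_2 -> nat -> E -> E) i p : b != 0 -> Db != 0 ->
  is_extension (W_bracket b) (M_act al Db) (M_act al D) actE i p ->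
  ~ trivial_extension (M_act al Db) (M_act al D) actE i p ->
  exists f g, listed b D Db f g /\
    ext_equiv actE i p (E_act al D Db f g) (@E_inj C) (@E_proj C).
Proof.
move=> b0 Db0 /extension_normal [F [G [HF HG eq]]] ntriv.
pose f := shift_d (- al) F; pose g := shift_d (- al) G.
have FE : F = shift_d al f by rewrite shift_dK.
have GE : G = shift_d al g by rewrite shift_dK.
rewrite FE GE in HF HG eq.
have /(cocL_classification Db0) [phi [f' [fE Ff']]] := (cocL_shift _ _ _ _).1
  HF.
have /(cocH_classification b0 Db0) Gg := (cocH_shift _ _ _ _ _).1 HG.
have eq' : ext_equiv actE i p (E_act al D Db f' g) (@E_inj C) (@E_proj C).
  apply: ext_equiv_trans eq _; rewrite E_actE fE.
  have -> : shift_d al (f' + dcob 0 0 D Db phi) =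
      shift_d al f' + dcob al al D Db (phi \Po ('X + al%:P)).
    by rewrite dcob_shift (rmorphD (@shift_d C al)).
  exact: shear_equiv.
exists f', g; split=> //; apply: parts_listed => // g0.
apply/eqP => f0; apply: ntriv; apply: ext_equiv_trans eq' _.
rewrite E_actE f0 g0 (rmorph0 (@shift_d C al)); exact: split_equiv.
Qed.

Lemma extension_neq b al ab D Db (E : lmodType {poly C})
    (actE : 'rV[{poly C}]_2 -> nat -> E -> E) i p :
  is_extension (W_bracket b) (M_act ab Db) (M_act al D) actE i p ->
  ~ trivial_extension (M_act ab Db) (M_act al D) actE i p -> al = ab.
Proof.
move=> /extension_normal [F [G [HF HG eq]]] ntriv; apply/eqP/negP => /negP nab.
have [phi [FE GE]] := coc_neq nab HF HG.
by apply: ntriv; apply: ext_equiv_trans eq _; rewrite FE GE;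
  exact: dcob_trivial.
Qed.

End Main.

Theorem theorem3p7 (R : realType)
    (b alpha alphabar Delta Deltabar : complexes R)
    (b_neq0 : b != 0) (Delta_neq0 : Delta != 0) (Deltabar_neq0 : Deltabar != 0) :
  [/\ forall (E : lmodType {poly complexes R})
          (actE : 'rV[{poly complexes R}]_2 -> nat -> E -> E)
          (i : 'rV[{poly complexes R}]_1 -> E)
          (p : E -> 'rV[{poly complexes R}]_1),
        is_extension (W_bracket b)
          (M_act alphabar Deltabar) (M_act alpha Delta) actE i p ->
        ~ trivial_extension
            (M_act alphabar Deltabar) (M_act alpha Delta) actE i p ->
        alpha = alphabar,
      forall (E : lmodType {poly complexes R})
          (actE : 'rV[{poly complexes R}]_2 -> nat -> E -> E)
          (i : 'rV[{poly complexes R}]_1 -> E)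
          (p : E -> 'rV[{poly complexes R}]_1),
        is_extension (W_bracket b)
          (M_act alpha Deltabar) (M_act alpha Delta) actE i p ->
        ~ trivial_extension
            (M_act alpha Deltabar) (M_act alpha Delta) actE i p ->
        exists f g : {poly {poly complexes R}},
          listed b Delta Deltabar f g /\
          ext_equiv actE i p
            (E_act alpha Delta Deltabar f g) (@E_inj _) (@E_proj _)
    & forall f g : {poly {poly complexes R}},
        listed b Delta Deltabar f g ->
        is_extension (W_bracket b)
          (M_act alpha Deltabar) (M_act alpha Delta)
          (E_act alpha Delta Deltabar f g) (@E_inj _) (@E_proj _) /\
        ~ trivial_extension
            (M_act alpha Deltabar) (M_act alpha Delta)
            (E_act alpha Delta Deltabar f g) (@E_inj _) (@E_proj _)].
Proof.
split=> [E actE i p|E actE i p|f g].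
- exact: extension_neq.
- exact: extension_listed.
- exact: listed_extension.
Qed.
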